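(* Let $\Lambda\in\mathcal{L}$, $c\in C^0_\Lambda$, $y\in\widetilde{\mathcal{O}}_c$ and write (uniquely) $y=\mu+\hat wc$ with $\mu\in\Lambda$ and $\hat w\in W^c$. Then the quasi-polynomials $p^\pm_y=\pi^{qp}(\mathbf{1}^\pm)x^y$ are given by \begin{align*} p^+_y&=t(w_0)\sum_{w\in W^c}\Big[w_0\,\pi\big(T_{(w_0w)^{-1}}^{-1}\mathbf{1}^+_{W_c}T_{\hat w^{-1}}\big)x^\mu\Big]x^{wc},\\ p^-_y&=\frac{(-1)^{l(\hat w)}\,t(w_0(W_c))^2}{t(w_0)}\sum_{w\in W^c}(-1)^{l(w)}\Big[\iota w_0\,\pi\big(T_{w_0w}\mathbf{1}^-_{W_c}T_{\hat w}^{-1}\big)\iota x^\mu\Big]x^{wc}. \end{align*} Moreover, if $y$ is dominant ($\alpha_i(y)\ge0$ for all $i$), then for all $w\in W^c$ \begin{align*} \gamma_w\big(\iota\overline{E}^+_{-y}(q;\mathbf{t}^{-1};\tau)\big)&=t(w_0)^{-1}\cdot w_0\,\pi\big(T_{(w_0w)^{-1}}^{-1}\big)\,p^{J_c,+}_{\hat w^{-1}\mu},\\ \gamma_w\big(\iota\overline{E}^-_{-y}(q;\mathbf{t}^{-1};\tau)\big)&=(-1)^{l(\hat w)+l(w)}\,t(w_0(W_c))^2\,t(w_0)\cdot\iota w_0\,\pi(T_{w_0w})\,p^{J_c,-}_{\hat w^{-1}\mu}. \end{align*}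
   Context: Let $E$ be a Euclidean space with dual $E^*$ and $\Phi\subset E^*$ a reduced irreducible root system (in its span). For $\alpha\in\Phi$, $\alpha^\vee\in E$ is the vector with $\langle y,\alpha^\vee\rangle=2\alpha(y)/\|\alpha\|^2$ for all $y\in E$. Fix simple roots $\alpha_1,\dots,\alpha_r$ and positive roots $\Phi^+$; $W$ is the finite Weyl group, with simple reflections $s_i$, acting on $E$ by $s_\alpha(y)=y-\alpha(y)\alpha^\vee$; $l$ is the length, $w_0$ the longest element. $Q^\vee$ is the coroot lattice. $\mathcal{L}$ is the set of finitely generated abelian subgroups $\Lambda\subset E$ with $Q^\vee\subseteq\Lambda$ and $\alpha(\Lambda)\subseteq\mathbb{Z}$ for all $\alpha\in\Phi$. $\mathbb{F}$ is a field; $\mathbb{F}[E]$ is the group algebra with basis $x^y$ ($y\in E$), and $\mathbb{F}[S]$ is the span of $x^y$, $y\in S$; $W$ acts by $wx^y=x^{wy}$; $\iota$ is the linear map $x^y\mapsto x^{-y}$. $\widetilde W_\Lambda=W\ltimes\Lambda$ acts on $E$ with $\Lambda$ acting by translations. $\overline{C^+}=\{y\in E:0\le\alpha(y)\le1\ \forall\alpha\in\Phi^+\}$. $C^0_\Lambda$ is the set of $c\in\overline{C^+}$ whose stabilizer in $\widetilde W_\Lambda$ equals its stabilizer $W_c$ in $W$. $J_c=\{j:s_jc=c\}$ and $W_c=W_{J_c}=\langle s_j:j\in J_c\rangle$, with longest element $w_0(W_c)$; $W^c$ is the set of minimal length representatives of $W/W_c$. $\widetilde{\mathcal{O}}_c=\{\lambda+wc:\lambda\in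 Q^\vee,w\in W\}\subseteq\widetilde{\mathcal{O}}_{\Lambda,c}=\{\lambda+wc:\lambda\in\Lambda,w\in W\}$. For $c\in C^0_\Lambda$, $\mathbb{F}[\widetilde{\mathcal{O}}_{\Lambda,c}]$ is a free $\mathbb{F}[\Lambda]$-module with basis $x^{wc}$ ($w\in W^c$), and the coefficient functions $\gamma_w$ on it are defined by $f=\sum_{w\in W^c}\gamma_w(f)x^{wc}$. Fix a $W$-invariant map $\mathbf{t}:\Phi\to\mathbb{F}^\times$, $\alpha\mapsto t_\alpha$; $t_j=t_{\alpha_j}$, and $t(w)=t_{j_1}\cdots t_{j_k}$ for a reduced expression $w=s_{j_1}\cdots s_{j_k}$. For $f\in\mathbb{F}[\Lambda]$, $\nabla_j(f)=\frac{s_jf-f}{x^{\alpha_j^\vee}-1}$. The extended affine Hecke algebra $\widetilde{\mathcal{H}}_\Lambda$ is generated by $T_1,\dots,T_r$ and $x^\lambda$ ($\lambda\in\Lambda$) with: braid relations; $(T_j-t_j)(T_j+t_j^{-1})=0$; $x^\lambda x^\mu=x^{\lambda+\mu}$, $x^0=1$; $T_jx^\lambda-x^{s_j\lambda}T_j=(t_j-t_j^{-1})\nabla_j(x^\lambda)$. $T_w=T_{j_1}\cdots T_{j_k}$ for a reduced expression. For $J\subseteq\{1,\dots,r\}$ and $W_J=\langle s_j:j\in J\rangle$: $\mathbf{1}^+_J=\mathbf{1}^+_{W_J}=\sum_{w\in W_J}t(w)T_w$, $\mathbf{1}^-_J=\mathbf{1}^-_{W_J}=\sum_{w\in W_J}(-1)^{l(w)}t(w)^{-1}T_w$;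 $\mathbf{1}^\pm=\mathbf{1}^\pm_W$. Polynomial representation $\pi$ on $\mathbb{F}[\Lambda]$: $\pi(T_j)f=t_js_jf+(t_j-t_j^{-1})\nabla_j(f)$, $\pi(x^\mu)$ multiplication by $x^\mu$. Quasi-polynomial representation $\pi^{qp}$ on $\mathbb{F}[E]$ (preserving $\mathbb{F}[\widetilde{\mathcal{O}}_{\Lambda,c}]$): $\pi^{qp}(x^\lambda)x^y=x^{\lambda+y}$ and $\pi^{qp}(T_j)x^y=\chi_j(\alpha_j(y))x^{s_jy}+(t_j-t_j^{-1})\frac{x^{y-\lfloor\alpha_j(y)\rfloor\alpha_j^\vee}-x^y}{x^{\alpha_j^\vee}-1}$, where $\chi_j(a)=t_j$ if $a\in\mathbb{Z}$ and $\chi_j(a)=1$ otherwise. $\overline{E}^\pm_z(q;\mathbf{t};\tau)$ denotes the $q\to\infty$ limit of the (anti-)symmetric quasi-polynomial generalizations of Macdonald polynomials $E^\pm_z(q;\mathbf{t};\tau)=\pi^{qp}(\mathbf{1}^\pm)E_z(q;\mathbf{t};\tau)$ ($\tau$ a torus parameter, assumed suitably regular). Here they are needed only for anti-dominant $z$, where it is known that $\overline{E}_z=x^z$ and $\overline{E}^\pm_z(q;\mathbf{t};\tau)=\pi^{qp}(\mathbf{1}^\pm)x^z$; this may be taken as the definition. $\overline{E}^\pm_z(q;\mathbf{t}^{-1};\tau)$ is the same expression with every $t_\alpha$ replaced by $t_\alpha^{-1}$ (in $\pi^{qp}$ and in $\mathbf{1}^\pm$). Let $\lambda\in\Lambda$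 be $J$-dominant, i.e. $\alpha_j(\lambda)\ge0$ for all $j\in J$. Write uniquely $\lambda=\hat w^{-1}\mu$ with $\mu\in\Lambda$ dominant and $\hat w^{-1}$ of minimal length in its coset modulo the stabilizer of $\mu$ in $W$. Then $p^{J,+}_\lambda=\pi(\mathbf{1}^+_JT_{\hat w^{-1}})x^\mu$ and $p^{J,-}_\lambda=\pi(\mathbf{1}^-_JT_{\hat w}^{-1})\iota x^\mu$. (If $y=\mu+\hat wc$ is dominant with $\hat w\in W^c$, then $\mu$ is dominant and $\mu,\hat w$ are the data attached in this way to $\lambda=\hat w^{-1}\mu$ with $J=J_c$.) *)

(* Defs.v *)
From mathcomp Require Import all_boot all_order all_algebra finmap.
From mathcomp Require Import boolp classical_sets functions cardinality fsbigop.
From mathcomp Require Import reals monalg.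

Set Implicit Arguments.
Unset Strict Implicit.
Unset Printing Implicit Defensive.

Import Order.TTheory GRing.Theory Num.Theory.

Local Open Scope classical_set_scope.
Local Open Scope ring_scope.

(* The Euclidean space E is R^n with its standard inner product, written as
   column vectors; E^* is the space of row vectors, and linear maps of E are
   n x n matrices acting on the left. *)

Section RootSystem.
Context {R : realType} {n : nat}.
Implicit Types (Phi : {fset 'rV[R]_n}) (alpha beta : 'rV[R]_n).
Implicit Types (y c lam mu : 'cV[R]_n) (w u : 'M[R]_n) (Lam : set 'cV[R]_n).

Definition ev alpha y : R := (alpha *m y) 0 0.

Definition dualdot alpha beta : R := (alpha *m beta^T) 0 0.

Definition coroot alpha : 'cV[R]_n := (2 / dualdot alpha alpha) *: alpha^T.

(* y |-> y - alpha(y) alpha^vee *)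
Definition refl alpha : 'M[R]_n := 1%:M - coroot alpha *m alpha.

Record root_system Phi : Prop := RootSystem {
  root_neq0 : 0 \notin Phi;
  root_refl : {in Phi &, forall alpha beta,
    beta - ev beta (coroot alpha) *: alpha \in Phi};
  root_int : {in Phi &, forall alpha beta,
    ev beta (coroot alpha) \is a Num.int} }.

Definition reduced_roots Phi : Prop :=
  {in Phi &, forall alpha beta (k : R),
    beta = k *: alpha -> beta = alpha \/ beta = - alpha}.

Definition irreducible_roots Phi : Prop :=
  Phi <> fset0 /\
  forall A B : {fset 'rV[R]_n}, Phi = (A `|` B)%fset ->
    {in A & B, forall alpha beta, dualdot alpha beta = 0} ->
    A = fset0 \/ B = fset0.

Definition weyl Phi : set 'M[R]_n :=
  [set w | exists2 s : seq 'rV[R]_n,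
     {subset s <= Phi} & w = \prod_(alpha <- s) refl alpha].

Definition stab Phi c : set 'M[R]_n := [set w | weyl Phi w /\ w *m c = c].

Definition Qvee Phi : set 'cV[R]_n :=
  [set y | inIntSpan (in_tuple [seq coroot alpha | alpha <- Phi]) y].

(* membership in the family written as a calligraphic L *)
Definition in_calL Phi Lam : Prop :=
  [/\ exists m (s : m.-tuple 'cV[R]_n), Lam = [set y | inIntSpan s y],
      Qvee Phi `<=` Lam
    & forall alpha lam, alpha \in Phi -> Lam lam ->
        ev alpha lam \is a Num.int].

(* {lam + w c : lam in Lam, w in W} *)
Definition orbit_set Phi Lam c : set 'cV[R]_n :=
  [set y | exists lam w, [/\ Lam lam, weyl Phi w & y = lam + w *m c]].

Section SimpleRoots.
Variables (r : nat) (a : 'I_r -> 'rV[R]_n).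
Implicit Types (J : set 'I_r).

Definition positive_root Phi beta : Prop :=
  beta \in Phi /\ exists k : 'I_r -> nat, beta = \sum_i a i *+ k i.

Record simple_roots Phi : Prop := SimpleRoots {
  simple_in : forall i, a i \in Phi;
  simple_free : row_free (\matrix_(i < r) a i);
  simple_sign : {in Phi, forall beta,
    positive_root Phi beta \/ positive_root Phi (- beta)} }.

Definition dominant y : Prop := forall i, 0 <= ev (a i) y.

Definition word (s : seq 'I_r) : 'M[R]_n := \prod_(j <- s) refl (a j).

Definition parabolic J : set 'M[R]_n :=
  [set w | exists2 s : seq 'I_r, (forall j, j \in s -> J j) & w = word s].

(* A chosen reduced expression; everything defined from it below is
   independent of the choice. *)
Definition redword w : seq 'I_r :=
  xget [::] [set s | word s = w /\
                     forall s', word s' = w -> (size s <= size s')%N].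

Definition len w : nat := size (redword w).

Definition longest (A : set 'M[R]_n) : 'M[R]_n :=
  xget 1%:M [set w | A w /\ forall u, A u -> (len u <= len w)%N].

(* minimal length representatives of W / stab c *)
Definition mincoset Phi c : set 'M[R]_n :=
  [set w | weyl Phi w /\ forall u, stab Phi c u -> (len w <= len (w *m u))%N].

Definition closed_alcove Phi : set 'cV[R]_n :=
  [set y | forall alpha, positive_root Phi alpha -> 0 <= ev alpha y <= 1].

(* The pair (lam, w) stands for the element y |-> lam + w y of the extended
   affine Weyl group; W is the set of pairs (0, w). *)
Definition C0 Phi Lam : set 'cV[R]_n :=
  [set c | closed_alcove Phi c /\
     [set p : 'cV[R]_n * 'M[R]_n |
        [/\ Lam p.1, weyl Phi p.2 & p.1 + p.2 *m c = c]] =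
     [set p | p.1 = 0 /\ stab Phi c p.2]].

Definition Jfix c : set 'I_r := [set j | refl (a j) *m c = c].

(* The pair (mu, hw) with mu in Lam dominant, lam = hw^-1 mu, and hw^-1 of
   minimal length modulo the stabilizer of mu. *)
Definition dominant_data Phi Lam lam : 'cV[R]_n * 'M[R]_n :=
  xget (0, 1%:M) [set p | [/\ Lam p.1, dominant p.1, weyl Phi p.2,
                           mincoset Phi p.1 (invmx p.2)
                         & lam = invmx p.2 *m p.1]].

End SimpleRoots.
End RootSystem.

Section GroupAlgebra.
Context {R : realType} {n : nat} {F : fieldType}.

Local Notation galg := {malg F['cV[R]_n]}.
Implicit Types (f g : galg) (y : 'cV[R]_n).

Definition xx y : galg := << y >>.

(* The ring structure of monalg is only available for conical monoids of
   exponents, so the product of F[E] is written out. *)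
Definition gmul f g : galg :=
  \sum_(y <- msupp f) \sum_(z <- msupp g) (f@_y * g@_z) *: xx (y + z).

(* F[S] *)
Definition gsub (S : set 'cV[R]_n) : set galg :=
  [set f | forall y, y \in msupp f -> S y].

(* linear extension of x^y |-> x^(phi y) *)
Definition gmap (phi : 'cV[R]_n -> 'cV[R]_n) f : galg :=
  \sum_(y <- msupp f) f@_y *: xx (phi y).

Definition gact (w : 'M[R]_n) f : galg := gmap (mulmx w) f.

Definition iota_alg f : galg := gmap -%R f.

(* f / g, for f divisible by g <> 0; unique since F[E] is a domain *)
Definition gdiv f g : galg := xget 0 [set h | gmul h g = f].

End GroupAlgebra.

Notation galg R n F := {malg F['cV[R]_n]}.

Section Hecke.
Context {R : realType} {n : nat} {F : fieldType}.
Implicit Types (Phi : {fset 'rV[R]_n}) (t : 'rV[R]_n -> F).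
Implicit Types (Lam : set 'cV[R]_n) (y c lam mu : 'cV[R]_n) (w u : 'M[R]_n).

(* W acts on E^* by (w alpha)(y) = alpha(w^-1 y). *)
Definition weyl_invariant Phi t : Prop :=
  (forall alpha, alpha \in Phi -> t alpha != 0) /\
  (forall alpha w, alpha \in Phi -> weyl Phi w ->
     t (alpha *m invmx w) = t alpha).

Definition tinv t : 'rV[R]_n -> F := fun alpha => (t alpha)^-1.

Section Simple.
Variables (r : nat) (a : 'I_r -> 'rV[R]_n).

Definition nabla (j : 'I_r) (f : galg R n F) : galg R n F :=
  gdiv (gact (refl (a j)) f - f) (xx (coroot (a j)) - xx 0).

Definition tlen t w : F := \prod_(j <- redword a w) t (a j).

(* i, j, i, ... with m letters *)
Definition alternating (i j : 'I_r) (m : nat) : seq 'I_r :=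
  [seq (if odd k then j else i) | k <- iota 0 m].

Definition has_order w (m : nat) : Prop :=
  [/\ (0 < m)%N, w ^+ m = 1
    & forall k, (0 < k < m)%N -> w ^+ k <> 1].

Record hecke_relations Lam t (H : algType F) (T : 'I_r -> H)
    (X : 'cV[R]_n -> H) : Prop := HeckeRelations {
  hecke_braid : forall i j m, i != j ->
    has_order (refl (a i) *m refl (a j)) m ->
    \prod_(k <- alternating i j m) T k = \prod_(k <- alternating j i m) T k;
  hecke_quadratic : forall j,
    (T j - (t (a j))%:A) * (T j + (t (a j))^-1%:A) = 0;
  hecke_xD : forall lam mu, Lam lam -> Lam mu -> X lam * X mu = X (lam + mu);
  hecke_x0 : X 0 = 1;
  hecke_cross : forall j lam, Lam lam ->
    T j * X lam - X (refl (a j) *m lam) * T j =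
    (t (a j) - (t (a j))^-1) *:
      (let f := nabla j (xx lam) in \sum_(y <- msupp f) f@_y *: X y) }.

(* (H, T, X) is the algebra presented by the generators T_j, x^lam
   (lam in Lam) and the relations above; X is irrelevant outside Lam. *)
Definition affine_hecke Lam t (H : algType F) (T : 'I_r -> H)
    (X : 'cV[R]_n -> H) : Prop :=
  hecke_relations Lam t T X /\
  forall (B : algType F) (T' : 'I_r -> B) (X' : 'cV[R]_n -> B),
    hecke_relations Lam t T' X' ->
    exists phi : {lrmorphism H -> B},
      let extends (psi : H -> B) :=
        (forall j, psi (T j) = T' j) /\
        (forall lam, Lam lam -> psi (X lam) = X' lam) in
      extends phi /\
      forall psi : {lrmorphism H -> B}, extends psi -> psi =1 phi.

Section Elements.
Variables (H : algType F) (T : 'I_r -> H) (X : 'cV[R]_n -> H).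

Definition Tw w : H := \prod_(j <- redword a w) T j.

(* two-sided inverse of an invertible element *)
Definition hinv (h : H) : H := xget 0 [set g | g * h = 1 /\ h * g = 1].

Definition symmetrizer t (A : set 'M[R]_n) : H :=
  \sum_(w \in A) tlen t w *: Tw w.

Definition antisymmetrizer t (A : set 'M[R]_n) : H :=
  \sum_(w \in A) ((-1) ^+ len a w / tlen t w) *: Tw w.

(* H-module structures on the subspace V of F[E] *)
Record is_rep (V : set (galg R n F))
    (rho : H -> galg R n F -> galg R n F) : Prop := IsRep {
  rep_stable : forall h f, V f -> V (rho h f);
  rep_linear : forall h k f g, V f -> V g ->
    rho h (k *: f + g) = k *: rho h f + rho h g;
  rep_linearH : forall k h h' f, V f ->
    rho (k *: h + h') f = k *: rho h f + rho h' f;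
  rep_one : forall f, V f -> rho 1 f = f;
  rep_mul : forall h h' f, V f -> rho (h * h') f = rho h (rho h' f) }.

Record polynomial_rep Lam t (rho : H -> galg R n F -> galg R n F) : Prop :=
  PolynomialRep {
  poly_rep : is_rep (gsub Lam) rho;
  poly_rep_T : forall j f, gsub Lam f ->
    rho (T j) f = t (a j) *: gact (refl (a j)) f +
                  (t (a j) - (t (a j))^-1) *: nabla j f;
  poly_rep_X : forall mu f, Lam mu -> gsub Lam f ->
    rho (X mu) f = gmul (xx mu) f }.

Definition chi t (j : 'I_r) (b : R) : F :=
  if b \is a Num.int then t (a j) else 1.

Record quasipolynomial_rep Lam t (rho : H -> galg R n F -> galg R n F) :
  Prop := QuasipolynomialRep {
  qp_rep : is_rep setT rho;
  qp_rep_T : forall j y,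
    rho (T j) (xx y) =
      chi t j (ev (a j) y) *: xx (refl (a j) *m y) +
      (t (a j) - (t (a j))^-1) *:
        gdiv (xx (y - coroot (a j) *~ Num.floor (ev (a j) y)) - xx y)
             (xx (coroot (a j)) - xx 0);
  qp_rep_X : forall lam y, Lam lam -> rho (X lam) (xx y) = xx (lam + y) }.

(* p^(J,+)_lam and p^(J,-)_lam, where rho is the polynomial representation *)
Definition parab_plus Phi Lam t (rho : H -> galg R n F -> galg R n F)
    (J : set 'I_r) lam : galg R n F :=
  let: (mu, hw) := dominant_data a Phi Lam lam in
  rho (symmetrizer t (parabolic a J) * Tw (invmx hw)) (xx mu).

Definition parab_minus Phi Lam t (rho : H -> galg R n F -> galg R n F)
    (J : set 'I_r) lam : galg R n F :=
  let: (mu, hw) := dominant_data a Phi Lam lam in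
  rho (antisymmetrizer t (parabolic a J) * hinv (Tw hw)) (iota_alg (xx mu)).

(* p^+_y and p^-_y, where rho is the quasi-polynomial representation *)
Definition qp_plus Phi t (rho : H -> galg R n F -> galg R n F) y :=
  rho (symmetrizer t (weyl Phi)) (xx y).

Definition qp_minus Phi t (rho : H -> galg R n F -> galg R n F) y :=
  rho (antisymmetrizer t (weyl Phi)) (xx y).

(* The q -> oo limits of the (anti-)symmetric quasi-polynomial generalizations
   of Macdonald polynomials, for anti-dominant z only: there the limit of E_z
   is x^z, and nothing depends on q and tau. *)
Definition Ebar_plus Phi t (rho : H -> galg R n F -> galg R n F) z :=
  rho (symmetrizer t (weyl Phi)) (xx z).

Definition Ebar_minus Phi t (rho : H -> galg R n F -> galg R n F) z :=
  rho (antisymmetrizer t (weyl Phi)) (xx z).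

End Elements.

(* The coefficients in f = sum_(w in W^c) gamma_w(f) x^(wc), gamma_w(f) in
   F[Lam]; meaningful for c in C0, f in F[orbit_set Phi Lam c], w in W^c. *)
Definition gamma Phi Lam c w (f : galg R n F) : galg R n F :=
  xget (fun=> 0)
    [set g : 'M[R]_n -> galg R n F |
       (forall v, mincoset a Phi c v -> gsub Lam (g v)) /\
       f = \sum_(v \in mincoset a Phi c) gmul (g v) (xx (v *m c))] w.

End Simple.
End Hecke.

(* Main.v *)
(* Over F[Lam] the module F[O], O = Lam + W c, is free on the x^(w c), w in W^c.
   Write S for one of the symmetrizers 1^+, 1^-; it satisfies
   T_j S = e_j S = S T_j with e = t for 1^+ and e = - 1/t for 1^-.
   Since x^y = x^mu T_hw x^c, the cross relation and S T_j = e_j S allow T_hw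
   to be moved onto x^mu, so that p_y = S (f x^c) with f in F[Lam] obtained from
   x^mu by the polynomial representation.  The coefficient of S (f x^c) at
   w_0 c involves only the longest coset representative and can be read off.
   Comparing coefficients at w c in T_j p_y = e_j p_y expresses the coefficient
   at w c through the one at s_j w c, up to the action of T_j twisted by w_0
   (for 1^+) or by - w_0 (for 1^-); descending from w_0 c along reduced words
   gives both formulas.
   For the last part, conjugation by iota turns the action of T_j at the
   parameters t^-1 into that of T_j^-1 at t, and
   sum_w t(w)^-1 T_(w^-1)^-1 = t(w_0)^-2 1^+, so the limits are the p_y up to a
   scalar. *)

Require Import Defs.
From HB Require Import structures.
From mathcomp Require Import all_boot all_order all_algebra finmap.
From mathcomp Require Import boolp classical_sets functions cardinality fsbigop.
From mathcomp Require Import reals monalg.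
From mathcomp Require Import zify ring lra.

Set Implicit Arguments.
Unset Strict Implicit.
Unset Printing Implicit Defensive.

Import Order.TTheory GRing.Theory Num.Theory.

Local Open Scope classical_set_scope.
Local Open Scope ring_scope.

(** * The group algebra *)

(** Lengths are handled geometrically. Fix a vector [v0] inside the fundamental chamber and count
    the walls separating a point from [v0]. At [w *m v0] the count is the length; at [w *m c] it
    equals the length exactly when w is a minimal coset representative; weighted by t it gives t(w).
    It also makes the coefficient at w_0 c readable: that orbit point is separated by the most
    walls, so a word reaching it cannot waste a letter. Both symmetrizers are one object, attached
    to a W-invariant weight e with e^2 = (t - t^-1) e + 1, whose roots are t and -t^-1. The square
    of t(w_0(W_c)) in the formula for p^- arises at the top coefficient: the representative w_0
    w_0(W_c) has weight e(w_0) / e(w_0(W_c)), and T at w_0(W_c) acts on the symmetrizer of W_c by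
    e(w_0(W_c)). For p^+ it is the inverse of T that occurs, and the two contributions cancel.
    Identities between quotients by x^al - 1 are checked after multiplying by x^al - 1, which is
    injective because supports are finite. *)

(* F[E] through its universal property.  Proofs are carried out for an abstract
   value of this record, because unification tends to unfold elements of
   {malg F['cV[R]_n]} down to finite maps. *)
Record freeModule (R : realType) (n : nat) (F : fieldType) := FreeModule {
  fcar :> lmodType F;
  fx : 'cV[R]_n -> fcar;
  fext : ('cV[R]_n -> fcar) -> fcar -> fcar;
  fcoef : 'cV[R]_n -> fcar -> F;
  fextP : forall G k f g, fext G (k *: f + g) = k *: fext G f + fext G g;
  fext_x : forall G y, fext G (fx y) = G y;
  fcoefP : forall y k f g, fcoef y (k *: f + g) = k * fcoef y f + fcoef y g;
  fcoef_x : forall y z, fcoef z (fx y) = (y == z)%:R;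
  fcoef_inj : forall f g, (forall y, fcoef y f = fcoef y g) -> f = g;
  free_ind : forall P : fcar -> Prop, P 0 ->
    (forall k y f, P f -> P (k *: fx y + f)) -> forall f, P f }.

Section FreeModuleTheory.
Context {R : realType} {n : nat} {F : fieldType} {A : freeModule R n F}.
Local Notation V := 'cV[R]_n.
Local Notation xx := (@fx R n F A).
Implicit Types (f g h : A) (x y z : V) (S : set V) (k : F) (w : 'M[R]_n).

HB.instance Definition _ (G : V -> A) :=
  GRing.isLinear.Build F A A *:%R (fext G) (fextP G).

HB.instance Definition _ y :=
  GRing.isLinear.Build F A F *%R (fcoef y) (fcoefP y).

Definition fsupp S : set A := [set f | forall y, fcoef y f != 0 -> S y].

Lemma fsupp0 S : fsupp S (0 : A).
Proof. by move=> y; rewrite linear0 eqxx. Qed.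

Lemma fsuppZD S k f g : fsupp S f -> fsupp S g -> fsupp S (k *: f + g).
Proof.
move=> Sf Sg y; rewrite fcoefP => nz.
have [fy|/Sf//] := eqVneq (fcoef y f) 0; apply: Sg; apply: contraNneq nz => gy.
by rewrite fy gy mulr0 addr0.
Qed.

Lemma fsuppZ S k f : fsupp S f -> fsupp S (k *: f).
Proof. by move=> Sf; rewrite -[_ *: _]addr0; apply: fsuppZD => //; apply: fsupp0. Qed.

Lemma fsuppD S f g : fsupp S f -> fsupp S g -> fsupp S (f + g).
Proof. by move=> Sf Sg; rewrite -[f]scale1r; apply: fsuppZD. Qed.

Lemma fsuppN S f : fsupp S f -> fsupp S (- f).
Proof. by move=> Sf; rewrite -scaleN1r; apply: fsuppZ. Qed.

Lemma fsuppB S f g : fsupp S f -> fsupp S g -> fsupp S (f - g).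
Proof. by move=> Sf Sg; apply: fsuppD => //; apply: fsuppN. Qed.

Lemma fsupp_x S y : S y -> fsupp S (xx y).
Proof.
move=> Sy z; rewrite fcoef_x.
by case: (y =P z) => [<-//|_]; rewrite eqxx.
Qed.

Lemma fsupp_sum S (I : Type) (s : seq I) (P : pred I) (G : I -> A) :
  (forall i, P i -> fsupp S (G i)) -> fsupp S (\sum_(i <- s | P i) G i).
Proof.
move=> h; apply: big_ind => //; first exact: fsupp0.
by move=> f g; apply: fsuppD.
Qed.

Lemma finite_coef f : exists s : seq V, forall y, fcoef y f != 0 -> y \in s.
Proof.
elim/free_ind: f => [|k y f [s sP]].
  by exists [::] => y; rewrite linear0 eqxx.
exists (y :: s) => z; rewrite fcoefP fcoef_x inE.
case: (y =P z) => [->|_]; rewrite ?eqxx //.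
by rewrite mulr0 add0r => /sP ->; rewrite orbT.
Qed.

Lemma f_sum f : exists (s : seq V) , uniq s /\ f = \sum_(y <- s) fcoef y f *: xx y.
Proof.
have [s sP] := finite_coef f; exists (undup s); split; first exact: undup_uniq.
apply: fcoef_inj => z; rewrite raddf_sum /=.
have [zs|zs] := boolP (z \in undup s).
  rewrite (bigD1_seq z) ?undup_uniq //= linearZ /= fcoef_x eqxx mulr1 big1 ?addr0 //.
  by move=> y /negPf yz; rewrite linearZ /= fcoef_x yz mulr0.
rewrite big_seq big1 => [|y ys].
  by apply/eqP; apply: contraNT zs => /sP; rewrite mem_undup.
rewrite linearZ /= fcoef_x; case: eqP => [yz|]; last by rewrite mulr0.
by move: zs; rewrite -yz ys.
Qed.

Lemma fsupp_ind S (P : A -> Prop) :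
  P 0 ->
  (forall k y f, S y -> fsupp S f -> P f -> P (k *: xx y + f)) ->
  forall f, fsupp S f -> P f.
Proof.
move=> P0 PD f Sf; have [s [_ ->]] := f_sum f.
suff [//] : P (\sum_(y <- s) fcoef y f *: xx y) /\ fsupp S (\sum_(y <- s) fcoef y f *: xx y).
elim: s => [|y s [IHs1 IHs2]]; first by rewrite big_nil; split => //; apply: fsupp0.
rewrite big_cons; have [->|/Sf Sy] := eqVneq (fcoef y f) 0; first by rewrite scale0r add0r.
by split; [apply: PD | apply: fsuppZD => //; apply: fsupp_x].
Qed.

(** Allowing any matrix [w] lets one operator cover the Weyl group action, iota (for -1) and the
    composite [- w0]. *)
Definition wact w : A -> A := fext (fun y => xx (w *m y)).

HB.instance Definition _ w := GRing.Linear.copy (wact w) (fext (fun y => xx (w *m y))).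

Lemma wact_x w y : wact w (xx y) = xx (w *m y).
Proof. by rewrite /wact fext_x. Qed.

Lemma wactP w k f g : wact w (k *: f + g) = k *: wact w f + wact w g.
Proof. exact: linearP. Qed.

Lemma wactM w w' f : wact (w *m w') f = wact w (wact w' f).
Proof.
elim/free_ind: f => [|k y f IH]; first by rewrite !linear0.
by rewrite !wactP IH !wact_x mulmxA.
Qed.

Lemma wact1 f : wact 1%:M f = f.
Proof.
elim/free_ind: f => [|k y f IH]; first by rewrite linear0.
by rewrite wactP IH wact_x mul1mx.
Qed.

Lemma fsupp_wact S S' w f :
  (forall y, S y -> S' (w *m y)) -> fsupp S f -> fsupp S' (wact w f).
Proof.
move=> wS; move: f; apply: fsupp_ind => [|k y f Sy Sf IH].
  by rewrite linear0; apply: fsupp0.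
by rewrite wactP wact_x; apply: fsuppZD => //; apply: fsupp_x; apply: wS.
Qed.

Definition tr z : A -> A := fext (fun y => xx (y + z)).

HB.instance Definition _ z := GRing.Linear.copy (tr z) (fext (fun y => xx (y + z))).

Lemma trP z k f g : tr z (k *: f + g) = k *: tr z f + tr z g.
Proof. exact: linearP. Qed.

Lemma tr_x z y : tr z (xx y) = xx (y + z).
Proof. by rewrite /tr fext_x. Qed.

Definition gprod f g : A := fext (fun y => tr y g) f.

Lemma gprodPl k f g h : gprod (k *: f + g) h = k *: gprod f h + gprod g h.
Proof. exact: fextP. Qed.

Lemma gprod0l h : gprod 0 h = 0. Proof. exact: linear0. Qed.
Lemma gprodDl f g h : gprod (f + g) h = gprod f h + gprod g h.
Proof. exact: linearD. Qed.
Lemma gprodZl k f h : gprod (k *: f) h = k *: gprod f h.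
Proof. by rewrite /gprod linearZ. Qed.

Lemma gprodPr f k g h : gprod f (k *: g + h) = k *: gprod f g + gprod f h.
Proof.
elim/free_ind: f => [|l y f IH]; first by rewrite !gprod0l scaler0 addr0.
rewrite !gprodPl IH /gprod !fext_x trP !scalerDr !scalerA (mulrC l k).
by rewrite addrACA.
Qed.

HB.instance Definition _ f :=
  GRing.isLinear.Build F A A *:%R (gprod f) (gprodPr f).

Lemma gprod_xl y f : gprod (xx y) f = tr y f.
Proof. by rewrite /gprod fext_x. Qed.

Lemma gprod_xx y z : gprod (xx y) (xx z) = xx (y + z).
Proof. by rewrite gprod_xl tr_x addrC. Qed.

Lemma gprod_xr f z : gprod f (xx z) = tr z f.
Proof.
elim/free_ind: f => [|k y f IH]; first by rewrite gprod0l linear0.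
by rewrite gprodPl trP IH gprod_xx tr_x.
Qed.

Lemma fcoef_tr z f y : fcoef y (tr z f) = fcoef (y - z) f.
Proof.
elim/free_ind: f => [|k x f IH]; first by rewrite !linear0.
rewrite trP tr_x !fcoefP IH !fcoef_x.
by rewrite [x == _]eq_sym subr_eq [y == _]eq_sym.
Qed.

Lemma tr0 f : tr 0 f = f.
Proof. by apply: fcoef_inj => y; rewrite fcoef_tr subr0. Qed.

Lemma trD x y f : tr x (tr y f) = tr (x + y) f.
Proof. by apply: fcoef_inj => z; rewrite !fcoef_tr opprD addrA. Qed.

Lemma wact_tr w f z : wact w (tr z f) = tr (w *m z) (wact w f).
Proof.
elim/free_ind: f => [|k x f IH]; first by rewrite !linear0.
by rewrite trP !wactP trP IH tr_x !wact_x tr_x mulmxDr.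
Qed.

(** A nonzero coefficient at [y] would force nonzero ones at all [y - al *+ i], against finiteness
    of the support. The scalar [k] makes this cover the factor t^2 x^al - 1 as well as x^al - 1. *)
Lemma scaled_tr_eq0 k f al : al != 0 -> k != 0 -> k *: tr al f = f -> f = 0.
Proof.
move=> al0 k0 fE; apply: fcoef_inj => y; rewrite linear0; apply/eqP/contraT => fy.
have fN (i : nat) : fcoef (y - al *+ i) f != 0.
  elim: i => [|i IHi]; first by rewrite mulr0n subr0.
  apply: contraNneq IHi => fi.
  rewrite -fE linearZ /= fcoef_tr -addrA -opprD -mulrSr.
  by rewrite fi mulr0.
have inj (i j : nat) : y - al *+ i = y - al *+ j -> i = j.
  move/addrI/oppr_inj/eqP; rewrite -!scaler_nat -subr_eq0 -scalerBl scaler_eq0.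
  by rewrite (negPf al0) orbF subr_eq0 eqr_nat => /eqP.
have [s sP] := finite_coef f.
have u : uniq [seq y - al *+ i | i <- iota 0 (size s).+1].
  by rewrite map_inj_uniq ?iota_uniq // => i j /inj.
have := @uniq_leq_size _ _ s u.
by rewrite size_map size_iota ltnn => -> // z /mapP[i _ ->]; apply: sP.
Qed.

(** Multiplication by x^al - 1, the denominator of the divided differences. *)
Definition tB al f : A := tr al f - f.

Lemma tBP al k f g : tB al (k *: f + g) = k *: tB al f + tB al g.
Proof. by rewrite /tB trP opprD addrACA -scalerBr. Qed.

HB.instance Definition _ al :=
  GRing.isLinear.Build F A A *:%R (tB al) (tBP al).

Lemma tB_inj al : al != 0 -> injective (tB al).
Proof.
move=> al0 h h' E; apply/eqP; rewrite -subr_eq0; apply/eqP.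
apply: (@scaled_tr_eq0 1 _ al) => //; first exact: oner_neq0.
by apply/eqP; rewrite scale1r -subr_eq0 -/(tB al _) linearB /= E subrr.
Qed.

End FreeModuleTheory.

(** * Root systems and Weyl groups *)

Section Reflections.
Context {R : realType} {n : nat}.
Implicit Types (al be : 'rV[R]_n) (x y z : 'cV[R]_n) (w : 'M[R]_n) (k : R).

Lemma evM be w z : ev (be *m w) z = ev be (w *m z).
Proof. by rewrite /ev mulmxA. Qed.

Lemma evDr be x y : ev be (x + y) = ev be x + ev be y.
Proof. by rewrite /ev mulmxDr mxE. Qed.

Lemma evNr be x : ev be (- x) = - ev be x.
Proof. by rewrite /ev mulmxN mxE. Qed.

Lemma evZr be k x : ev be (k *: x) = k * ev be x.
Proof. by rewrite /ev -scalemxAr mxE. Qed.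

Lemma ev0r be : ev be 0 = 0.
Proof. by rewrite /ev mulmx0 mxE. Qed.

Lemma evNl be x : ev (- be) x = - ev be x.
Proof. by rewrite /ev mulNmx mxE. Qed.

Lemma evDl al be x : ev (al + be) x = ev al x + ev be x.
Proof. by rewrite /ev mulmxDl mxE. Qed.

Lemma evBl al be x : ev (al - be) x = ev al x - ev be x.
Proof. by rewrite evDl evNl. Qed.

Lemma evZl be k x : ev (k *: be) x = k * ev be x.
Proof. by rewrite /ev -scalemxAl mxE. Qed.

Lemma ev_suml (I : Type) (s : seq I) (G : I -> 'rV[R]_n) x :
  ev (\sum_(i <- s) G i) x = \sum_(i <- s) ev (G i) x.
Proof. by rewrite /ev mulmx_suml summxE. Qed.

Lemma dualdot_gt0 al : al != 0 -> 0 < dualdot al al.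
Proof.
move=> al0; rewrite /dualdot mxE lt_def; apply/andP; split; last first.
  by apply: sumr_ge0 => i _; rewrite mxE -expr2 sqr_ge0.
apply: contraNneq al0 => s0; apply/eqP/rowP => i; rewrite mxE.
have al2_ge0 j : xpredT j -> 0 <= al 0 j * al^T j 0 by rewrite mxE -expr2 sqr_ge0.
by apply/eqP; rewrite -sqrf_eq0 expr2 -{2}(trmxK al) mxE (psumr_eq0P al2_ge0 s0).
Qed.

Lemma ev_coroot al be : ev be (coroot al) = 2 / dualdot al al * dualdot be al.
Proof. by rewrite /coroot evZr. Qed.

Lemma ev_corootxx al : al != 0 -> ev al (coroot al) = 2.
Proof.
by move=> /dualdot_gt0 al0; rewrite ev_coroot divfK // gt_eqF.
Qed.

Lemma corootN al : coroot (- al) = - coroot al.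
Proof.
by rewrite /coroot /dualdot linearN /= mulNmx mulmxN opprK scalerN.
Qed.

Lemma mx11_mull k (A : 'M[R]_(1, n)) : k%:M *m A = k *: A.
Proof. by rewrite mul_scalar_mx. Qed.

Lemma reflE al z : refl al *m z = z - ev al z *: coroot al.
Proof.
rewrite /refl mulmxBl mul1mx -mulmxA [al *m z]mx11_scalar.
by rewrite mul_mx_scalar.
Qed.

Lemma mul_refl be al : be *m refl al = be - ev be (coroot al) *: al.
Proof.
by rewrite /refl mulmxBr mulmx1 mulmxA [be *m coroot al]mx11_scalar mx11_mull.
Qed.

Lemma refl_tr al : (refl al)^T = refl al.
Proof.
rewrite /refl linearB /= tr_scalar_mx trmx_mul /coroot linearZ /= trmxK.
by rewrite -scalemxAr -scalemxAl.
Qed.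

Lemma reflN al : refl (- al) = refl al.
Proof. by rewrite /refl corootN mulNmx mulmxN opprK. Qed.

Lemma reflK al : al != 0 -> refl al *m refl al = 1%:M.
Proof.
move=> al0; rewrite {2}/refl mulmxBr mulmx1 mulmxA reflE ev_corootxx //.
by rewrite scaler_nat mulr2n opprD addrA subrr add0r mulNmx opprK subrK.
Qed.

Lemma refl_orth be w : w *m w^T = 1%:M -> w^T *m w = 1%:M ->
  coroot (be *m w) = w^T *m coroot be /\
  refl be *m w = w *m refl (be *m w).
Proof.
move=> wwT wTw.
have dE : dualdot (be *m w) (be *m w) = dualdot be be.
  by rewrite /dualdot trmx_mul mulmxA -(mulmxA be) wwT mulmx1.
have cE : coroot (be *m w) = w^T *m coroot be.
  by rewrite /coroot dE trmx_mul scalemxAr.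
split=> //; rewrite /refl cE mulmxBr mulmxBl mul1mx mulmx1 !mulmxA wwT mul1mx.
by [].
Qed.

End Reflections.

(** Such a vector plays the role of the half sum of positive coroots: its pairing with a root is the
    height, so positivity of a root becomes the sign of a number. *)
Lemma exists_regular (R : realType) (n : nat) (Phi : {fset 'rV[R]_n}) (r : nat)
    (a : 'I_r -> 'rV[R]_n) :
  simple_roots a Phi -> exists v0 : 'cV[R]_n, forall i, ev (a i) v0 = 1.
Proof.
move=> /simple_free/row_freeP[B AB].
exists (B *m const_mx 1) => i; rewrite /ev mulmxA.
have -> : a i = row i (\matrix_(i < r) a i) by rewrite rowK.
by rewrite -row_mul AB row1 -rowE !mxE.
Qed.

Record root_datum (R : realType) (n : nat) (Phi : {fset 'rV[R]_n}) (r : nat)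
    (a : 'I_r -> 'rV[R]_n) (v0 : 'cV[R]_n) : Prop := RootDatum {
  rd_rs : root_system Phi;
  rd_red : reduced_roots Phi;
  rd_simple : simple_roots a Phi;
  rd_v0 : forall i, ev (a i) v0 = 1 }.

Section RootCombinatorics.
Context {R : realType} {n : nat} {Phi : {fset 'rV[R]_n}}.
Context {r : nat} {a : 'I_r -> 'rV[R]_n} {v0 : 'cV[R]_n}.
Hypothesis rd : root_datum Phi a v0.
Let rsPhi := rd_rs rd.
Let simPhi := rd_simple rd.
Implicit Types (al be : 'rV[R]_n) (x y z c : 'cV[R]_n) (w u v : 'M[R]_n).
Local Notation s_ j := (refl (a j)).
Local Notation W := (weyl Phi).

Lemma root_nz al : al \in Phi -> al != 0.
Proof. by apply: contraTneq => ->; apply: (root_neq0 rsPhi). Qed.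

Lemma simple_root j : a j \in Phi. Proof. exact: (simple_in simPhi). Qed.

Lemma simple_nz j : a j != 0. Proof. exact/root_nz/simple_root. Qed.

Lemma sK j : s_ j *m s_ j = 1%:M.
Proof. exact/reflK/simple_nz. Qed.

Lemma sKx j z : s_ j *m (s_ j *m z) = z.
Proof. by rewrite mulmxA sK mul1mx. Qed.

Lemma root_mul_refl al be : al \in Phi -> be \in Phi -> be *m refl al \in Phi.
Proof. by move=> al_ be_; rewrite mul_refl; apply: (root_refl rsPhi). Qed.

Lemma phiN al : al \in Phi -> - al \in Phi.
Proof.
move=> al_; have := root_mul_refl al_ al_.
rewrite mul_refl ev_corootxx ?root_nz //.
by rewrite scaler_nat mulr2n opprD addrA subrr add0r.
Qed.

Lemma weyl1 : W 1%:M.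
Proof. by exists [::]; rewrite ?big_nil. Qed.

Lemma weylM w u : W w -> W u -> W (w *m u).
Proof.
move=> [s sP ->] [s' s'P ->]; exists (s ++ s'); last by rewrite big_cat.
by move=> al; rewrite mem_cat => /orP[/sP|/s'P].
Qed.

Lemma weyl_refl al : al \in Phi -> W (refl al).
Proof. by exists [:: al]; [move=> b; rewrite inE => /eqP-> | rewrite big_seq1]. Qed.

Lemma weyl_s j : W (s_ j). Proof. exact/weyl_refl/simple_root. Qed.

Lemma weyl_ind (P : 'M[R]_n -> Prop) :
  P 1%:M -> (forall al w, al \in Phi -> W w -> P w -> P (refl al *m w)) ->
  forall w, W w -> P w.
Proof.
move=> P1 PM w [s + ->]; elim: s => [|al s IH] sP; first by rewrite big_nil.
have sP' : {subset s <= Phi} by move=> b bs; apply: sP; rewrite inE bs orbT.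
rewrite big_cons; apply: PM; [by apply: sP; rewrite mem_head| by exists s|exact: IH].
Qed.

Lemma weyl_orth w : W w -> w *m w^T = 1%:M /\ w^T *m w = 1%:M.
Proof.
move: w; apply: weyl_ind => [|al w al_ _ [wwT wTw]]; first by rewrite trmx1 mulmx1.
rewrite trmx_mul refl_tr; split.
  by rewrite mulmxA -(mulmxA (refl al)) wwT mulmx1 reflK ?root_nz.
by rewrite mulmxA -(mulmxA w^T) reflK ?root_nz // mulmx1.
Qed.

Lemma weyl_tr w : W w -> W w^T.
Proof.
move: w; apply: weyl_ind => [|al w al_ _ IH]; first by rewrite trmx1; apply: weyl1.
by rewrite trmx_mul refl_tr; apply: weylM => //; apply: weyl_refl.
Qed.

Lemma weyl_invE w : W w -> invmx w = w^T.
Proof.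
move=> /weyl_orth[wwT wTw]; have [wu _] := mulmx1_unit wwT.
by rewrite -[invmx w]mulmx1 -wwT mulmxA mulVmx // mul1mx.
Qed.

Lemma weyl_unit w : W w -> w \in unitmx.
Proof. by move=> /weyl_orth[/mulmx1_unit[]]. Qed.

Lemma weyl_inv w : W w -> W (invmx w).
Proof. by move=> Ww; rewrite weyl_invE //; apply: weyl_tr. Qed.

Lemma weylK w z : W w -> invmx w *m (w *m z) = z.
Proof. by move=> /weyl_unit wu; rewrite mulmxA mulVmx // mul1mx. Qed.

Lemma weylKV w z : W w -> w *m (invmx w *m z) = z.
Proof. by move=> /weyl_unit wu; rewrite mulmxA mulmxV // mul1mx. Qed.

Lemma root_weyl w be : W w -> be \in Phi -> be *m w \in Phi.
Proof.
move=> Ww; move: w Ww be; apply: weyl_ind => [|al w al_ _ IH] be be_.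
  by rewrite mulmx1.
by rewrite mulmxA; apply/IH/root_mul_refl.
Qed.

Lemma weyl_conj w be : W w -> refl be *m w = w *m refl (be *m w).
Proof. by case/weyl_orth => wwT wTw; case: (refl_orth be wwT wTw). Qed.

Lemma weyl_coroot w be : W w -> coroot (be *m w) = invmx w *m coroot be.
Proof.
by move=> Ww; rewrite weyl_invE //; have [p q] := weyl_orth Ww; case: (refl_orth be p q).
Qed.

Lemma word_cons j s : word a (j :: s) = s_ j *m word a s.
Proof. by rewrite /word big_cons. Qed.

Lemma word_cat s s' : word a (s ++ s') = word a s *m word a s'.
Proof. by rewrite /word big_cat. Qed.

Lemma word_nil : word a [::] = 1%:M.
Proof. by rewrite /word big_nil. Qed.

Lemma word1 j : word a [:: j] = s_ j.
Proof. by rewrite word_cons word_nil mulmx1. Qed.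

Lemma word_rcons s j : word a (rcons s j) = word a s *m s_ j.
Proof. by rewrite -cats1 word_cat word1. Qed.

Lemma weyl_word s : W (word a s).
Proof.
elim: s => [|j s IH]; first by rewrite word_nil; apply: weyl1.
by rewrite word_cons; apply: weylM => //; apply: weyl_s.
Qed.

Lemma word_rev s : word a (rev s) = invmx (word a s).
Proof.
rewrite weyl_invE; last exact: weyl_word.
elim: s => [|j s IH]; first by rewrite word_nil trmx1.
by rewrite rev_cons word_rcons word_cons trmx_mul IH refl_tr.
Qed.

End RootCombinatorics.

(** * Length, reduced words and minimal coset representatives *)

Section Length.
Context {R : realType} {n : nat} {Phi : {fset 'rV[R]_n}}.
Context {r : nat} {a : 'I_r -> 'rV[R]_n} {v0 : 'cV[R]_n}.
Hypothesis rd : root_datum Phi a v0.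
Let redPhi := rd_red rd.
Let simPhi := rd_simple rd.
Let v0P := rd_v0 rd.
Implicit Types (al be : 'rV[R]_n) (x y z c : 'cV[R]_n) (w u v : 'M[R]_n).
Local Notation s_ j := (refl (a j)).
Local Notation W := (weyl Phi).

Lemma simple_mul_s j : a j *m s_ j = - a j.
Proof.
rewrite mul_refl ev_corootxx ?(simple_nz rd) //.
by rewrite scaler_nat mulr2n opprD addrA subrr add0r.
Qed.

Lemma positive_ev be : positive_root a Phi be ->
  0 < ev be v0 /\ forall c, dominant a c -> 0 <= ev be c.
Proof.
move=> [be_ [k bE]]; split; last first.
  move=> c dc; rewrite bE ev_suml sumr_ge0 // => i _.
  by rewrite -scaler_nat evZl mulr_ge0.
rewrite lt_def bE ev_suml; apply/andP; split; last first.
  by rewrite sumr_ge0 // => i _; rewrite -scaler_nat evZl v0P mulr1.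
apply: contraNneq (root_nz rd be_) => s0; rewrite bE big1 // => i _.
have ge0 j : xpredT j -> 0 <= ev (a j *+ k j) v0.
  by rewrite -scaler_nat evZl v0P mulr1.
have := psumr_eq0P ge0 s0 (i := i) isT.
by rewrite -scaler_nat evZl v0P mulr1 => ->; rewrite scale0r.
Qed.

Lemma root_sign be : be \in Phi ->
  positive_root a Phi be /\ 0 < ev be v0 \/ positive_root a Phi (- be) /\ ev be v0 < 0.
Proof.
move=> be_; have [p|p] := simple_sign simPhi be_; [left|right]; split=> //.
  by case: (positive_ev p).
by case: (positive_ev p) => + _; rewrite evNl oppr_gt0.
Qed.

Lemma posP be : be \in Phi -> 0 < ev be v0 -> positive_root a Phi be.
Proof.
by move=> be_ b0; have [[]//|[_]] := root_sign be_; rewrite ltNge ltW.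
Qed.

Lemma root_v0_neq0 be : be \in Phi -> ev be v0 != 0.
Proof. by move=> /root_sign[[_ /lt0r_neq0]//|[_ /ltr0_neq0]]. Qed.

Lemma root_v0_lt be : be \in Phi -> (ev be v0 < 0) = ~~ (0 < ev be v0).
Proof. by move=> /root_v0_neq0 b0; rewrite -leNgt le_eqVlt (negPf b0). Qed.

Lemma dom_pos c be : dominant a c -> be \in Phi -> 0 < ev be v0 -> 0 <= ev be c.
Proof. by move=> dc be_ /(posP be_) /positive_ev [_]; apply. Qed.

Lemma pos_dom c be : dominant a c -> be \in Phi -> 0 < ev be c -> 0 < ev be v0.
Proof.
move=> dc be_ bc; rewrite lt_def root_v0_neq0 // leNgt; apply/negP => b0.
have := @dom_pos c (- be) dc (phiN rd be_).
by rewrite !evNl oppr_gt0 oppr_ge0 => /(_ b0); rewrite leNgt bc.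
Qed.

Lemma simple_comb_inj (k m : 'I_r -> R) :
  \sum_i k i *: a i = \sum_i m i *: a i -> forall i, k i = m i.
Proof.
have E (l : 'I_r -> R) : \sum_i l i *: a i = (\row_i l i) *m \matrix_(i < r) a i.
  rewrite mulmx_sum_row; apply: eq_bigr => i _; by rewrite mxE rowK.
rewrite !E => /(row_free_inj (simple_free simPhi)) /rowP km i.
by have := km i; rewrite !mxE.
Qed.

(** The coefficients of [be] and [be *m s_j] differ only at [a j]. If the image were negative, all
    other coefficients would vanish, and reducedness would leave only [be = a j]. *)
Lemma simple_refl_pos j be : be \in Phi -> 0 < ev be v0 -> be != a j ->
  0 < ev (be *m s_ j) v0.
Proof.
move=> be_ b0; apply: contraNT => nb.
have sb_ := root_mul_refl rd (simple_root rd j) be_.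
rewrite -root_v0_lt // in nb.
have [[_ /lt_geF]|[[_ [m mE]] _]] := root_sign sb_; first by rewrite ltW.
have [_ [k kE]] := posP be_ b0.
pose cc := ev be (coroot (a j)).
have E : \sum_i (k i + m i)%:R *: a i = \sum_i (cc *+ (i == j)) *: a i.
  under eq_bigr do rewrite natrD scalerDl !scaler_nat.
  rewrite big_split /= -kE -mE mul_refl opprB addrCA subrr addr0.
  rewrite (bigD1 j) //= eqxx mulr1n big1 ?addr0 // => i /negPf ij.
  by rewrite ij mulr0n scale0r.
have k0 i : i != j -> k i = 0%N.
  move=> ij; have := simple_comb_inj E i; rewrite (negPf ij) mulr0n => /eqP.
  by rewrite pnatr_eq0 addn_eq0 => /andP[/eqP].
have bE : be = (k j)%:R *: a j.
  rewrite kE (bigD1 j) //= big1 ?addr0 ?scaler_nat // => i ij.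
  by rewrite k0 // mulr0n.
have [->//|bN] := redPhi (simple_root rd j) be_ bE.
by move: b0; rewrite bN evNl v0P ltr0N1.
Qed.

Lemma perm_root w : W w -> perm_eq (Phi : seq _) [seq be *m w | be <- Phi].
Proof.
move=> Ww; have wu := weyl_unit rd Ww.
apply: uniq_perm; rewrite ?map_inj_uniq ?fset_uniq //.
  by move=> x y /(congr1 (mulmx^~ (invmx w))); rewrite !mulmxK.
move=> be; apply/idP/mapP => [be_|[al al_ ->]]; last exact: (root_weyl rd).
exists (be *m invmx w); last by rewrite mulmxKV.
by apply: (root_weyl rd) => //; apply: (weyl_inv rd).
Qed.

(* For op = + and e = 1 this is the number of walls between z and the regular
   dominant vector v0; the Weyl group length is the case z = w v0. *)
Definition walls (T : Type) (idx : T) (op : T -> T -> T) (e : 'rV[R]_n -> T) z : T :=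
  \big[op/idx]_(be <- Phi | (0 < ev be v0) && (ev be z < 0)) e be.

Section Walls.
Variables (T : Type) (idx : T) (op : Monoid.com_law idx) (e : 'rV[R]_n -> T).
Hypothesis eW : forall be w, be \in Phi -> W w -> e (be *m w) = e be.

Lemma walls_v0 : walls idx op e v0 = idx.
Proof. by rewrite /walls big1 // => be /andP[/ltW/le_gtF->]. Qed.

Lemma walls_dom c : dominant a c -> walls idx op e c = idx.
Proof.
move=> dc; rewrite /walls big_seq_cond big1 // => be /and3P[be_ b0].
by rewrite ltNge dom_pos.
Qed.

(** [s_j] permutes the positive roots other than [a j], so reindexing by it leaves exactly one new
    factor. *)
Lemma walls_refl j z : 0 < ev (a j) z ->
  walls idx op e (s_ j *m z) = op (e (a j)) (walls idx op e z).
Proof.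
move=> jz; have sjz : ev (a j) (s_ j *m z) = - ev (a j) z by rewrite -evM simple_mul_s evNl.
rewrite {1}/walls -big_filter (bigD1_seq (a j)) /=; last 2 first.
- by rewrite mem_filter v0P ltr01 sjz oppr_lt0 jz (simple_root rd).
- by rewrite filter_uniq ?fset_uniq.
congr (op _ _); rewrite big_filter_cond /walls.
rewrite (perm_big _ (perm_root (weyl_s rd j))) big_map big_seq_cond [RHS]big_seq_cond.
have E be : be \in Phi -> (0 < ev (be *m s_ j) v0) && (ev (be *m s_ j) (s_ j *m z) < 0) &&
    (be *m s_ j != a j) = (0 < ev be v0) && (ev be z < 0).
  move=> be_; rewrite [ev _ (_ *m z)]evM (sKx rd) -!andbA.
  have sb_ := root_mul_refl rd (simple_root rd j) be_.
  have sbb : be *m s_ j *m s_ j = be by rewrite -mulmxA (sK rd) mulmx1.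
  have [bz|] /= := boolP (ev be z < 0); last by rewrite !andbF.
  have [sbj|sbj] /= := eqVneq (be *m s_ j) (a j).
    by rewrite andbF -sbb sbj simple_mul_s evNl v0P oppr_gt0 ltr10.
  rewrite !andbT; apply/idP/idP => b0; last first.
    apply: simple_refl_pos => //; apply: contraTneq bz => ->.
    by rewrite -leNgt ltW.
  by rewrite -sbb; apply: simple_refl_pos.
rewrite (eq_bigl (fun be => (be \in Phi) && ((0 < ev be v0) && (ev be z < 0)))); last first.
  by move=> be /=; case: (boolP (be \in Phi)) => //= be_; rewrite E.
by apply: eq_bigr => be /andP[be_ _]; apply/eW => //; apply: (weyl_s rd).
Qed.

End Walls.
End Length.

(** * Exchange condition and length *)

Section Coxeter.
Context {R : realType} {n : nat} {Phi : {fset 'rV[R]_n}}.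
Context {r : nat} {a : 'I_r -> 'rV[R]_n} {v0 : 'cV[R]_n}.
Hypothesis rd : root_datum Phi a v0.
Implicit Types (al be : 'rV[R]_n) (x y z c : 'cV[R]_n) (w u v : 'M[R]_n).
Implicit Types (s : seq 'I_r) (i j : 'I_r).
Local Notation s_ j := (refl (a j)).
Local Notation W := (weyl Phi).
Local Notation word := (word a).
Local Notation len := (len a).

Definition nw z : nat := walls (Phi := Phi) (v0 := v0) 0%N addn (fun=> 1%N) z.

Lemma ev_simple_s j z : ev (a j) (s_ j *m z) = - ev (a j) z.
Proof. by rewrite -evM (simple_mul_s rd) evNl. Qed.

Lemma nw_dom c : dominant a c -> nw c = 0%N.
Proof. exact: walls_dom. Qed.

Lemma nw_v0 : nw v0 = 0%N.
Proof. exact: walls_v0. Qed.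

Lemma nw_up j z : 0 < ev (a j) z -> nw (s_ j *m z) = (nw z).+1.
Proof. by move=> jz; rewrite /nw (walls_refl rd) // add1n. Qed.

Lemma nw_down j z : ev (a j) z < 0 -> nw z = (nw (s_ j *m z)).+1.
Proof.
move=> jz; rewrite -{1}(sKx rd j z) nw_up //.
by rewrite ev_simple_s oppr_gt0.
Qed.

Lemma s_fix j z : ev (a j) z = 0 -> s_ j *m z = z.
Proof. by move=> jz; rewrite reflE jz scale0r subr0. Qed.

Lemma nw_le j z : (nw (s_ j *m z) <= (nw z).+1)%N.
Proof.
have [jz|jz|jz] := ltrgtP (ev (a j) z) 0; last by rewrite s_fix.
  by rewrite (nw_down jz) leqW.
by rewrite nw_up.
Qed.

Lemma simple_flip i be : be \in Phi -> 0 < ev be v0 -> ev (be *m s_ i) v0 < 0 ->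
  be = a i.
Proof.
move=> be_ b0; case: (eqVneq be (a i)) => // bi.
by rewrite ltNge ltW // (simple_refl_pos rd).
Qed.

(** When [be] is carried through the letters of the word, its sign changes somewhere, and by
    [simple_refl_pos] this happens only where it equals the simple root of the next letter. *)
Lemma exchange_root s be : be \in Phi -> 0 < ev be v0 -> ev be (word s *m v0) < 0 ->
  exists s1 i s2, s = s1 ++ i :: s2 /\ be *m word s1 = a i.
Proof.
elim: s be => [|i s IH] be be_ b0.
  by rewrite word_nil mul1mx ltNge ltW.
rewrite word_cons -mulmxA -evM => bs.
have [->|bi] := eqVneq be (a i).
  by exists [::], i, s; rewrite word_nil mulmx1.
have sb_ := root_mul_refl rd (simple_root rd i) be_.
have [s1 [k [s2 [-> E]]]] := IH _ sb_ (simple_refl_pos rd be_ b0 bi) bs.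
by exists (i :: s1), k, s2; split=> //; rewrite word_cons mulmxA.
Qed.

(** Strong exchange condition: moved past the prefix [s1], the reflection in [be] becomes [s_i] and
    cancels the letter that follows. *)
Lemma exchange s be : be \in Phi -> 0 < ev be v0 -> ev be (word s *m v0) < 0 ->
  exists s1 i s2, [/\ s = s1 ++ i :: s2, be *m word s1 = a i
    & refl be *m word s = word (s1 ++ s2)].
Proof.
move=> be_ b0 bs; have [s1 [i [s2 [sE E]]]] := exchange_root be_ b0 bs.
exists s1, i, s2; split=> //.
rewrite sE !word_cat word_cons mulmxA (weyl_conj rd); last exact: (weyl_word rd).
by rewrite E -!mulmxA (mulmxA (s_ i)) (sK rd) mul1mx.
Qed.

(** Induction on the height. Some simple root has positive inner product with [be], since otherwise
    the inner product of [be] with itself would be nonpositive; reflecting in that root lowers the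
    height. *)
Lemma pos_root_word N be : be \in Phi -> 0 < ev be v0 -> ev be v0 <= N%:R ->
  exists s j, be = a j *m word s.
Proof.
elim: N be => [|N IH] be be_ b0 bN; first by rewrite leNgt b0 in bN.
have [_ [k bE]] := posP rd be_ b0.
have [j jp] : exists j, 0 < dualdot be (a j).
  apply: contrapT => /forallNP np.
  have := dualdot_gt0 (root_nz rd be_).
  rewrite ltNge => /negP; apply.
  have dD (p q : 'rV[R]_n) : dualdot p q = ev p q^T by [].
  have -> : dualdot be be = \sum_i (k i)%:R * dualdot be (a i).
    rewrite {2}bE dD linear_sum /= /ev mulmx_sumr summxE; apply: eq_bigr => i _.
    by rewrite -scaler_nat linearZ /= -scalemxAr mxE.
  by apply: sumr_le0 => i _; rewrite mulr_ge0_le0 // leNgt; apply/negP/np.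
have [->|bj] := eqVneq be (a j); first by exists [::], j; rewrite word_nil mulmx1.
have sb_ := root_mul_refl rd (simple_root rd j) be_.
have sb0 := simple_refl_pos rd be_ b0 bj.
have Pos := dualdot_gt0 (simple_nz rd j).
have lt : ev (be *m s_ j) v0 < ev be v0.
  rewrite mul_refl evBl evZl (rd_v0 rd) mulr1 ltrBlDr ltrDl ev_coroot.
  by rewrite mulr_gt0 // divr_gt0.
have [s [i E]] : exists s i, be *m s_ j = a i *m word s.
  apply: IH => //.
  have [_ [m mE]] := posP rd sb_ sb0.
  have hE (p : 'rV[R]_n) (l : 'I_r -> nat) : p = \sum_i a i *+ l i -> ev p v0 = (\sum_i l i)%:R.
    move=> ->; rewrite ev_suml natr_sum; apply: eq_bigr => i0 _.
    by rewrite -scaler_nat evZl (rd_v0 rd) mulr1.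
  move: lt bN; rewrite (hE _ _ mE) (hE _ _ bE) ltr_nat !ler_nat => lt bN.
  by rewrite -ltnS; apply: leq_trans bN.
exists (rcons s j), i; rewrite word_rcons mulmxA -E -mulmxA (sK rd) mulmx1.
by [].
Qed.

Lemma pos_refl_word be : be \in Phi -> 0 < ev be v0 -> exists s, refl be = word s.
Proof.
move=> be_ b0; have [_ [k bE]] := posP rd be_ b0.
have [s [j E]] : exists s j, be = a j *m word s.
  apply: (@pos_root_word (\sum_i k i)) => //.
  rewrite bE ev_suml natr_sum ler_sum // => i _.
  by rewrite -scaler_nat evZl (rd_v0 rd) mulr1.
exists (rev s ++ j :: s).
rewrite word_cat word_cons (word_rev rd) (weyl_conj rd); last exact: (weyl_word rd).
by rewrite mulmxA mulVmx ?mul1mx ?E //; apply/(weyl_unit rd)/(weyl_word rd).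
Qed.

Lemma weyl_wordE w : W w -> exists s, w = word s.
Proof.
move: w; apply: weyl_ind => [|be w be_ _ [s ->]].
  by exists [::]; rewrite word_nil.
have [s' E] : exists s', refl be = word s'.
  have [[_ b0]|[_ b0]] := root_sign rd be_; first exact: pos_refl_word.
  by rewrite -reflN; apply: pos_refl_word; rewrite ?(phiN rd) // evNl oppr_gt0.
by exists (s' ++ s); rewrite word_cat E.
Qed.

Lemma nw_word s : (nw (word s *m v0) <= size s)%N.
Proof.
elim: s => [|j s IH]; first by rewrite word_nil mul1mx nw_v0.
by rewrite word_cons -mulmxA (leq_trans (nw_le _ _)).
Qed.

Lemma root_simple_neq0 w j : W w -> ev (a j) (w *m v0) != 0.
Proof.
by move=> Ww; rewrite -evM (root_v0_neq0 rd) // (root_weyl rd) // (simple_root rd).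
Qed.

(** This identifies the length with the number of walls: prepending a letter either crosses one more
    wall or, by the exchange condition, amounts to deleting a letter. *)
Lemma reduced_exists s : exists2 s', word s' = word s & size s' = nw (word s *m v0).
Proof.
elim: s => [|j s [s' E IH]]; first by exists [::]; rewrite // word_nil mul1mx nw_v0.
have := root_simple_neq0 j (weyl_word rd s).
rewrite word_cons -mulmxA neq_lt => /orP[js|js]; last first.
  by exists (j :: s'); rewrite ?word_cons ?E //= IH nw_up.
have j0 : 0 < ev (a j) v0 by rewrite (rd_v0 rd).
rewrite -E in js; have [s1 [i [s2 [sE _ E']]]] := exchange (simple_root rd j) j0 js.
exists (s1 ++ s2); first by rewrite -E' E.
apply/eqP; rewrite -eqSS -E -nw_down // E -IH sE !size_cat /= addnS.
by [].
Qed.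

Lemma redwordP w : W w -> word (redword a w) = w /\ size (redword a w) = nw (w *m v0).
Proof.
move=> Ww; have [s sE] := weyl_wordE Ww.
have [s' E E'] := reduced_exists s; rewrite -sE in E E'.
have [/= p q] : [set s | word s = w /\
    forall s', word s' = w -> (size s <= size s')%N] (redword a w).
  apply: (@xgetPex _ [::] _ _); exists s' => /=; split=> // s'' E''.
  by rewrite E' -E'' nw_word.
split=> //; apply/eqP; rewrite eqn_leq -E' q // E'.
by rewrite -{1}p nw_word.
Qed.

Lemma word_redword w : W w -> word (redword a w) = w.
Proof. by case/redwordP. Qed.

Lemma len_nw w : W w -> len w = nw (w *m v0).
Proof. by case/redwordP. Qed.

Lemma len_word s : (len (word s) <= size s)%N.
Proof. by rewrite len_nw ?nw_word //; apply: (weyl_word rd). Qed.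

Lemma len1 : len 1%:M = 0%N.
Proof. by rewrite len_nw ?mul1mx ?nw_v0 //; apply: weyl1. Qed.

Lemma len_eq0 w : W w -> len w = 0%N -> w = 1%:M.
Proof. by move=> Ww /size0nil E; rewrite -(word_redword Ww) E word_nil. Qed.

Lemma len_up j w : W w -> 0 < ev (a j) (w *m v0) -> len (s_ j *m w) = (len w).+1.
Proof.
move=> Ww jw; rewrite !len_nw -?mulmxA ?nw_up //.
by apply: weylM => //; apply: (weyl_s rd).
Qed.

Lemma len_down j w : W w -> ev (a j) (w *m v0) < 0 -> len w = (len (s_ j *m w)).+1.
Proof.
move=> Ww jw; rewrite !len_nw -?mulmxA -?nw_down //.
by apply: weylM => //; apply: (weyl_s rd).
Qed.

Lemma len_lt_up j w : W w -> (len w < len (s_ j *m w))%N -> 0 < ev (a j) (w *m v0).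
Proof.
move=> Ww; have := root_simple_neq0 j Ww; rewrite neq_lt => /orP[jw|//].
by rewrite (len_down Ww jw) ltnNge leqnSn.
Qed.

Lemma len_mul_le w u : W w -> W u -> (len (w *m u) <= len w + len u)%N.
Proof.
move=> Ww Wu; rewrite -{1}(word_redword Ww) -{1}(word_redword Wu) -word_cat.
by rewrite (leq_trans (len_word _)) // size_cat.
Qed.

Lemma len_inv w : W w -> len (invmx w) = len w.
Proof.
have le u : W u -> (len (invmx u) <= len u)%N.
  move=> Wu; rewrite -{1}(word_redword Wu) -(word_rev rd).
  by rewrite (leq_trans (len_word _)) // size_rev.
move=> Ww; apply/eqP; rewrite eqn_leq le //=.
by rewrite -{1}(invmxK w) le //; apply: (weyl_inv rd).
Qed.

Definition reduced s := size s == len (word s).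

Lemma redword_reduced w : W w -> reduced (redword a w).
Proof. by move=> Ww; rewrite /reduced word_redword. Qed.

Lemma reduced_cat s s' : reduced (s ++ s') -> reduced s /\ reduced s'.
Proof.
rewrite /reduced size_cat word_cat => /eqP E.
have := len_mul_le (weyl_word rd s) (weyl_word rd s'); rewrite -E.
have := len_word s; have := len_word s'.
by split; apply/eqP; lia.
Qed.

Lemma reduced_cons j s : reduced (j :: s) ->
  [/\ reduced s, 0 < ev (a j) (word s *m v0) & len (word (j :: s)) = (len (word s)).+1].
Proof.
move=> jsr; have [_ sr] := @reduced_cat [:: j] s jsr.
have E : len (word (j :: s)) = (len (word s)).+1 by rewrite -(eqP jsr) -(eqP sr).
split=> //; apply: len_lt_up; first exact: (weyl_word rd).
by rewrite -word_cons E.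
Qed.

Lemma reduced_rev s : reduced s -> reduced (rev s).
Proof.
by rewrite /reduced size_rev (word_rev rd) len_inv //; apply: (weyl_word rd).
Qed.

Lemma reduced_word_cat w u : W w -> W u -> len (w *m u) = (len w + len u)%N ->
  reduced (redword a w ++ redword a u).
Proof.
by move=> Ww Wu E; rewrite /reduced word_cat !word_redword // E size_cat.
Qed.

Lemma len_refl_lt be w : be \in Phi -> W w -> 0 < ev be v0 -> ev be (w *m v0) < 0 ->
  (len (refl be *m w) < len w)%N.
Proof.
move=> be_ Ww b0; rewrite -{1}(word_redword Ww) => bw.
have [s1 [i [s2 [sE _ E]]]] := exchange be_ b0 bw.
rewrite -{1}(word_redword Ww) E (leq_ltn_trans (len_word _)) //.
by rewrite /Defs.len sE !size_cat /= addnS.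
Qed.

Lemma len_refl_gt be w : be \in Phi -> W w -> 0 < ev be v0 -> 0 < ev be (w *m v0) ->
  (len w < len (refl be *m w))%N.
Proof.
move=> be_ Ww b0 bw.
have {1}-> : w = refl be *m (refl be *m w) by rewrite mulmxA reflK ?mul1mx ?(root_nz rd).
apply: len_refl_lt => //; first by apply: weylM => //; apply: weyl_refl.
rewrite -mulmxA -evM mul_refl ev_corootxx ?(root_nz rd) //.
by rewrite scaler_nat mulr2n opprD addrA subrr add0r evNl oppr_lt0.
Qed.

(** By dominance of [c], a wall strictly separating [w *m c] from [v0] also separates [w *m v0] from
    it. Equality means that no wall counted by the length passes through [w *m c]. *)
Lemma nw_le_dom c w : dominant a c -> W w -> (nw (w *m c) <= len w)%N /\
  (nw (w *m c) = len w <->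
   forall be, be \in Phi -> 0 < ev be v0 -> ev be (w *m v0) < 0 -> ev be (w *m c) < 0).
Proof.
move=> dc Ww; rewrite len_nw // /nw /walls.
have imp be : be \in Phi -> ev be (w *m c) < 0 -> ev be (w *m v0) < 0.
  move=> be_; have bw_ := root_weyl rd Ww be_; rewrite -!evM => bc.
  rewrite -oppr_gt0 -evNl (pos_dom rd dc) //; first exact: (phiN rd).
  by rewrite evNl oppr_gt0.
pose p be := (0 < ev be v0) && (ev be (w *m v0) < 0).
have -> : (\sum_(be <- Phi | (0 < ev be v0)%R && (ev be (w *m c) < 0)%R) 1 =
    \sum_(be <- Phi | p be && (ev be (w *m c) < 0)%R) 1)%N.
  rewrite big_seq_cond [RHS]big_seq_cond; apply: eq_bigl => be.
  case: (boolP (be \in Phi)) => //= be_; rewrite /p.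
  have [bc|] := boolP (ev be (w *m c) < 0)%R; last by rewrite !andbF.
  by rewrite imp // !andbT.
rewrite [X in (_ <= X)%N /\ _](bigID (fun be => ev be (w *m c) < 0)%R) /= -/(p _).
rewrite [X in _ /\ (_ = X <-> _)](bigID (fun be => ev be (w *m c) < 0)%R) /= -/(p _).
split; first exact: leq_addr.
split=> [/eqP|H].
  rewrite -[X in X == _]addn0 eqn_add2l eq_sym sum_nat_seq_eq0 => /allP H be be_ b0 bw.
  by have := H be be_; rewrite /p b0 bw /=; case: (ev be (w *m c) < 0).
rewrite [X in (_ + X)%N]big1_seq ?addn0 // => be /andP[/andP[/andP[b0 bw] bc] be_].
by rewrite H in bc.
Qed.

(** If a wall counted by [len w] contained [w *m c], the reflection in [be *m w] would fix [c] and
    shorten [w]. Conversely [nw] depends only on the point, hence bounds the length of every element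
    of the coset from below. *)
Lemma mincosetP c w : dominant a c ->
  mincoset a Phi c w <-> W w /\ nw (w *m c) = len w.
Proof.
move=> dc; split=> [[Ww min]|[Ww E]]; last first.
  split=> // u [Wu uc]; have Wwu := weylM Ww Wu.
  by rewrite -E -{1}uc mulmxA; case: (nw_le_dom dc Wwu).
split=> //; have [_ [_ H]] := nw_le_dom dc Ww; apply: H => be be_ b0 bw.
have bw_ := root_weyl rd Ww be_.
rewrite lt_neqAle; apply/andP; split; last first.
  rewrite -evM leNgt; apply/negP => /(pos_dom rd dc bw_).
  by rewrite evM ltNge ltW.
apply/eqP => bc.
have : stab Phi c (refl (be *m w)).
  by split; [exact: weyl_refl | rewrite reflE evM bc scale0r subr0].
move=> /min; rewrite -(weyl_conj rd) // leqNgt.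
by rewrite len_refl_lt.
Qed.

Lemma dominant_s c j : dominant a c -> (refl (a j) *m c = c) <-> ev (a j) c = 0.
Proof.
move=> dc; split=> [E|]; last exact: s_fix.
have := ev_simple_s j c; rewrite E => /eqP.
by rewrite -addr_eq0 -mulr2n -mulr_natr mulf_eq0 pnatr_eq0 orbF => /eqP.
Qed.

End Coxeter.

Arguments nw {R n} Phi v0 z.
Arguments reduced {R n r} a s.

(** * Cosets and longest element of the stabilizer of a dominant point *)

Section Cosets.
Context {R : realType} {n : nat} {Phi : {fset 'rV[R]_n}}.
Context {r : nat} {a : 'I_r -> 'rV[R]_n} {v0 : 'cV[R]_n}.
Hypothesis rd : root_datum Phi a v0.
Context {c : 'cV[R]_n}.
Hypothesis dc : dominant a c.
Implicit Types (al be : 'rV[R]_n) (x y z : 'cV[R]_n) (w u v : 'M[R]_n).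
Implicit Types (s : seq 'I_r) (i j : 'I_r).
Local Notation s_ j := (refl (a j)).
Local Notation W := (weyl Phi).
Local Notation word := (word a).
Local Notation len := (len a).
Local Notation Wc := (stab Phi c).
Local Notation mincoset := (mincoset a Phi c).

Lemma stab1 : Wc 1%:M.
Proof. by split; [exact: weyl1 | rewrite mul1mx]. Qed.

Lemma stabM u v : Wc u -> Wc v -> Wc (u *m v).
Proof.
by move=> [Wu uc] [Wv vc]; split; [exact: weylM | rewrite -mulmxA vc uc].
Qed.

Lemma stab_inv v : Wc v -> Wc (invmx v).
Proof.
by move=> [Wv vc]; split; [exact: (weyl_inv rd) | rewrite -{1}vc (weylK rd)].
Qed.

Lemma stab_s j : ev (a j) c = 0 -> Wc (s_ j).
Proof. by move=> /s_fix jc; split=> //; apply: (weyl_s rd). Qed.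

Lemma stab_refl be : be \in Phi -> ev be c = 0 -> Wc (refl be).
Proof.
by move=> be_ bc; split; [exact: weyl_refl | rewrite reflE bc scale0r subr0].
Qed.

Lemma mincoset_weyl w : mincoset w -> W w. Proof. by case. Qed.

Lemma mincoset_nw w : mincoset w -> nw Phi v0 (w *m c) = len w.
Proof. by move=> /(mincosetP rd w dc)[]. Qed.

Lemma mincoset_exists w : W w -> exists2 u, mincoset u & u *m c = w *m c.
Proof.
move=> Ww.
pose P k := `[< exists u, [/\ W u, u *m c = w *m c & len u = k] >].
have exP : exists k, P k by exists (len w); apply/asboolP; exists w.
case: (ex_minnP exP) => k /asboolP[u [Wu uc uk]] kmin.
exists u => //; split=> // v [Wv vc]; rewrite uk; apply: kmin; apply/asboolP.
by exists (u *m v); split=> //; [exact: weylM | rewrite -mulmxA vc].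
Qed.

(** The count at [w *m c] is at most [len w], and [s_j] raises it by at most one. As it ends at
    [len w + 1], both bounds are attained. *)
Lemma mincoset_step j w : mincoset (s_ j *m w) -> W w -> len (s_ j *m w) = (len w).+1 ->
  mincoset w /\ 0 < ev (a j) (w *m c).
Proof.
move=> mw Ww lE; have := mincoset_nw mw; rewrite lE -mulmxA => nE.
have [le1 _] := nw_le_dom rd dc Ww.
have [jz|jz|jz] := ltrgtP (ev (a j) (w *m c)) 0.
- by have := nw_down rd jz; lia.
- split=> //; apply/(mincosetP rd _ dc); split=> //.
  by have := nw_up rd jz; lia.
- by move: nE; rewrite s_fix //; lia.
Qed.

Lemma mincoset_up j w : mincoset w -> 0 < ev (a j) (w *m c) ->
  mincoset (s_ j *m w) /\ len (s_ j *m w) = (len w).+1.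
Proof.
move=> mw jz; have Ww := mincoset_weyl mw; have Wsw := weylM (weyl_s rd j) Ww.
have := nw_up rd jz; rewrite mincoset_nw // => nE.
have [le1 _] := nw_le_dom rd dc Wsw; rewrite -mulmxA nE in le1.
have := len_mul_le rd (weyl_s rd j) Ww.
have lj : (len (s_ j) <= 1)%N by rewrite -(word1 (a := a)) (len_word rd).
move=> le2; have E : len (s_ j *m w) = (len w).+1 by lia.
by split=> //; apply/(mincosetP rd _ dc); split=> //; rewrite -mulmxA nE E.
Qed.

Lemma mincoset_ind (P : 'M[R]_n -> Prop) :
  P 1%:M ->
  (forall j w, mincoset w -> mincoset (s_ j *m w) -> len (s_ j *m w) = (len w).+1 ->
    0 < ev (a j) (w *m c) -> P w -> P (s_ j *m w)) ->
  forall w, mincoset w -> P w.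
Proof.
move=> P1 PS w mw; have Ww := mincoset_weyl mw.
rewrite -(word_redword rd Ww) in mw *; have := redword_reduced rd Ww.
elim: (redword a w) mw => [|j s IH] mw rs; first by rewrite word_nil.
have [rs' js E] := reduced_cons rd rs; rewrite word_cons in mw E *.
have [mw' jc] := mincoset_step mw (weyl_word rd s) E.
by apply: PS => //; apply: IH.
Qed.

Lemma mincoset_mul u v : mincoset u -> Wc v -> len (u *m v) = (len u + len v)%N.
Proof.
move=> mu [Wv vc]; move: u mu; apply: mincoset_ind => [|j u mu _ E ju IH].
  by rewrite mul1mx (len1 rd).
rewrite E -mulmxA (len_up rd) ?IH //; first by apply: weylM (mincoset_weyl mu) Wv.
have b_ : a j *m (u *m v) \in Phi.
  by apply: (root_weyl rd); [apply: weylM (mincoset_weyl mu) Wv | apply: (simple_root rd)].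
by rewrite -evM (pos_dom rd dc) // evM -mulmxA vc.
Qed.

Lemma mincoset_uniq u u' : mincoset u -> mincoset u' -> u *m c = u' *m c -> u = u'.
Proof.
move=> mu mu' uc; have [Wu Wu'] := (mincoset_weyl mu, mincoset_weyl mu').
have uu := weyl_unit rd Wu.
have Wv : Wc (invmx u *m u').
  split; first by apply: weylM => //; apply: (weyl_inv rd).
  by rewrite -mulmxA -uc (weylK rd).
have uE : u' = u *m (invmx u *m u') by rewrite mulmxA mulmxV // mul1mx.
have := mincoset_mul mu Wv; rewrite -uE -(mincoset_nw mu) -(mincoset_nw mu') uc.
move=> /eqP; rewrite -{1}[nw _ _ _]addn0 eqn_add2l => /eqP/esym.
by move=> /(len_eq0 rd (proj1 Wv)) E; rewrite uE E mulmx1.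
Qed.

(** The stabilizer of a dominant point is a standard parabolic subgroup. If the first letter [j] did
    not fix [c], then [a j] would be positive at [c], which is the image of [c] under the word,
    hence also at the image of [v0], although [j] is a left descent. *)
Lemma stab_reduced s : reduced a s -> Wc (word s) -> forall j, j \in s -> ev (a j) c = 0.
Proof.
elim: s => [|j s IH] // rs sc k.
have [rs' js _] := reduced_cons rd rs; rewrite word_cons in sc.
have jc : ev (a j) c = 0.
  apply/eqP; rewrite eq_le dc andbT leNgt; apply/negP => jc.
  have [Ws E] := sc; have Wws := weyl_word rd s.
  have b_ := root_weyl rd Ws (simple_root rd j).
  have := pos_dom rd dc b_; rewrite !evM E => /(_ jc).
  by rewrite -mulmxA (ev_simple_s rd) oppr_gt0 ltNge ltW.
have Wws : Wc (word s).
  rewrite -[word s]mul1mx -(sK rd j) -mulmxA.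
  by apply: stabM => //; apply: stab_s.
by rewrite inE => /orP[/eqP->//|]; apply: IH.
Qed.

Lemma JfixP j : Jfix a c j <-> ev (a j) c = 0.
Proof. exact: (dominant_s rd j dc). Qed.

Lemma parabolicE : parabolic a (Jfix a c) = Wc.
Proof.
apply/seteqP; split=> [w [s sJ ->]|w Ww].
  elim: s sJ => [|j s IH] sJ; first by rewrite word_nil; apply: stab1.
  rewrite word_cons; apply: stabM.
    by apply/stab_s/JfixP/sJ; rewrite mem_head.
  by apply: IH => k ks; apply: sJ; rewrite inE ks orbT.
have E := word_redword rd (proj1 Ww); exists (redword a w) => // j js.
apply/JfixP; apply: (stab_reduced _ _ js); last by rewrite E.
exact: (redword_reduced rd (proj1 Ww)).
Qed.

Lemma stab_ind (P : 'M[R]_n -> Prop) :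
  P 1%:M ->
  (forall j w, Wc w -> ev (a j) c = 0 -> len (s_ j *m w) = (len w).+1 ->
    P w -> P (s_ j *m w)) ->
  forall w, Wc w -> P w.
Proof.
move=> P1 PS w Ww; have E := word_redword rd (proj1 Ww).
have rs := redword_reduced rd (proj1 Ww).
have jc := stab_reduced rs; rewrite E in jc; move: (jc Ww) => {}jc.
rewrite -E; elim: (redword a w) rs jc {E Ww} => [|j s IH] rs jc; first by rewrite word_nil.
have [rs' js E] := reduced_cons rd rs; rewrite word_cons in E *.
have jc' k : k \in s -> ev (a k) c = 0 by move=> ks; apply: jc; rewrite inE ks orbT.
apply: PS => //; last exact: IH.
- have -> : Wc = parabolic a (Jfix a c) by rewrite parabolicE.
  by exists s => // k ks; apply/JfixP/jc'.
- by apply: jc; rewrite mem_head.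
Qed.

Lemma len_bound w : W w -> (len w <= size (Phi : seq _))%N.
Proof.
move=> Ww; rewrite (len_nw rd Ww) /nw /walls.
by rewrite -big_filter sum1_size size_filter count_size.
Qed.

Let w0 := longest a Wc.

Lemma longestP : Wc w0 /\ forall u, Wc u -> (len u <= len w0)%N.
Proof.
change ([set w | Wc w /\ forall u, Wc u -> (len u <= len w)%N] w0).
apply: (@xgetPex _ 1%:M _ _).
pose P k := `[< (exists2 u, Wc u & len u = k) >].
have exP : exists k, P k by exists (len 1%:M); apply/asboolP; exists 1%:M => //; apply: stab1.
have bP k : P k -> (k <= size (Phi : seq _))%N.
  by move=> /asboolP[u [Wu _] <-]; apply: len_bound.
case: (ex_maxnP exP bP) => k /asboolP[u Wu uk] kmax.
exists u; split=> // v Wv; rewrite uk; apply: kmax; apply/asboolP; by exists v.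
Qed.

Lemma longest_stab : Wc w0. Proof. by case: longestP. Qed.

Lemma longest_weyl : W w0. Proof. by case: longest_stab. Qed.

Lemma longest_fix : w0 *m c = c. Proof. by case: longest_stab. Qed.

Lemma longest_neg be : be \in Phi -> 0 < ev be v0 -> ev be c = 0 -> ev be (w0 *m v0) < 0.
Proof.
move=> be_ b0 bc; have bw_ := root_weyl rd longest_weyl be_.
rewrite -evM (root_v0_lt rd) // evM; apply/negP => bw.
have := len_refl_gt rd be_ longest_weyl b0 bw.
by rewrite ltnNge (proj2 longestP) //; apply: stabM longest_stab; apply: stab_refl.
Qed.

Lemma len_longest v : Wc v -> (len (v *m w0) + len v)%N = len w0.
Proof.
move: v; apply: stab_ind => [|j v Wv jc E IH].
  by rewrite mul1mx (len1 rd) addn0.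
have [Wv' vc] := Wv; have jv := len_lt_up rd (j := j) Wv'; rewrite E ltnSn in jv.
have Wvw := weylM Wv' longest_weyl.
have := len_down rd (j := j) Wvw; rewrite -mulmxA -evM mulmxA.
rewrite longest_neg; first by move=> /(_ isT); rewrite E -IH; lia.
- by apply: (root_weyl rd) => //; apply: (simple_root rd).
- by rewrite evM jv.
- by rewrite evM vc.
Qed.

Lemma longestK : w0 *m w0 = 1%:M.
Proof.
apply: (len_eq0 rd); first exact: weylM longest_weyl longest_weyl.
by have := len_longest longest_stab; lia.
Qed.

Lemma longest_inv : invmx w0 = w0.
Proof.
have wu := weyl_unit rd longest_weyl.
by rewrite -[invmx w0]mulmx1 -longestK mulmxA mulVmx // mul1mx.
Qed.

Lemma len_longestl v : Wc v -> (len (w0 *m v) + len v)%N = len w0.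
Proof.
move=> Wv; have Wv' := stab_inv Wv; rewrite -(len_longest Wv') (len_inv rd (proj1 Wv)).
congr (_ + _)%N; rewrite -[LHS](len_inv rd); last exact: weylM longest_weyl (proj1 Wv).
rewrite -{2}longest_inv; congr (len _).
by rewrite (weyl_invE rd (weylM longest_weyl (proj1 Wv))) trmx_mul
  (weyl_invE rd longest_weyl) (weyl_invE rd (proj1 Wv)).
Qed.

(** The diagram automorphism. The root [- a j *m w0] is positive, and its reflection
    [w0 *m s_j *m w0] has length 1 because [w0] complements lengths on both sides; so the root is
    simple. *)
Lemma longest_star j : ev (a j) c = 0 -> exists2 i, ev (a i) c = 0 & a j *m w0 = - a i.
Proof.
move=> jc; pose de := - (a j *m w0).
have b_ := root_weyl rd longest_weyl (simple_root rd j).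
have de_ : de \in Phi by apply: (phiN rd).
have j0 : 0 < ev (a j) v0 by rewrite (rd_v0 rd).
have de0 : 0 < ev de v0.
  by rewrite evNl evM oppr_gt0 longest_neg // (simple_root rd).
have rE : refl de = w0 *m (s_ j *m w0).
  by rewrite (weyl_conj rd _ longest_weyl) mulmxA longestK mul1mx reflN.
have lj : len (s_ j) = 1%N.
  by rewrite -[s_ j]mulmx1 (len_up rd) ?(len1 rd) ?mul1mx //; apply: weyl1.
have Wsw := weylM (weyl_s rd j) longest_weyl.
have l1 : len (refl de) = 1%N.
  have := len_longestl (stabM (stab_s jc) longest_stab); rewrite -rE.
  by have := len_longest (stab_s jc); rewrite lj; lia.
have := word_redword rd (weyl_refl de_); move: l1; rewrite /Defs.len.
case: (redword a (refl de)) => [|i [|]] // _; rewrite word1 => iE.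
have dE : de = a i.
  apply: (simple_flip rd) => //; rewrite iE mul_refl ev_corootxx ?(root_nz rd) //.
  by rewrite scaler_nat mulr2n opprD addrA subrr add0r evNl oppr_lt0.
by exists i; rewrite -dE ?opprK // evNl evM longest_fix jc oppr0.
Qed.

End Cosets.

(** * Matsumoto's theorem *)

Section Weights.
Context {R : realType} {n : nat} {Phi : {fset 'rV[R]_n}}.
Context {r : nat} {a : 'I_r -> 'rV[R]_n} {v0 : 'cV[R]_n} {F : fieldType}.
Hypothesis rd : root_datum Phi a v0.
Implicit Types (be : 'rV[R]_n) (w u v : 'M[R]_n) (s : seq 'I_r) (i j : 'I_r).
Local Notation s_ j := (refl (a j)).
Local Notation W := (weyl Phi).
Local Notation word := (word a).
Local Notation len := (len a).

Definition weyl_inv_weight (e : 'rV[R]_n -> F) :=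
  forall be w, be \in Phi -> W w -> e (be *m w) = e be.

(** The coefficients of the antisymmetrizer are multiplicative for the weight -1/t, which makes it a
    symmetrizer for that weight. *)
Lemma tlen_neg_inv (t : 'rV[R]_n -> F) w :
  tlen a (fun al => - (t al)^-1) w = (-1) ^+ len w / tlen a t w.
Proof.
rewrite /tlen /Defs.len; elim: (redword a w) => [|j s IH].
  by rewrite !big_nil invr1 mulr1.
by rewrite !big_cons IH exprS invfM mulN1r !mulNr mulrCA.
Qed.

Lemma tlen_inv_fun (t : 'rV[R]_n -> F) w :
  tlen a (fun al => (t al)^-1) w = (tlen a t w)^-1.
Proof. by rewrite /tlen prodfV. Qed.

Variable e : 'rV[R]_n -> F.
Hypothesis eW : weyl_inv_weight e.

(** W-invariance turns the product along a reduced word into a product over the walls crossed, which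
    depends on the element only. Independence of the reduced word thus precedes Matsumoto's theorem
    here. *)
Lemma prod_reduced s : reduced a s ->
  \prod_(j <- s) e (a j) = walls (Phi := Phi) (v0 := v0) 1 *%R e (word s *m v0).
Proof.
elim: s => [|j s IH] rs.
  by rewrite big_nil word_nil mul1mx walls_v0.
have [rs' js _] := reduced_cons rd rs.
by rewrite big_cons IH // word_cons -mulmxA (walls_refl rd).
Qed.

Lemma tlen_word s : reduced a s -> tlen a e (word s) = \prod_(j <- s) e (a j).
Proof.
move=> rs; have Ws := weyl_word rd s.
by rewrite /tlen !prod_reduced ?(redword_reduced rd) // (word_redword rd).
Qed.

Lemma tlen1 : tlen a e 1%:M = 1.
Proof.
rewrite -(word_nil (a := a)) tlen_word ?big_nil //.
by rewrite /reduced word_nil (len1 rd).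
Qed.

Lemma tlen_mul u v : W u -> W v -> len (u *m v) = (len u + len v)%N ->
  tlen a e (u *m v) = tlen a e u * tlen a e v.
Proof.
move=> Wu Wv E; have rs := reduced_word_cat rd Wu Wv E.
by rewrite -{1}(word_redword rd Wu) -{1}(word_redword rd Wv) -word_cat tlen_word // big_cat.
Qed.

Lemma len_s j : len (s_ j) = 1%N.
Proof.
rewrite -[s_ j]mulmx1 (len_up rd) ?(len1 rd) ?mul1mx ?(rd_v0 rd) //.
exact: weyl1.
Qed.

Lemma tlen_s j : tlen a e (s_ j) = e (a j).
Proof.
rewrite -(word1 (a := a)) tlen_word ?big_seq1 //.
by rewrite /reduced word1 len_s.
Qed.

Lemma tlen_inv w : W w -> tlen a e (invmx w) = tlen a e w.
Proof.
move=> Ww; have rs := redword_reduced rd Ww.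
rewrite -{1}(word_redword rd Ww) -(word_rev rd) tlen_word ?(reduced_rev rd) //.
by rewrite (perm_big (redword a w)) ?perm_rev.
Qed.

Lemma weightN be : be \in Phi -> e (- be) = e be.
Proof.
move=> be_; rewrite -(eW be_ (weyl_refl be_)); congr e.
rewrite mul_refl ev_corootxx ?(root_nz rd) //.
by rewrite scaler_nat mulr2n opprD addrA subrr add0r.
Qed.

End Weights.

Section Matsumoto.
Context {R : realType} {n : nat} {Phi : {fset 'rV[R]_n}}.
Context {r : nat} {a : 'I_r -> 'rV[R]_n} {v0 : 'cV[R]_n} {F : fieldType}.
Hypothesis rd : root_datum Phi a v0.
Implicit Types (be : 'rV[R]_n) (w u v : 'M[R]_n) (s q : seq 'I_r) (i j : 'I_r).
Local Notation s_ j := (refl (a j)).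
Local Notation W := (weyl Phi).
Local Notation word := (word a).
Local Notation len := (len a).

Lemma alternatingS i j m : alternating i j m.+1 = i :: alternating j i m.
Proof.
rewrite /alternating /= -[1%N]addn0 iotaDl -map_comp; congr cons.
by apply: eq_map => k /=; case: (odd k).
Qed.

Lemma size_alternating i j m : size (alternating i j m) = m.
Proof. by rewrite size_map size_iota. Qed.

Lemma take_alternating i j k m : (m <= k)%N ->
  take m (alternating i j k) = alternating i j m.
Proof. by move=> mk; rewrite /alternating -map_take take_iota (minn_idPl mk). Qed.

Lemma word_alternating i j k :
  word (alternating i j k) *m invmx (word (alternating j i k)) = (s_ i *m s_ j) ^+ k.
Proof.
have comm (x y : 'M[R]_n) m : x *m (y *m x) ^+ m *m y = (x *m y) ^+ m.+1.
  elim: m => [|m IH]; first by rewrite expr0 expr1 mulmx1.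
  by rewrite exprS [RHS]exprS -IH -mulmxE !mulmxA.
elim: k i j => [|k IH] i j; first by rewrite !word_nil expr0 mul1mx invmx1.
rewrite !alternatingS -(word_rev rd) rev_cons word_rcons (word_rev rd).
by rewrite word_cons -comm -IH !mulmxA.
Qed.

Lemma word_alternating_eq i j k :
  word (alternating i j k) = word (alternating j i k) <-> (s_ i *m s_ j) ^+ k = 1.
Proof.
have wu q := weyl_unit rd (weyl_word rd q).
rewrite -word_alternating; split=> [->|E]; first by rewrite mulmxV.
by rewrite -[LHS]mulmx1 -(mulVmx (wu (alternating j i k))) mulmxA [X in X *m _]E mul1mx.
Qed.

Lemma alternating_descent i j k q :
  let s := alternating i j k ++ q in reduced a s -> ev (a j) (word s *m v0) < 0 ->
  (exists m q', [/\ (0 < m)%N, word (alternating i j m) = word (alternating j i m)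
     & s = alternating i j m ++ q']) \/
  (exists q', word s = word (alternating j i k.+1 ++ q') /\
     reduced a (alternating j i k.+1 ++ q')).
Proof.
move=> s rs js; have j0 : 0 < ev (a j) v0 by rewrite (rd_v0 rd).
have [s1 [p [s2 [s12 pE E]]]] := exchange rd (simple_root rd j) j0 js.
have prefix m : (m <= k)%N -> take m s = alternating i j m.
  by move=> mk; rewrite takel_cat ?size_alternating // take_alternating.
have [s1k|s1k] := ltnP (size s1) k; [left|right].
  have rE : rcons s1 p = alternating i j (size s1).+1.
    by rewrite -prefix // s12 -cat_rcons take_size_cat ?size_rcons.
  have s1E : alternating i j (size s1) = s1 by rewrite -prefix 1?ltnW // s12 take_size_cat.
  exists (size s1).+1, s2; rewrite -rE cat_rcons -s12; split=> //.
  rewrite alternatingS word_cons word_rcons -pE s1E.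
  by rewrite (weyl_conj rd) //; apply: (weyl_word rd).
have s1E : s1 = alternating i j k ++ drop k s1.
  by rewrite -{1}(cat_take_drop k s1) -(prefix k) // s12 takel_cat.
exists (drop k s1 ++ s2).
have wE : word s = word (alternating j i k.+1 ++ (drop k s1 ++ s2)).
  by rewrite alternatingS cat_cons catA -s1E word_cons -E mulmxA (sK rd) mul1mx.
split=> //; rewrite /reduced -wE -(eqP rs) s12.
have := congr1 size s1E; rewrite !size_cat !size_alternating /= => sz1.
by apply/eqP; lia.
Qed.

(** With [i] and [j] both left descents the previous lemma applies again with their roles exchanged.
    The tail, bounded by [d], shrinks each time, so a dihedral relation must appear. *)
Lemma two_descents d i j k q : (size q <= d)%N ->
  let w := word (alternating i j k ++ q) in reduced a (alternating i j k ++ q) ->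
  ev (a i) (w *m v0) < 0 -> ev (a j) (w *m v0) < 0 ->
  exists m q', [/\ (0 < m)%N, word (alternating i j m) = word (alternating j i m),
    w = word (alternating i j m ++ q') & reduced a (alternating i j m ++ q')].
Proof.
elim: d i j k q => [|d IH] i j k q qd w rs iw jw.
  have [[m [q' [m0 mE sE]]]|[q' [wE rs']]] := alternating_descent rs jw.
    by exists m, q'; rewrite -sE.
  move: (rs) (rs'); rewrite /reduced -wE !size_cat !size_alternating => /eqP E /eqP E'.
  by lia.
have [[m [q' [m0 mE sE]]]|[q' [wE rs']]] := alternating_descent rs jw.
  by exists m, q'; rewrite -sE.
have q'd : (size q' <= d)%N.
  move: (rs) (rs'); rewrite /reduced -wE !size_cat !size_alternating => /eqP E /eqP E'.
  by lia.
have := IH j i k.+1 q' q'd rs'; rewrite -wE -/w => /(_ jw iw) [m [q1 [m0 mE wE1 rs1]]].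
exists m, q1; split=> //; first by rewrite wE1 !word_cat mE.
by move: rs1; rewrite /reduced !word_cat mE !size_cat !size_alternating.
Qed.

Variables (H : algType F) (T : 'I_r -> H).
Hypothesis braid : forall i j m, i != j -> has_order (s_ i *m s_ j) m ->
  \prod_(k <- alternating i j m) T k = \prod_(k <- alternating j i m) T k.

(** Only words with different first letters [i] and [j] need work. Both letters are then left
    descents, and the two words are linked through words starting with the two sides of a braid
    relation. *)
Lemma matsumoto s s' : reduced a s -> reduced a s' -> word s = word s' ->
  \prod_(j <- s) T j = \prod_(j <- s') T j.
Proof.
have [N] := ubnP (size s); elim: N s s' => // N IH [|i s] s' sN rs rs' E.
  by move: rs'; rewrite /reduced -E -(eqP rs) => /nilP->.
case: s' => [|j s'] in rs' E *; first by move: rs; rewrite /reduced E -(eqP rs').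
have su k : s_ k \in unitmx by apply/(weyl_unit rd)/(weyl_s rd).
have [rs1 i1 l1] := reduced_cons rd rs; have [rs2 j1 l2] := reduced_cons rd rs'.
rewrite !big_cons; have [ij|ij] := eqVneq i j.
  rewrite -ij; congr (_ * _); apply: IH => //.
  by move: E; rewrite -ij !word_cons => /(congr1 (mulmx (invmx (s_ i)))); rewrite !mulKmx.
set w := word (i :: s) in E.
have Ww : W w by exact: (weyl_word rd).
have iw : ev (a i) (w *m v0) < 0 by rewrite /w word_cons -mulmxA (ev_simple_s rd) oppr_lt0.
have jw : ev (a j) (w *m v0) < 0 by rewrite E word_cons -mulmxA (ev_simple_s rd) oppr_lt0.
have [||m0 [q0 [m00 m0E w0E rq0]]] := @two_descents _ i j 1 s (leqnn _) rs => //.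
rewrite -[word _]/w in w0E.
(* [braid] asks for the exact order of [s_i *m s_j], while [m0] is only some positive exponent
   giving the identity; the least one is taken. *)
pose P k := (0 < k)%N && ((s_ i *m s_ j) ^+ k == 1).
have exP : exists k, P k by exists m0; rewrite /P m00; apply/eqP/word_alternating_eq.
case: (ex_minnP exP) => m /andP[mpos /eqP mP] mmin.
have mord : has_order (s_ i *m s_ j) m.
  split=> // k /andP[kpos km] kE; have := mmin k; rewrite /P kpos kE eqxx => /(_ isT).
  by rewrite leqNgt km.
have mm0 : (m <= m0)%N by apply: mmin; rewrite /P m00; apply/eqP/word_alternating_eq.
have mE : word (alternating i j m) = word (alternating j i m) by apply/word_alternating_eq.
(* [q] completes both alternating words of length [m] to reduced words of [w], one starting with [i]
   and one with [j]; the induction hypothesis will apply to their tails. *)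
pose q := drop m (alternating i j m0 ++ q0).
have qE : alternating i j m ++ q = alternating i j m0 ++ q0.
  rewrite -[RHS](cat_take_drop m) takel_cat ?size_alternating //.
  by rewrite take_alternating.
rewrite -qE in w0E rq0.
have rq1 : reduced a (alternating j i m ++ q).
  by move: rq0; rewrite /reduced !word_cat mE !size_cat !size_alternating.
have w1E : w = word (alternating j i m ++ q) by rewrite w0E !word_cat mE.
have := braid ij mord.
case: m mpos {mP mmin mord mm0 mE} @q qE w0E rq0 rq1 w1E => // m _ q _ w0E rq0 rq1 w1E bE.
rewrite !alternatingS !cat_cons in w0E rq0 rq1 w1E bE.
have [rqi _ _] := reduced_cons rd rq0; have [rqj _ _] := reduced_cons rd rq1.
rewrite (IH s (alternating j i m ++ q)) //; last first.
  by apply: (can_inj (mulKmx (su i))); rewrite -!word_cons -w0E.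
rewrite (IH s' (alternating i j m ++ q)) //; last 2 first.
- by rewrite (eqP rs2) -ltnS -l2 -E -(eqP rs).
- by apply: (can_inj (mulKmx (su j))); rewrite -!word_cons -w1E -E.
by rewrite !big_cat /= !mulrA -!(big_cons _ _ _ _ xpredT) bE.
Qed.

Lemma Tw_word s : reduced a s -> Tw a T (word s) = \prod_(j <- s) T j.
Proof.
move=> rs; have Ws := weyl_word rd s.
by apply: matsumoto => //; [exact: (redword_reduced rd) | exact: (word_redword rd)].
Qed.

Lemma TwM u v : W u -> W v -> len (u *m v) = (len u + len v)%N ->
  Tw a T (u *m v) = Tw a T u * Tw a T v.
Proof.
move=> Wu Wv E; have rs := reduced_word_cat rd Wu Wv E.
by rewrite -{1}(word_redword rd Wu) -{1}(word_redword rd Wv) -word_cat Tw_word // big_cat.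
Qed.

Lemma Tw1 : Tw a T 1%:M = 1.
Proof.
rewrite -(word_nil (a := a)) Tw_word ?big_nil //.
by rewrite /reduced word_nil (len1 rd).
Qed.

Lemma Tw_s j : Tw a T (s_ j) = T j.
Proof.
rewrite -(word1 (a := a)) Tw_word ?big_seq1 //.
by rewrite /reduced word1 (len_s rd).
Qed.

End Matsumoto.

(** * Symmetrizers in Hecke algebras *)

Lemma fsum_morph (I : choiceType) (A : set I) (U V : nmodType)
    (f : U -> V) (G : I -> U) : finite_set A ->
  f 0 = 0 -> (forall x y, f (x + y) = f x + f y) ->
  f (\sum_(i \in A) G i) = \sum_(i \in A) f (G i).
Proof. by move=> fA f0 fD; rewrite !fsbig_finite // (big_morph f fD f0). Qed.

Lemma fsum_scaler (F : fieldType) (I : choiceType) (A : set I) (U : lmodType F)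
    (k : F) (G : I -> U) : finite_set A ->
  k *: (\sum_(i \in A) G i) = \sum_(i \in A) k *: G i.
Proof. by move=> fA; rewrite !fsbig_finite // scaler_sumr. Qed.

Lemma fsum_mulr (S : pzRingType) (I : choiceType) (A : set I) (k : S) (G : I -> S) :
  finite_set A -> k * (\sum_(i \in A) G i) = \sum_(i \in A) k * G i.
Proof. by move=> fA; rewrite !fsbig_finite // mulr_sumr. Qed.

Lemma fsum_mull (S : pzRingType) (I : choiceType) (A : set I) (k : S) (G : I -> S) :
  finite_set A -> (\sum_(i \in A) G i) * k = \sum_(i \in A) G i * k.
Proof. by move=> fA; rewrite !fsbig_finite // mulr_suml. Qed.

Lemma eq_fsum (I : choiceType) (A : set I) (U : nmodType) (f g : I -> U) :
  (forall i, A i -> f i = g i) -> \sum_(i \in A) f i = \sum_(i \in A) g i.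
Proof. by move=> E; apply: eq_fsbigr => i; rewrite inE; apply: E. Qed.

Section HeckeTheory.
Context {R : realType} {n : nat} {Phi : {fset 'rV[R]_n}}.
Context {r : nat} {a : 'I_r -> 'rV[R]_n} {v0 : 'cV[R]_n} {F : fieldType}.
Hypothesis rd : root_datum Phi a v0.
Context {c : 'cV[R]_n}.
Hypothesis dc : dominant a c.
Implicit Types (be : 'rV[R]_n) (w u v : 'M[R]_n) (s q : seq 'I_r) (i j : 'I_r).
Local Notation s_ j := (refl (a j)).
Local Notation W := (weyl Phi).
Local Notation Wc := (stab Phi c).
Local Notation word := (word a).
Local Notation len := (len a).

Context {H : algType F} {T : 'I_r -> H} {t : 'rV[R]_n -> F}.
Hypothesis braid : forall i j m, i != j -> has_order (s_ i *m s_ j) m ->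
  \prod_(k <- alternating i j m) T k = \prod_(k <- alternating j i m) T k.
Hypothesis quad : forall j, (T j - (t (a j))%:A) * (T j + (t (a j))^-1%:A) = 0.
Hypothesis t0 : forall be, be \in Phi -> t be != 0.
Local Notation Tw := (Tw a T).
Local Notation q j := (t (a j) - (t (a j))^-1).

Lemma finite_weyl : finite_set W.
Proof.
pose N := size (Phi : seq _).
apply: (@sub_finite_set _ _ (\bigcup_(k in `I_N.+1)
    ((fun s : k.-tuple 'I_r => word s) @` setT))).
  move=> w Ww; exists (len w); first by rewrite /= ltnS (len_bound rd Ww).
  by exists (in_tuple (redword a w)) => //=; apply: (word_redword rd).
apply: bigcup_finite => [|k _]; first exact: finite_II.
exact: finite_image finite_finset.
Qed.

Lemma finite_stab : finite_set Wc.
Proof. by apply: sub_finite_set finite_weyl => v []. Qed.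

Lemma finite_mincoset : finite_set (mincoset a Phi c).
Proof. by apply: sub_finite_set finite_weyl => v []. Qed.

Lemma sq_T j : T j * T j = q j *: T j + 1.
Proof.
have t0j := t0 (simple_root rd j); have := quad j.
rewrite mulrBl !mulrDr mulr_algr !mulr_algl scalerA mulfV // scale1r.
by move=> /subr0_eq E; rewrite scalerBl addrAC -E addrK.
Qed.

Definition Ti j : H := T j - (q j)%:A.

Lemma TiT j : Ti j * T j = 1.
Proof. by rewrite /Ti mulrBl sq_T -scalerAl mul1r addrC addKr. Qed.

Lemma TTi j : T j * Ti j = 1.
Proof. by rewrite /Ti mulrBr sq_T -scalerAr mulr1 addrC addKr. Qed.

Lemma Tw_up j w : W w -> len (s_ j *m w) = (len w).+1 -> Tw (s_ j *m w) = T j * Tw w.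
Proof.
move=> Ww E; rewrite (TwM rd braid) ?(Tw_s rd braid) //; first exact: (weyl_s rd).
by rewrite E (len_s rd).
Qed.

Lemma Tw_upr j w : W w -> len (w *m s_ j) = (len w).+1 -> Tw (w *m s_ j) = Tw w * T j.
Proof.
move=> Ww E; rewrite (TwM rd braid) ?(Tw_s rd braid) //; first exact: (weyl_s rd).
by rewrite E (len_s rd) addn1.
Qed.

Lemma len_dich j w : W w -> len (s_ j *m w) = (len w).+1 \/ len w = (len (s_ j *m w)).+1.
Proof.
move=> Ww; have := root_simple_neq0 rd j Ww; rewrite neq_lt => /orP[jw|jw].
  by right; apply: (len_down rd).
by left; apply: (len_up rd).
Qed.

Lemma invmxM u w : W u -> W w -> invmx (u *m w) = invmx w *m invmx u.
Proof.
by move=> Wu Ww; rewrite !(weyl_invE rd) ?trmx_mul //; apply: weylM.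
Qed.

Lemma inv_s j : invmx (s_ j) = s_ j.
Proof. by rewrite (weyl_invE rd) ?refl_tr //; apply: (weyl_s rd). Qed.

Lemma len_dichr j w : W w -> len (w *m s_ j) = (len w).+1 \/ len w = (len (w *m s_ j)).+1.
Proof.
move=> Ww; have Ws := weyl_s rd j.
rewrite -(len_inv rd (weylM Ww Ws)) -(len_inv rd Ww) invmxM // inv_s.
exact/len_dich/(weyl_inv rd).
Qed.

Section Symmetrizer.
Variable e : 'rV[R]_n -> F.
Hypothesis eW : weyl_inv_weight (Phi := Phi) e.
Hypothesis eq : forall j, e (a j) * e (a j) = q j * e (a j) + 1.
Local Notation tl := (tlen a e).

Local Notation S := (symmetrizer a T e Wc).

(** Left and right multiplication by T_j at once, with [f] the corresponding multiplication by
    [s_j]. The alternatives are length going up or down, encoded as [d v] being 0 or t_j - t_j^-1.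
    After reindexing by [f], comparing the coefficients of T_v leaves the quadratic equation of
    [e]. *)
Lemma sym_invol j (op : H -> H) (f : 'M[R]_n -> 'M[R]_n) :
  linear op -> (forall v, Wc v -> Wc (f v)) -> (forall v, f (f v) = v) ->
  (forall v, Wc v -> op (Tw v) = Tw (f v) /\ tl (f v) = e (a j) * tl v \/
     op (Tw v) = q j *: Tw v + Tw (f v) /\ tl v = e (a j) * tl (f v)) ->
  op S = e (a j) *: S.
Proof.
move=> opP fW fK dich; have fin := finite_stab.
have op0 : op 0 = 0 by have := opP (-1) 0 0; rewrite scaleN1r addNr scaleN1r addNr.
have opD x y : op (x + y) = op x + op y by have := opP 1 x y; rewrite !scale1r.
have opZ k x : op (k *: x) = k *: op x by have := opP k x 0; rewrite op0 !addr0.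
pose d v : F := if `[< op (Tw v) = Tw (f v) /\ tl (f v) = e (a j) * tl v >] then 0 else q j.
have opE v : Wc v -> op (Tw v) = d v *: Tw v + Tw (f v).
  move=> /dich; rewrite /d; case: asboolP => [[-> _]|nd [|[]]] //.
  by rewrite scale0r add0r.
have tlE v : Wc v -> tl v * d v + tl (f v) = e (a j) * tl v.
  move=> /dich; rewrite /d; case: asboolP => [[_ ->]|nd [|[_ ->]]] //.
    by rewrite mulr0 add0r.
  by rewrite mulrA eq mulrDl mul1r mulrC mulrA.
rewrite /symmetrizer fsum_morph // fsum_scaler //.
transitivity (\sum_(v \in Wc) ((tl v * d v) *: Tw v + tl v *: Tw (f v))).
  by apply: eq_fsum => v Wv; rewrite opZ opE // scalerDr scalerA.
rewrite fsbig_split //=.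
have -> : \sum_(v \in Wc) tl v *: Tw (f v) = \sum_(v \in Wc) tl (f v) *: Tw v.
  rewrite (reindex_fsbig f Wc Wc).
    by apply: eq_fsum => v _; rewrite fK.
  split=> [v /fW//|v v' _ _ /(congr1 f)|v Wv]; first by rewrite !fK.
  by exists (f v); rewrite ?fK //; apply: fW.
rewrite -fsbig_split //=; apply: eq_fsum => v Wv.
by rewrite -scalerDl tlE // scalerA.
Qed.

Lemma T_sym j : ev (a j) c = 0 -> T j * S = e (a j) *: S.
Proof.
move=> jc; have Ws := weyl_s rd j.
have lin : linear (fun h => T j * h) by move=> k x y; rewrite mulrDr scalerAr.
apply: (sym_invol (f := mulmx (s_ j)) lin); first by move=> v; apply: stabM (stab_s rd jc).
  by move=> v; rewrite mulmxA (sK rd) mul1mx.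
move=> v Wv; have [Wv' _] := Wv; have Wsv := weylM Ws Wv'.
have [E|E] := len_dich j Wv'; [left|right].
  by rewrite Tw_up // (tlen_mul rd eW) ?(tlen_s rd eW) ?(len_s rd).
have sK : s_ j *m (s_ j *m v) = v by rewrite mulmxA (sK rd) mul1mx.
have vE : Tw v = T j * Tw (s_ j *m v) by rewrite -Tw_up // sK.
have tE : tl v = e (a j) * tl (s_ j *m v).
  by rewrite -{1}sK (tlen_mul rd eW) ?(tlen_s rd eW) ?(len_s rd) // sK.
by rewrite vE mulrA sq_T mulrDl mul1r -scalerAl.
Qed.

Lemma sym_T j : ev (a j) c = 0 -> S * T j = e (a j) *: S.
Proof.
move=> jc; have Ws := weyl_s rd j.
have lin : linear (fun h => h * T j) by move=> k x y; rewrite mulrDl scalerAl.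
have sK v : v *m s_ j *m s_ j = v by rewrite -mulmxA (sK rd) mulmx1.
apply: (sym_invol (f := fun v => v *m s_ j) lin) => [v Wv|//|v Wv].
  exact: stabM Wv (stab_s rd jc).
have [Wv' _] := Wv; have Wsv := weylM Wv' Ws.
have [E|E] := len_dichr j Wv'; [left|right].
  by rewrite Tw_upr // (tlen_mul rd eW) ?(tlen_s rd eW) ?(len_s rd) ?addn1 // mulrC.
have vE : Tw v = Tw (v *m s_ j) * T j by rewrite -Tw_upr // sK.
have tE : tl v = e (a j) * tl (v *m s_ j).
  by rewrite -{1}(sK v) (tlen_mul rd eW) ?(tlen_s rd eW) ?(len_s rd) ?addn1 ?sK // mulrC.
by rewrite vE -mulrA sq_T mulrDr mulr1 -scalerAr.
Qed.

Lemma Tw_sym v : Wc v -> Tw v * S = tl v *: S.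
Proof.
move: v; apply: (stab_ind rd dc) => [|j v Wv jc E IH].
  by rewrite (Tw1 rd braid) (tlen1 rd eW) mul1r scale1r.
have [Wv' _] := Wv; rewrite Tw_up // -mulrA IH -scalerAr T_sym // scalerA.
by rewrite (tlen_mul rd eW) ?(tlen_s rd eW) ?(len_s rd) ?(mulrC (tl v)) //; apply: (weyl_s rd).
Qed.

(* Pair v with v s_j. *)
Lemma sym_factor j : ev (a j) c = 0 -> exists h, S = h * (1 + e (a j) *: T j).
Proof.
move=> jc; have Ws := weyl_s rd j; have fin := finite_stab.
pose B := [set v | len (v *m s_ j) = (len v).+1].
have finB : finite_set (Wc `&` B) by apply: finite_setIl.
exists (\sum_(v \in Wc `&` B) tl v *: Tw v).
rewrite /symmetrizer (fsbigID B) // mulrDr mulr1; congr (_ + _).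
have sK v : v *m s_ j *m s_ j = v by rewrite -mulmxA (sK rd) mulmx1.
rewrite fsum_mull // (reindex_fsbig (fun v => v *m s_ j) (Wc `&` B)).
  apply: eq_fsum => v [[Wv vc] vB].
  rewrite Tw_upr // (tlen_mul rd eW) ?(tlen_s rd eW) ?(len_s rd) ?addn1 //.
  by rewrite -scalerAl -scalerAr scalerA.
have stabs v : Wc v -> Wc (v *m s_ j) by move=> Wv; apply: stabM Wv (stab_s rd jc).
split=> [v [Wv vB]|v v' _ _ /(congr1 (mulmx^~ (s_ j)))|v [Wv vB]].
- by split; [exact: stabs | rewrite /B /= sK; move: vB; rewrite /B /=; lia].
- by rewrite !sK.
- exists (v *m s_ j); last exact: sK.
  split; first exact: stabs.
  rewrite /B /= sK; have [E|//] := len_dichr j (proj1 Wv).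
  by case: vB.
Qed.

End Symmetrizer.

Lemma hinvE (h g : H) : g * h = 1 -> h * g = 1 -> hinv h = g.
Proof.
move=> gh hg; apply: xget_unique => [//|k [kh hk]].
by rewrite -[k]mulr1 -hg mulrA kh mul1r.
Qed.

Lemma Tw_invertible w : W w -> hinv (Tw w) * Tw w = 1 /\ Tw w * hinv (Tw w) = 1.
Proof.
move=> _; suff [g gh hg] : exists2 g, g * Tw w = 1 & Tw w * g = 1.
  by rewrite (hinvE gh hg).
rewrite /Defs.Tw; elim: (redword a w) => [|j s [g gh hg]].
  by rewrite big_nil; exists 1; rewrite mulr1.
rewrite big_cons; exists (g * Ti j).
  by rewrite mulrA -(mulrA g) TiT mulr1.
by rewrite -mulrA (mulrA _ g) hg mul1r TTi.
Qed.

Lemma hinv_Tw1 : hinv (Tw 1%:M) = 1.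
Proof. by apply: hinvE; rewrite (Tw1 rd braid) mulr1. Qed.

Lemma hinv_TwM u w : W u -> W w -> len (u *m w) = (len u + len w)%N ->
  hinv (Tw (u *m w)) = hinv (Tw w) * hinv (Tw u).
Proof.
move=> Wu Ww E; have [p1 p2] := Tw_invertible Wu; have [p3 p4] := Tw_invertible Ww.
rewrite (TwM rd braid) //; apply: hinvE.
  by rewrite mulrA -(mulrA _ _ (Tw u)) p1 mulr1.
by rewrite mulrA -(mulrA (Tw u)) p4 mulr1.
Qed.

Lemma hinv_T j : hinv (Tw (s_ j)) = Ti j.
Proof. by apply: hinvE; rewrite (Tw_s rd braid) (TiT, TTi). Qed.

End HeckeTheory.

Arguments Ti {R n r} a {F H} T t j.

Section HeckeCosets.
Context {R : realType} {n : nat} {Phi : {fset 'rV[R]_n}}.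
Context {r : nat} {a : 'I_r -> 'rV[R]_n} {v0 : 'cV[R]_n} {F : fieldType}.
Hypothesis rd : root_datum Phi a v0.
Context {c : 'cV[R]_n}.
Hypothesis dc : dominant a c.
Implicit Types (be : 'rV[R]_n) (w u v : 'M[R]_n) (s q : seq 'I_r) (i j : 'I_r).
Local Notation s_ j := (refl (a j)).
Local Notation W := (weyl Phi).
Local Notation Wc := (stab Phi c).
Local Notation len := (len a).
Context {H : algType F} {T : 'I_r -> H} {t e : 'rV[R]_n -> F}.
Hypothesis braid : forall i j m, i != j -> has_order (s_ i *m s_ j) m ->
  \prod_(k <- alternating i j m) T k = \prod_(k <- alternating j i m) T k.
Hypothesis quad : forall j, (T j - (t (a j))%:A) * (T j + (t (a j))^-1%:A) = 0.
Hypothesis t0 : forall be, be \in Phi -> t be != 0.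
Hypothesis eW : weyl_inv_weight (Phi := Phi) e.
Hypothesis eq : forall j, e (a j) * e (a j) = (t (a j) - (t (a j))^-1) * e (a j) + 1.
Local Notation Tw := (Tw a T).
Local Notation tl := (tlen a e).

Lemma weight_neq0 j : e (a j) != 0.
Proof. by apply/eqP => E; have := eq j; rewrite E !mulr0 add0r => /esym/eqP; rewrite oner_eq0. Qed.

Lemma tl_neq0 w : tl w != 0.
Proof.
rewrite /tlen prodf_seq_neq0; apply/allP => j _.
by rewrite implyTb weight_neq0.
Qed.

Lemma stab0 : stab Phi 0 = W.
Proof. by apply/seteqP; split=> [w []//|w Ww]; split=> //; rewrite mulmx0. Qed.

Lemma dominant0 : dominant a 0.
Proof. by move=> j; rewrite ev0r. Qed.

Lemma sym_coset : symmetrizer a T e W =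
  \sum_(u \in mincoset a Phi c) tl u *: (Tw u * symmetrizer a T e Wc).
Proof.
have fc := finite_stab rd (c := c); have fm := finite_mincoset rd (c := c).
rewrite {1}/symmetrizer.
rewrite (reindex_fsbig (fun p => p.1 *m p.2) (mincoset a Phi c `*` Wc)).
  rewrite -(pair_fsbig _ (fun u v => tl (u *m v) *: Tw (u *m v))) //.
  apply: eq_fsum => u mu; have Wu := mincoset_weyl mu.
  rewrite fsum_mulr // fsum_scaler //; apply: eq_fsum => v Wv.
  have E := mincoset_mul rd dc mu Wv; have [Wv' _] := Wv.
  by rewrite (tlen_mul rd eW) // (TwM rd braid) // -scalerAr scalerA.
split=> [[u v] [/= mu Wv]|[u v] [u' v'] /set_mem[/= mu Wv] /set_mem[/= mu' Wv'] E|w Ww].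
- by apply: weylM (mincoset_weyl mu) (proj1 Wv).
- have uE : u = u'.
    apply: (mincoset_uniq rd dc) => //; have := congr1 (mulmx^~ c) E.
    by rewrite -!mulmxA (proj2 Wv) (proj2 Wv').
  move: E; rewrite -uE => /(congr1 (mulmx (invmx u))).
  by rewrite !mulKmx ?(weyl_unit rd (mincoset_weyl mu)) // => ->.
- have [u mu uc] := mincoset_exists (a := a) (c := c) Ww; have Wu := mincoset_weyl mu.
  exists (u, invmx u *m w).
    split=> //=; split; first by apply: weylM => //; apply: (weyl_inv rd).
    by rewrite -mulmxA -uc (weylK rd).
  by rewrite /= mulKVmx // (weyl_unit rd).
Qed.

Let w0 := longest a Wc.

Lemma tl_longest v : Wc v -> tl (w0 *m v) * tl v = tl w0.
Proof.
move=> Wv; have Wvi := stab_inv rd Wv.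
have W0 := longest_weyl rd (c := c); have [Wv' _] := Wv; have [Wvi' _] := Wvi.
have vE : w0 = (w0 *m v) *m invmx v by rewrite mulmxK // (weyl_unit rd).
have Wwv := weylM W0 Wv'.
have lE : len (w0 *m v *m invmx v) = (len (w0 *m v) + len (invmx v))%N.
  by rewrite -vE (len_inv rd) // (len_longestl rd dc).
by rewrite [in RHS]vE (tlen_mul rd eW Wwv Wvi' lE) (tlen_inv rd eW).
Qed.

(** Since [w0] is [w0 *m v] times the inverse of [v] with lengths adding, the inverse of T at v^-1
    is T_{w0}^-1 T_{w0 v}, and 1 / tl v = tl (w0 v) / tl w0. The sum becomes T_{w0}^-1 times the
    symmetrizer, over tl w0; as T_{w0} acts on the symmetrizer by tl w0, a square results. *)
Lemma sym_inv : \sum_(v \in Wc) (tl v)^-1 *: hinv (Tw (invmx v)) =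
  (tl w0)^-1 ^+ 2 *: symmetrizer a T e Wc.
Proof.
have fc := finite_stab rd (c := c); have W0 := longest_weyl rd (c := c).
have S0 := longest_stab rd (c := c).
have [h1 h2] := Tw_invertible rd quad t0 W0.
have hS : hinv (Tw w0) * symmetrizer a T e Wc = (tl w0)^-1 *: symmetrizer a T e Wc.
  have := Tw_sym rd dc braid quad t0 eW eq S0.
  move=> /(congr1 (fun h => (tl w0)^-1 *: (hinv (Tw w0) * h))).
  by rewrite mulrA h1 mul1r -scalerAr scalerA mulVf ?tl_neq0 // scale1r => ->.
rewrite expr2 -scalerA -hS /symmetrizer.
rewrite [in RHS](reindex_fsbig (fun v => w0 *m v) Wc Wc); last first.
  have K := longestK rd dc.
  split=> [v Wv|v v' _ _ /(congr1 (mulmx w0))|v Wv].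
  - exact: stabM.
  - by rewrite !mulmxA K !mul1mx.
  - by exists (w0 *m v); [exact: stabM | rewrite mulmxA K mul1mx].
rewrite fsum_mulr // fsum_scaler //; apply: eq_fsum => v Wv.
have Wvi := stab_inv rd Wv; have [Wv' _] := Wv; have [Wvi' _] := Wvi.
have Wwv := weylM W0 Wv'.
have vE : w0 = (w0 *m v) *m invmx v by rewrite mulmxK // (weyl_unit rd).
have TE : Tw w0 = Tw (w0 *m v) * Tw (invmx v).
  have lE : len (w0 *m v *m invmx v) = (len (w0 *m v) + len (invmx v))%N.
    by rewrite -vE (len_inv rd) // (len_longestl rd dc).
  by rewrite [in LHS]vE (TwM rd braid Wwv Wvi' lE).
have [g1 g2] := Tw_invertible rd quad t0 Wvi'.
have -> : hinv (Tw (invmx v)) = hinv (Tw w0) * Tw (w0 *m v).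
  by rewrite -[LHS]mul1r -h1 TE -!mulrA g2 mulr1.
rewrite -scalerAr scalerA; congr (_ *: _).
by rewrite -(tl_longest Wv) mulrC invfM mulrA mulfV ?mul1r // tl_neq0.
Qed.

End HeckeCosets.

(** * Existence of divided differences *)

Section Divided.
Context {R : realType} {n : nat} {F : fieldType} {A : freeModule R n F}.
Local Notation V := 'cV[R]_n.
Local Notation xx := (@fx R n F A).

(** A finite geometric sum. Keeping track of a set [S] stable under translation by [al] and [- al]
    serves both F[Lam] and F[E]. *)
Lemma tB_exists (S : set V) (al y : V) (m : int) :
  (forall z, S z -> S (z + al)) -> (forall z, S z -> S (z - al)) -> S y ->
  exists2 h : A, fsupp S h & tB al h = xx (y - al *~ m) - xx y.
Proof.
move=> Sp Sm.
have pos (p : nat) z : S z -> exists2 h : A, fsupp S h & tB al h = xx (z + al *+ p) - xx z.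
  move=> Sz; elim: p => [|p [h Sh hE]].
    by exists 0; [exact: fsupp0 | rewrite linear0 mulr0n addr0 subrr].
  have Sp' : S (z + al *+ p).
    by elim: p {h Sh hE} => [|p IH]; rewrite ?addr0 // mulrSr addrA; apply: Sp.
  exists (h + xx (z + al *+ p)); first by apply: fsuppD => //; apply: fsupp_x.
  by rewrite linearD /= hE /tB tr_x mulrSr [z + (_ + _)]addrA [LHS]addrC addrA subrK.
case: m => p Sy; last first.
  have [h Sh hE] := pos p.+1 y Sy; exists h => //.
  by rewrite NegzE mulrNz opprK hE.
have Sy' : S (y - al *+ p).
  by elim: p => [|p IH]; rewrite ?subr0 // mulrSr opprD addrA; apply: Sm.
have [h Sh hE] := pos p _ Sy'; exists (- h); first exact: fsuppN.
by rewrite linearN /= hE subrK opprB.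
Qed.

End Divided.

(** * Coefficients of symmetrized quasi-polynomials *)

Section QuasiPolynomials.
Context {R : realType} {n : nat} {Phi : {fset 'rV[R]_n}}.
Context {r : nat} {a : 'I_r -> 'rV[R]_n} {v0 : 'cV[R]_n} {F : fieldType}.
Hypothesis rd : root_datum Phi a v0.
Context {A : freeModule R n F} {Lam : set 'cV[R]_n}.
Local Notation V := 'cV[R]_n.
Local Notation xx := (@fx R n F A).
Implicit Types (be : 'rV[R]_n) (w u v : 'M[R]_n) (i j : 'I_r).
Implicit Types (f g m : A) (y z lam : V) (k : F).
Local Notation s_ j := (refl (a j)).
Local Notation W := (weyl Phi).
Local Notation len := (len a).

Hypothesis LamD : forall x y, Lam x -> Lam y -> Lam (x + y).
Hypothesis LamN : forall x, Lam x -> Lam (- x).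
Hypothesis Lam_coroot : forall be, be \in Phi -> Lam (coroot be).
Hypothesis Lam_int : forall be lam, be \in Phi -> Lam lam -> ev be lam \is a Num.int.
Hypothesis Lam0 : Lam 0.

Context {H : algType F} {T : 'I_r -> H} {t : 'rV[R]_n -> F}.
Hypothesis braid : forall i j (m : nat), i != j -> has_order (s_ i *m s_ j) m ->
  \prod_(k <- alternating i j m) T k = \prod_(k <- alternating j i m) T k.
Hypothesis quad : forall j, (T j - (t (a j))%:A) * (T j + (t (a j))^-1%:A) = 0.
Hypothesis t0 : forall be, be \in Phi -> t be != 0.
Hypothesis tW : weyl_inv_weight (Phi := Phi) t.
Local Notation Tw := (Tw a T).
Local Notation q j := (t (a j) - (t (a j))^-1).

Local Notation FL := (@fsupp R n F A Lam).

Variable nab : 'I_r -> A -> A.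
Hypothesis nabP : forall j f, FL f ->
  FL (nab j f) /\ tB (coroot (a j)) (nab j f) = wact (s_ j) f - f.

Variable pi : H -> A -> A.
Hypothesis pi_stable : forall h f, FL f -> FL (pi h f).
Hypothesis pi_lin : forall h k f g, FL f -> FL g ->
  pi h (k *: f + g) = k *: pi h f + pi h g.
Hypothesis pi_linH : forall k h h' f, FL f -> pi (k *: h + h') f = k *: pi h f + pi h' f.
Hypothesis pi1 : forall f, FL f -> pi 1 f = f.
Hypothesis piM : forall h h' f, FL f -> pi (h * h') f = pi h (pi h' f).
Hypothesis piT : forall j f, FL f ->
  pi (T j) f = t (a j) *: wact (s_ j) f + q j *: nab j f.

Lemma coroot_nz j : coroot (a j) != 0.
Proof.
apply/eqP => E; have := ev_corootxx (simple_nz rd j).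
by rewrite E ev0r => /eqP; rewrite eq_sym pnatr_eq0.
Qed.

Lemma Lam_mulz (x : V) (m : int) : Lam x -> Lam (x *~ m).
Proof.
move=> Lx; have pos (p : nat) : Lam (x *+ p).
  by elim: p => [|p IH]; rewrite ?mulr0n // mulrSr; apply: LamD.
case: m => p; first exact: pos.
by rewrite NegzE mulrNz; apply: LamN; apply: pos.
Qed.

Lemma Lam_weyl w lam : W w -> Lam lam -> Lam (w *m lam).
Proof.
move=> Ww; move: w Ww lam; apply: weyl_ind => [|be w be_ _ IH] lam Ll.
  by rewrite mul1mx.
rewrite -mulmxA reflE; apply: LamD; first exact: IH.
have /intrP[m ->] := Lam_int be_ (IH _ Ll).
by apply: LamN; rewrite scaler_int; apply: Lam_mulz; apply: Lam_coroot.
Qed.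

Lemma FL_wact w f : W w -> FL f -> FL (wact w f).
Proof. by move=> Ww; apply: fsupp_wact => y; apply: Lam_weyl. Qed.

Lemma FL_neg f : FL f -> FL (wact (- 1%:M) f).
Proof. by apply: fsupp_wact => y Ly; rewrite mulNmx mul1mx; apply: LamN. Qed.

Lemma wact_sK j f : wact (s_ j) (wact (s_ j) f) = f.
Proof. by rewrite -wactM (sK rd) wact1. Qed.

Lemma wact_neg_neg f : wact (- 1%:M) (wact (- 1%:M) f) = f.
Proof. by rewrite -wactM mulNmx mul1mx opprK wact1. Qed.

Lemma wact_negC w f : wact w (wact (- 1%:M) f) = wact (- 1%:M) (wact w f).
Proof. by rewrite -!wactM mulmxN mulmx1 mulNmx mul1mx. Qed.

Lemma nab_FL j f : FL f -> FL (nab j f). Proof. by case/(nabP j). Qed.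

Lemma nab_tB j f : FL f -> tB (coroot (a j)) (nab j f) = wact (s_ j) f - f.
Proof. by case/(nabP j). Qed.

(** The tool behind the identities for [nab]: both sides are compared after multiplication by x^al -
    1. *)
Lemma nab_uniq j f h : FL f -> tB (coroot (a j)) h = wact (s_ j) f - f -> nab j f = h.
Proof. by move=> Lf hE; apply: (tB_inj (coroot_nz j)); rewrite nab_tB. Qed.

Lemma nab_lin j k f g : FL f -> FL g -> nab j (k *: f + g) = k *: nab j f + nab j g.
Proof.
move=> Lf Lg; apply: nab_uniq; first exact: fsuppZD.
by rewrite linearP /= !nab_tB // wactP opprD addrACA scalerBr.
Qed.

Lemma nab0 j : nab j 0 = 0.
Proof. by apply: nab_uniq; [exact: fsupp0 | rewrite !linear0 addr0]. Qed.

Lemma nabD j f g : FL f -> FL g -> nab j (f + g) = nab j f + nab j g.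
Proof. by move=> Lf Lg; have := nab_lin j 1 Lf Lg; rewrite !scale1r. Qed.

Lemma nabZ j k f : FL f -> nab j (k *: f) = k *: nab j f.
Proof.
by move=> Lf; have := nab_lin j k Lf (fsupp0 Lam); rewrite nab0 !addr0.
Qed.

Lemma nabN j f : FL f -> nab j (- f) = - nab j f.
Proof. by move=> Lf; rewrite -scaleN1r nabZ // scaleN1r. Qed.

Lemma nab_conj (M : 'M[R]_n) i j f : M *m s_ j = s_ i *m M ->
  M *m coroot (a j) = coroot (a i) -> FL f -> FL (wact M f) ->
  wact M (nab j f) = nab i (wact M f).
Proof.
move=> sM cM Lf LMf; symmetry; apply: nab_uniq => //.
by rewrite /tB -{1}cM -wact_tr -linearB /= -/(tB _ _) nab_tB // linearB /= -!wactM sM.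
Qed.

(** The right side is x^al [nab j f]: applying [s_j] changes the sign of the numerator and turns the
    denominator x^al - 1 into x^-al - 1. *)
Lemma s_nab j f : FL f -> wact (s_ j) (nab j f) = nab j f + wact (s_ j) f - f.
Proof.
move=> Lf; apply: (tB_inj (coroot_nz j)); rewrite -addrA.
set al := coroot (a j); set N := nab j f; set d := wact (s_ j) f - f.
have cs : al = s_ j *m (- al).
  rewrite mulmxN reflE ev_corootxx ?(simple_nz rd) // scaler_nat mulr2n.
  by rewrite opprB addrK.
have trE : tr al N = N + d by rewrite /d -(nab_tB j Lf) /tB addrC subrK.
have trE' : tr (- al) N = N - tr (- al) d.
  by apply/eqP; rewrite eq_sym subr_eq -linearD /= -trE trD addNr tr0.
rewrite linearD /= (nab_tB j Lf) -/d {1}/tB {1}cs -wact_tr trE' linearB /= -/N wact_tr -cs.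
have -> : wact (s_ j) d = - d by rewrite /d linearB /= wact_sK opprB.
by rewrite linearN /= opprK addrAC subrr add0r /tB addrC subrK.
Qed.

Lemma nab_s j f : FL f -> nab j (wact (s_ j) f) = - nab j f.
Proof.
move=> Lf; have Ls := FL_wact (weyl_s rd j) Lf.
by apply: nab_uniq => //; rewrite linearN /= nab_tB // wact_sK opprB.
Qed.

Lemma nab_sym j f : FL f -> wact (s_ j) f = f -> nab j f = 0.
Proof. by move=> Lf sf; apply: nab_uniq => //; rewrite linear0 sf subrr. Qed.

Lemma nab_nab j f : FL f -> nab j (nab j f) = nab j f.
Proof.
move=> Lf; have LN := @nab_FL j f Lf; apply: nab_uniq => //; rewrite s_nab // nab_tB //.
by apply/eqP; rewrite eq_sym subr_eq [X in _ == X]addrC addrA.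
Qed.

(** The matrix [- s_j] fixes the coroot and commutes with [s_j], hence commutes with [nab j]; iota
    is its composite with [s_j]. *)
Lemma neg_nab j f : FL f ->
  wact (- 1%:M) (nab j (wact (- 1%:M) f)) = - (nab j f + wact (s_ j) f - f).
Proof.
move=> Lf; have Lnf := FL_neg Lf; rewrite -s_nab // -linearN /= -nab_s //.
have Lsf := FL_wact (weyl_s rd j) Lf; have Lnsf := FL_neg Lsf.
have -> : wact (- 1%:M) f = wact (- s_ j) (wact (s_ j) f).
  by rewrite -wactM mulNmx (sK rd).
rewrite -(@nab_conj (- s_ j) j j) //.
- by rewrite -wactM mulNmx mul1mx opprK.
- by rewrite mulNmx mulmxN.
- rewrite mulNmx reflE ev_corootxx ?(simple_nz rd) // scaler_nat mulr2n.
  by rewrite opprB addrK.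
- by rewrite -wactM mulNmx (sK rd).
Qed.

Lemma pi0r h : pi h 0 = 0.
Proof.
have := pi_lin h (-1) (fsupp0 Lam) (fsupp0 Lam).
by rewrite !scaleN1r !addNr.
Qed.

Lemma piDr h f g : FL f -> FL g -> pi h (f + g) = pi h f + pi h g.
Proof. by move=> Lf Lg; have := pi_lin h 1 Lf Lg; rewrite !scale1r. Qed.

Lemma piZr h k f : FL f -> pi h (k *: f) = k *: pi h f.
Proof. by move=> Lf; have := pi_lin h k Lf (fsupp0 Lam); rewrite pi0r !addr0. Qed.

Lemma piDl h h' f : FL f -> pi (h + h') f = pi h f + pi h' f.
Proof. by move=> Lf; have := pi_linH 1 h h' Lf; rewrite !scale1r. Qed.

Lemma pi0l f : FL f -> pi 0 f = 0.
Proof. by move=> Lf; have := pi_linH (-1) 0 0 Lf; rewrite !scaleN1r !addNr. Qed.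

Lemma piZl h k f : FL f -> pi (k *: h) f = k *: pi h f.
Proof. by move=> Lf; have := pi_linH k h 0 Lf; rewrite pi0l // !addr0. Qed.

Lemma pi_fsum (B : set 'M[R]_n) (h : 'M[R]_n -> H) f : finite_set B -> FL f ->
  pi (\sum_(w \in B) h w) f = \sum_(w \in B) pi (h w) f.
Proof.
move=> fB Lf; apply: (fsum_morph (f := pi^~ f)) => //; first exact: pi0l.
by move=> x y; apply: piDl.
Qed.

Lemma pi_Ti j f : FL f ->
  pi (Ti a T t j) f = t (a j) *: wact (s_ j) f + q j *: nab j f - q j *: f.
Proof.
by move=> Lf; rewrite /Ti piDl // -scaleNr piZl // pi1 // piT // scaleNr.
Qed.

Lemma pi_TiT j f : FL f -> pi (Ti a T t j) (pi (T j) f) = f.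
Proof. by move=> Lf; rewrite -piM // (TiT rd quad t0) pi1. Qed.

(* Conjugation by M = - w0 realizes the diagram automorphism j -> i. *)
Lemma pi_conj (M : 'M[R]_n) i j f : M *m s_ j = s_ i *m M ->
  M *m coroot (a j) = coroot (a i) -> t (a i) = t (a j) ->
  FL f -> FL (wact M f) -> wact M (pi (T j) f) = pi (T i) (wact M f).
Proof.
move=> sM cM tij Lf LMf; rewrite !piT // linearD /= !linearZ /= -tij.
by rewrite (nab_conj sM cM) // -!wactM sM.
Qed.

(** * Symmetrizers of the stabilizer in the polynomial representation *)

Section FixedPoint.
Context {c : V}.
Hypothesis dc : dominant a c.
Local Notation Wc := (stab Phi c).
Local Notation w0 := (longest a Wc).

Lemma longest_conj j : ev (a j) c = 0 -> exists i, [/\ ev (a i) c = 0,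
  w0 *m s_ j = s_ i *m w0, w0 *m coroot (a j) = - coroot (a i) &
  forall e : 'rV[R]_n -> F, weyl_inv_weight (Phi := Phi) e -> e (a i) = e (a j)].
Proof.
move=> jc; have [i ic jE] := longest_star rd dc jc.
have W0 := longest_weyl rd (c := c); have K := longestK rd dc.
have inv := longest_inv rd dc; exists i; split=> //.
- have := weyl_conj rd (a j) W0; rewrite jE reflN => E.
  by rewrite -[LHS]mulmx1 -K mulmxA -(mulmxA w0) E !mulmxA K mul1mx.
- have := weyl_coroot rd (a j) W0; rewrite jE corootN inv => E.
  by rewrite E.
- by move=> e eW; rewrite -(weightN rd eW (simple_root rd i)) -jE eW // (simple_root rd).
Qed.

Lemma FL_negw w f : W w -> FL f -> FL (wact (- w) f).
Proof.
by move=> Ww; apply: fsupp_wact => y Ly; rewrite mulNmx; apply/LamN/Lam_weyl.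
Qed.

Lemma pi_negw0 j : ev (a j) c = 0 -> exists i, [/\ ev (a i) c = 0,
  w0 *m s_ j = s_ i *m w0,
  forall e : 'rV[R]_n -> F, weyl_inv_weight (Phi := Phi) e -> e (a i) = e (a j) &
  forall f, FL f -> wact (- w0) (pi (T j) f) = pi (T i) (wact (- w0) f)].
Proof.
move=> jc; have [i [ic sE cE eE]] := longest_conj jc; exists i; split=> // f Lf.
apply: pi_conj => //; last exact: FL_negw (longest_weyl rd) Lf.
- by rewrite mulNmx mulmxN sE.
- by rewrite mulNmx cE opprK.
- exact: eE.
Qed.

Lemma conj_stab v : Wc v -> Wc (w0 *m (v *m w0)).
Proof.
by have S0 := longest_stab rd (c := c); move=> Wv; do 2!apply: stabM => //.
Qed.

Lemma len_conj v : Wc v -> len (w0 *m (v *m w0)) = len v.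
Proof.
move=> Wv; have := len_longest rd dc Wv.
have := len_longestl rd dc (stabM Wv (longest_stab rd (c := c))); lia.
Qed.

(** Simultaneous induction along a reduced word of [v] and its image under the diagram automorphism
    of the stabilizer. *)
Lemma conj_ind (P : 'M[R]_n -> 'M[R]_n -> Prop) :
  P 1%:M 1%:M ->
  (forall i j v v', Wc v -> Wc v' -> len (s_ j *m v) = (len v).+1 ->
     len (s_ i *m v') = (len v').+1 ->
     (forall e : 'rV[R]_n -> F, weyl_inv_weight (Phi := Phi) e -> e (a i) = e (a j)) ->
     (forall f, FL f -> wact (- w0) (pi (T j) f) = pi (T i) (wact (- w0) f)) ->
     P v v' -> P (s_ j *m v) (s_ i *m v')) ->
  forall v, Wc v -> P v (w0 *m (v *m w0)).
Proof.
move=> P1 PS; apply: (stab_ind rd dc) => [|j v Wv jc E IH].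
  by rewrite mul1mx (longestK rd dc).
have [i [ic sE eE piE]] := pi_negw0 jc.
have -> : w0 *m (s_ j *m v *m w0) = s_ i *m (w0 *m (v *m w0)) by rewrite !mulmxA sE.
apply: PS => //; first exact: conj_stab.
rewrite (len_conj Wv) -E -(len_conj (stabM (stab_s rd jc) Wv)).
by rewrite !mulmxA sE.
Qed.

Lemma pi_negw0_Tw v f : Wc v -> FL f ->
  wact (- w0) (pi (Tw v) f) = pi (Tw (w0 *m (v *m w0))) (wact (- w0) f).
Proof.
move=> Wv Lf; have LN := FL_negw (longest_weyl rd (c := c)) Lf.
move: v Wv; apply: (@conj_ind (fun v v' =>
  wact (- w0) (pi (Tw v) f) = pi (Tw v') (wact (- w0) f)))
    => [|i j v v' [Wv _] [Wv' _] E E' _ piE IH].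
  by rewrite (Tw1 rd braid) !pi1.
by rewrite !(Tw_up rd braid) // !piM // piE ?IH //; apply: pi_stable.
Qed.

Section Weight.
Variable e : 'rV[R]_n -> F.
Hypothesis eW : weyl_inv_weight (Phi := Phi) e.
Hypothesis eq : forall j, e (a j) * e (a j) = q j * e (a j) + 1.
Local Notation tl := (tlen a e).
Local Notation S := (symmetrizer a T e Wc).

Lemma tl_up j w : W w -> len (s_ j *m w) = (len w).+1 -> tl (s_ j *m w) = e (a j) * tl w.
Proof.
move=> Ww E; rewrite (tlen_mul rd eW) ?(tlen_s rd eW) ?(len_s rd) //.
exact: (weyl_s rd).
Qed.

Lemma tl_conj v : Wc v -> tl (w0 *m (v *m w0)) = tl v.
Proof.
move: v; apply: (@conj_ind (fun v v' => tl v' = tl v)) => // i j v v' [Wv _] [Wv' _] E E' eE _ IH.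
by rewrite !tl_up // IH eE.
Qed.

Lemma pi_symE f : FL f -> pi S f = \sum_(v \in Wc) tl v *: pi (Tw v) f.
Proof.
move=> Lf; rewrite /symmetrizer pi_fsum //; last exact: (finite_stab rd).
by apply: eq_fsum => v _; rewrite piZl.
Qed.

Lemma negw0_sym f : FL f -> wact (- w0) (pi S f) = pi S (wact (- w0) f).
Proof.
move=> Lf; have fin := finite_stab rd (c := c).
have LN := FL_negw (longest_weyl rd (c := c)) Lf.
rewrite !pi_symE // (fsum_morph (f := wact (- w0))) ?linear0 //; last exact: linearD.
have K := longestK rd dc.
have KK v : w0 *m (w0 *m (v *m w0) *m w0) = v.
  by rewrite -!mulmxA K mulmx1 mulmxA K mul1mx.
rewrite [RHS](reindex_fsbig (fun v => w0 *m (v *m w0)) Wc Wc).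
  by apply: eq_fsum => v Wv; rewrite linearZ /= pi_negw0_Tw // tl_conj.
split=> [v /conj_stab//|v v' _ _ /(congr1 (fun v => w0 *m (v *m w0)))|v Wv].
  by rewrite !KK.
by exists (w0 *m (v *m w0)); [exact: conj_stab | rewrite KK].
Qed.

Section Anti.
Hypothesis e_anti : forall j, e (a j) * t (a j) = -1.

(** The symmetrizer has 1 + e_j T_j as a right factor. On the [s_j]-invariant element f + s_j f the
    divided difference vanishes and T_j acts by t_j, so this factor acts by 1 + e_j t_j = 0. *)
Lemma sym_anti_s j f : ev (a j) c = 0 -> FL f -> pi S (wact (s_ j) f) = - pi S f.
Proof.
move=> jc Lf; have Ls := FL_wact (weyl_s rd j) Lf; have Lg := fsuppD Lf Ls.
have [h ->] := sym_factor rd braid eW jc.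
apply/eqP; rewrite -addr_eq0 addrC -piDr // piM // piDl // pi1 // piZl // piT //.
have gs : wact (s_ j) (f + wact (s_ j) f) = f + wact (s_ j) f.
  by rewrite linearD /= wact_sK addrC.
by rewrite nab_sym // scaler0 addr0 gs scalerA e_anti scaleN1r subrr pi0r.
Qed.

Lemma sym_anti v f : Wc v -> FL f -> pi S (wact v f) = (-1) ^+ len v *: pi S f.
Proof.
move=> Wv Lf; move: v Wv; apply: (stab_ind rd dc) => [|j v [Wv _] jc E IH].
  by rewrite wact1 (len1 rd) expr0 scale1r.
have Lvf := FL_wact Wv Lf.
by rewrite wactM sym_anti_s // IH E exprS mulN1r scaleNr.
Qed.

(** Write iota as [w0] after [- w0]: the symmetrizer absorbs [w0] into a sign and commutes with
    [- w0]. *)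
Lemma sym_anti_neg h : FL h ->
  wact w0 (pi S (wact (- 1%:M) h)) = (-1) ^+ len w0 *: wact (- 1%:M) (pi S h).
Proof.
move=> Lh; have W0 := longest_weyl rd (c := c); have K := longestK rd dc.
have Lnh := FL_neg Lh; have Lwh := FL_negw W0 Lh.
have E : wact (- 1%:M) h = wact w0 (wact (- w0) h).
  by rewrite -wactM mulmxN K.
rewrite E (sym_anti (longest_stab rd)) // -negw0_sym // linearZ /= -!wactM mulmxN K.
by [].
Qed.

End Anti.
End Weight.

(** Let N be the divided difference of the symmetrized element g. From T_j g = t_j g follows t (x^al
    - 1) N + (t - t^-1) N = 0, that is t^2 x^al N = N, so N = 0. *)
Lemma sym_fixed j f : ev (a j) c = 0 -> FL f ->
  wact (s_ j) (pi (symmetrizer a T t Wc) f) = pi (symmetrizer a T t Wc) f.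
Proof.
move=> jc Lf; set g := pi _ f; have Lg : FL g by apply: pi_stable.
have tne : t (a j) != 0 := t0 (simple_root rd j).
have tq i : t (a i) * t (a i) = q i * t (a i) + 1.
  by rewrite mulrBl mulVf ?subrK // (t0 (simple_root rd i)).
have : pi (T j) g = t (a j) *: g.
  by rewrite /g -piM // (T_sym rd braid quad t0 tW tq jc) piZl.
rewrite piT // => E.
have {}E : t (a j) *: tB (coroot (a j)) (nab j g) + q j *: nab j g = 0.
  by rewrite nab_tB // scalerBr addrAC E subrr.
have N0 : nab j g = 0.
  apply: (@scaled_tr_eq0 _ _ _ _ (t (a j) ^+ 2) _ _ (coroot_nz j)); first by rewrite expf_neq0.
  move: E => /(congr1 (fun x => t (a j) *: x)); rewrite scaler0 /tB scalerDr !scalerA.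
  rewrite scalerBr -expr2 mulrBr mulfV // -expr2 scalerBl scale1r.
  by rewrite addrA subrK => /subr0_eq.
by have := nab_tB j Lg; rewrite N0 linear0 => /esym/subr0_eq.
Qed.

Lemma sym_fixed_w v f : Wc v -> FL f ->
  wact v (pi (symmetrizer a T t Wc) f) = pi (symmetrizer a T t Wc) f.
Proof.
move=> Wv Lf; move: v Wv; apply: (stab_ind rd dc) => [|j v Wv jc E IH].
  by rewrite wact1.
by rewrite wactM IH sym_fixed.
Qed.

End FixedPoint.

(** * The quasi-polynomial representation on the orbit of c *)

Variable rq : H -> A -> A.
Hypothesis rq_lin : forall h k f g, rq h (k *: f + g) = k *: rq h f + rq h g.
Hypothesis rq_linH : forall k h h' f, rq (k *: h + h') f = k *: rq h f + rq h' f.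
Hypothesis rq1 : forall f, rq 1 f = f.
Hypothesis rqM : forall h h' f, rq (h * h') f = rq h (rq h' f).
Hypothesis rq_cross : forall j f m, FL f ->
  rq (T j) (gprod f m) = gprod (wact (s_ j) f) (rq (T j) m) + q j *: gprod (nab j f) m.
Hypothesis rq_T : forall j y,
  tB (coroot (a j)) (rq (T j) (xx y) - chi a t j (ev (a j) y) *: xx (s_ j *m y)) =
  q j *: (xx (y - coroot (a j) *~ Num.floor (ev (a j) y)) - xx y).

Context {c : V}.
Hypothesis dc : dominant a c.
Hypothesis c_lt1 : forall be, be \in Phi -> ev be c < 1.
Hypothesis c_free : forall lam w, Lam lam -> W w -> lam + w *m c = c -> lam = 0.
Local Notation Wc := (stab Phi c).
Local Notation mincoset := (mincoset a Phi c).
Local Notation orbit := [set z | exists2 w, W w & z = w *m c].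

Lemma rq0r h : rq h 0 = 0.
Proof. by have := rq_lin h (-1) 0 0; rewrite !scaleN1r !addNr. Qed.

Lemma rqDr h f g : rq h (f + g) = rq h f + rq h g.
Proof. by have := rq_lin h 1 f g; rewrite !scale1r. Qed.

Lemma rqZr h k f : rq h (k *: f) = k *: rq h f.
Proof. by have := rq_lin h k f 0; rewrite rq0r !addr0. Qed.

Lemma rqDl h h' f : rq (h + h') f = rq h f + rq h' f.
Proof. by have := rq_linH 1 h h' f; rewrite !scale1r. Qed.

Lemma rq0l f : rq 0 f = 0.
Proof. by have := rq_linH (-1) 0 0 f; rewrite !scaleN1r !addNr. Qed.

Lemma rqZl h k f : rq (k *: h) f = k *: rq h f.
Proof. by have := rq_linH k h 0 f; rewrite rq0l !addr0. Qed.

Lemma rq_fsum (B : set 'M[R]_n) (h : 'M[R]_n -> H) f : finite_set B ->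
  rq (\sum_(w \in B) h w) f = \sum_(w \in B) rq (h w) f.
Proof.
move=> fB; apply: (fsum_morph (f := rq^~ f)) => //; first exact: rq0l.
by move=> x y; apply: rqDl.
Qed.

Lemma orbit_s j z : orbit z -> orbit (s_ j *m z).
Proof.
move=> [w Ww ->]; exists (s_ j *m w); last by rewrite mulmxA.
by apply: weylM => //; apply: (weyl_s rd).
Qed.

Lemma orbit_c : orbit c.
Proof. by exists 1%:M; [exact: weyl1 | rewrite mul1mx]. Qed.

Lemma orbit_bound j z : orbit z -> -1 < ev (a j) z < 1.
Proof.
move=> [w Ww ->]; rewrite -evM; have b_ := root_weyl rd Ww (simple_root rd j).
by rewrite c_lt1 // andbT ltrNl -evNl c_lt1 // (phiN rd).
Qed.

Definition chi0 j z : F := if ev (a j) z == 0 then t (a j) else 1.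
Definition neg_q j z : F := if ev (a j) z < 0 then q j else 0.

(** On the orbit of [c] the value of [a j] lies strictly between -1 and 1. It is therefore an
    integer only if it is 0, and its floor is 0 or -1, for which the quotient in the definition of
    T_j is 0 or x^z. *)
Lemma rq_Tx j z : orbit z ->
  rq (T j) (xx z) = chi0 j z *: xx (s_ j *m z) + neg_q j z *: xx z.
Proof.
move=> /(orbit_bound j) /andP[b1 b2].
have -> : chi0 j z = chi a t j (ev (a j) z).
  rewrite /chi0 /chi; case: eqP => [->|b0]; first by rewrite rpred0.
  case: ifP => // /intrP[m mE]; case: b0; move: b1 b2; rewrite mE.
  rewrite -[1]/(1%:~R) -mulrNz !ltr_int => m1 m2.
  by have -> : m = 0 by lia.
apply/eqP; rewrite [X in _ == X]addrC -subr_eq; apply/eqP.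
apply: (tB_inj (coroot_nz j)); rewrite rq_T linearZ /= /tB tr_x /neg_q.
have [bneg|bpos] := ltP (ev (a j) z) 0.
  have -> : Num.floor (ev (a j) z) = -1.
    by apply: floor_def; rewrite addNr mulrN1z bneg ltW.
  by rewrite mulrN1z opprK.
have -> : Num.floor (ev (a j) z) = 0 by apply: floor_def; rewrite add0r bpos b2.
by rewrite mulr0z subr0 subrr scaler0 scale0r.
Qed.

Lemma rq_basis j f z : FL f -> orbit z ->
  rq (T j) (gprod f (xx z)) =
    gprod (chi0 j z *: wact (s_ j) f) (xx (s_ j *m z)) +
    gprod (q j *: nab j f + neg_q j z *: wact (s_ j) f) (xx z).
Proof.
move=> Lf oz; rewrite rq_cross // rq_Tx // gprodPr linearZ /= gprodDl !gprodZl -addrA.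
by congr (_ + _); rewrite addrC.
Qed.

(** The F[Lam]-coefficient of x^z, found by keeping the exponents in z + Lam. For orbit points it is
    the coefficient in the basis x^(wc), since [orbit_inj] puts distinct orbit points into distinct
    cosets of Lam. *)
Definition cf z : A -> A := fext (fun y => if `[< Lam (y - z) >] then xx (y - z) else 0).

HB.instance Definition _ z := GRing.Linear.copy (cf z)
  (fext (fun y => if `[< Lam (y - z) >] then xx (y - z) else 0)).

Lemma cfP z k f g : cf z (k *: f + g) = k *: cf z f + cf z g.
Proof. exact: linearP. Qed.

Lemma orbit_inj z z' : orbit z -> orbit z' -> Lam (z - z') -> z = z'.
Proof.
move=> [w Ww ->] [w' Ww' ->] Ld; have Wi := weyl_inv rd Ww'.
apply/eqP; rewrite -subr_eq0; apply/eqP.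
rewrite -[_ - _](weylKV rd _ Ww').
have -> : invmx w' *m (w *m c - w' *m c) = - (invmx w' *m (w' *m c - w *m c)).
  by rewrite !mulmxBr opprB.
rewrite (_ : invmx w' *m (w' *m c - w *m c) = 0) ?oppr0 ?mulmx0 //.
apply: (@c_free _ (invmx w' *m w)); last by rewrite mulmxBr (weylK rd) // mulmxA subrK.
  by apply: Lam_weyl => //; rewrite -opprB; apply: LamN.
exact: weylM.
Qed.

Lemma cf_FL z m : FL (cf z m).
Proof.
elim/free_ind: m => [|k y m IH]; first by rewrite linear0; apply: fsupp0.
rewrite cfP; apply: fsuppZD => //; rewrite /cf fext_x.
by case: asboolP => [Ly|_]; [exact: fsupp_x | exact: fsupp0].
Qed.

Lemma cf_basis z z' f : orbit z -> orbit z' -> FL f ->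
  cf z (gprod f (xx z')) = if z == z' then f else 0.
Proof.
move=> oz oz'; move: f; apply: fsupp_ind => [|k lam f Ll Lf IH].
  by rewrite gprod0l linear0 if_same.
rewrite gprodPl cfP IH gprod_xx {1}/cf fext_x.
case: eqP => [->|zz'].
  by rewrite addrK asboolT.
rewrite asboolF ?scaler0 ?addr0 // => Lzz'; apply: zz'.
apply/esym/orbit_inj => //; have := LamD Lzz' (LamN Ll).
by rewrite [lam + z']addrC addrAC addrK.
Qed.

Local Notation O := [set y | exists lam w, [/\ Lam lam, W w & y = lam + w *m c]].
Local Notation FO := (@fsupp R n F A O).

Lemma FO_basis f z : orbit z -> FL f -> FO (gprod f (xx z)).
Proof.
move=> [w Ww ->]; move: f; apply: fsupp_ind => [|k lam f Ll Lf IH].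
  by rewrite gprod0l; apply: fsupp0.
rewrite gprodPl gprod_xx; apply: fsuppZD => //.
by apply: fsupp_x; exists lam, w.
Qed.

Lemma FO_ind (P : A -> Prop) : P 0 ->
  (forall k lam z m, Lam lam -> orbit z -> FO m -> P m ->
     P (k *: gprod (xx lam) (xx z) + m)) ->
  forall m, FO m -> P m.
Proof.
move=> P0 PS; apply: fsupp_ind => // k y m [lam [w [Ll Ww ->]]] Om IH.
by rewrite -gprod_xx; apply: PS => //; exists w.
Qed.

Lemma FL_x lam : Lam lam -> FL (xx lam). Proof. exact: fsupp_x. Qed.

Lemma FO_T j m : FO m -> FO (rq (T j) m).
Proof.
move: m; apply: FO_ind => [|k lam z m Ll oz Om IH].
  by rewrite rq0r; apply: fsupp0.
have Lx := FL_x Ll; have Ls := FL_wact (weyl_s rd j) Lx; have Ln := @nab_FL j _ Lx.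
rewrite rq_lin; apply: fsuppZD => //; rewrite rq_basis //; apply: fsuppD.
  by apply: FO_basis; [exact: orbit_s | exact: fsuppZ].
by apply: FO_basis => //; apply: fsuppZD => //; apply: fsuppZ.
Qed.

Lemma FO_Tw w m : FO m -> FO (rq (Tw w) m).
Proof.
rewrite /Defs.Tw; elim: (redword a w) => [|j s IH] Om; first by rewrite big_nil rq1.
by rewrite big_cons rqM; apply/FO_T/IH.
Qed.

Lemma FO_sym (e : 'rV[R]_n -> F) m : FO m -> FO (rq (symmetrizer a T e W) m).
Proof.
move=> Om; have fW := finite_weyl rd; rewrite rq_fsum // fsbig_finite //.
by apply: fsupp_sum => w _; rewrite rqZl; apply: fsuppZ; apply: FO_Tw.
Qed.

Lemma cf_T j z m : orbit z -> FO m -> cf z (rq (T j) m) =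
  chi0 j z *: wact (s_ j) (cf (s_ j *m z) m) + q j *: nab j (cf z m)
   + neg_q j z *: wact (s_ j) (cf z m).
Proof.
move=> oz; have osz := orbit_s j oz.
move: m; apply: FO_ind => [|k lam z' m Ll oz' Om IH].
  by rewrite rq0r !linear0 nab0 !scaler0 !addr0.
have Lx := FL_x Ll; have Ls := FL_wact (weyl_s rd j) Lx; have Ln := @nab_FL j _ Lx.
have osz' := orbit_s j oz'.
rewrite rq_lin !cfP IH !wactP nab_lin; try exact: cf_FL.
set B := gprod (xx lam) (xx z').
suff -> : cf z (rq (T j) B) = chi0 j z *: wact (s_ j) (cf (s_ j *m z) B) +
    q j *: nab j (cf z B) + neg_q j z *: wact (s_ j) (cf z B).
  rewrite !scalerDr !scalerA !(mulrC k) addrACA; congr (_ + _).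
  by rewrite addrACA.
rewrite rq_basis // linearD /= !cf_basis //; try exact: fsuppZ; last first.
  by apply: fsuppZD => //; apply: fsuppZ.
have -> : (z == s_ j *m z') = (s_ j *m z == z').
  by apply/eqP/eqP => [->|<-]; rewrite (sKx rd).
rewrite -addrA; congr (_ + _).
  have [<-|_] := eqVneq (s_ j *m z) z'; last by rewrite linear0 scaler0.
  by rewrite /chi0 (ev_simple_s rd) oppr_eq0.
have [->//|_] := eqVneq z z'.
by rewrite linear0 nab0 !scaler0 addr0.
Qed.

Lemma FO_decomp m : FO m -> m = \sum_(w \in mincoset) gprod (cf (w *m c) m) (xx (w *m c)).
Proof.
have fm := finite_mincoset rd (c := c).
have orb w : mincoset w -> orbit (w *m c) by move=> /mincoset_weyl Ww; exists w.
move: m; apply: FO_ind => [|k lam z m Ll [w Ww ->] Om IH].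
  by rewrite fsbig1 // => w _; rewrite linear0 gprod0l.
have [u mu uc] := mincoset_exists (a := a) (c := c) Ww.
rewrite {1}IH; under [RHS]eq_fsbigr do rewrite cfP gprodPl.
rewrite fsbig_split //=; congr (_ + _).
rewrite -fsum_scaler // -uc (fsbigD1 u) //= fsbig1 ?addr0 => [|v [mv vu]].
  by rewrite cf_basis ?eqxx //; [exact: orb | exact: orb | exact: FL_x].
rewrite cf_basis; [|exact: orb|exact: orb|exact: FL_x].
by case: eqP => [E|_]; [case: vu; apply: (mincoset_uniq rd dc) | rewrite gprod0l].
Qed.

(** Each letter of a reduced word of a minimal representative is applied on the strictly positive
    side of its wall, where T_j simply sends x^z to x^(s_j z). *)
Lemma rq_Tw_c w : mincoset w -> rq (Tw w) (xx c) = xx (w *m c).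
Proof.
move: w; apply: (mincoset_ind rd dc) => [|j w mw _ E jc IH].
  by rewrite (Tw1 rd braid) rq1 mul1mx.
have Ww := mincoset_weyl mw.
rewrite (Tw_up rd braid) // rqM IH rq_Tx; last by exists w.
by rewrite /chi0 /neg_q gt_eqF // ltNge ltW // scale1r scale0r addr0 mulmxA.
Qed.

(** Where [a j] vanishes at [c], [chi0] is t_j and x^c is fixed, so the action on F[Lam] x^c is the
    polynomial one. *)
Lemma rq_Tw_stab v f : Wc v -> FL f ->
  rq (Tw v) (gprod f (xx c)) = gprod (pi (Tw v) f) (xx c).
Proof.
move=> Wv Lf; move: v Wv; apply: (stab_ind rd dc) => [|j v [Wv _] jc E IH].
  by rewrite (Tw1 rd braid) rq1 pi1.
rewrite (Tw_up rd braid) // rqM IH piM // rq_basis //; [|exact: pi_stable|exact: orbit_c].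
rewrite /chi0 /neg_q jc eqxx ltxx scale0r addr0 s_fix // -gprodDl.
by rewrite piT //; apply: pi_stable.
Qed.

Lemma gprod_fsum (B : set 'M[R]_n) (G : 'M[R]_n -> A) m : finite_set B ->
  gprod (\sum_(w \in B) G w) m = \sum_(w \in B) gprod (G w) m.
Proof.
move=> fB; apply: (fsum_morph (f := gprod^~ m)) => //; first exact: gprod0l.
by move=> x y; apply: gprodDl.
Qed.

Lemma rq_sym_stab (e : 'rV[R]_n -> F) f : FL f ->
  rq (symmetrizer a T e Wc) (gprod f (xx c)) = gprod (pi (symmetrizer a T e Wc) f) (xx c).
Proof.
move=> Lf; have fc := finite_stab rd (c := c).
rewrite rq_fsum // pi_fsum // gprod_fsum //; apply: eq_fsum => v Wv.
by rewrite rqZl rq_Tw_stab // piZl // gprodZl.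
Qed.

Lemma nw_word_dom s : (nw Phi v0 (word a s *m c) <= size s)%N.
Proof.
elim: s => [|j s IH]; first by rewrite word_nil mul1mx (nw_dom rd dc).
by rewrite word_cons -mulmxA (leq_trans (nw_le rd _ _)).
Qed.

(** A point separated from the dominant chamber by at least [size s] walls is reached only if every
    letter crosses a wall. At each stage only the term of T_j that moves the point contributes, with
    [chi0] equal to 1; the terms that stay put fall short of [z]. *)
Lemma cf_word s g z : FL g -> orbit z -> (size s <= nw Phi v0 z)%N ->
  cf z (rq (\prod_(j <- s) T j) (gprod g (xx c))) =
  if z == word a s *m c then wact (word a s) g else 0.
Proof.
move=> Lg; elim: s z => [|j s IH] z oz sz.
  by rewrite big_nil rq1 cf_basis ?word_nil ?mul1mx ?wact1 //; apply: orbit_c.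
rewrite big_cons rqM word_cons -mulmxA wactM.
set x := word a s *m c; have nx : (nw Phi v0 x <= size s)%N := nw_word_dom s.
set m' := rq _ _ in IH *; have osz := orbit_s j oz.
have Om' : FO m'.
  rewrite /m'; elim: (s) => [|k s' IHs]; first by rewrite big_nil rq1; apply: FO_basis orbit_c Lg.
  by rewrite big_cons rqM; apply: FO_T.
have zx : (z == x) = false by apply/eqP => E; move: sz nx; rewrite E /=; lia.
have ssz : (size s <= nw Phi v0 (s_ j *m z))%N.
  by have := nw_le rd j (s_ j *m z); rewrite (sKx rd); move: sz => /=; lia.
rewrite cf_T // (IH z oz) ?(ltnW sz) // -/x zx linear0 nab0 !scaler0 !addr0.
rewrite (IH _ osz ssz) -/x.
have -> : (s_ j *m z == x) = (z == s_ j *m x).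
  by apply/eqP/eqP => [<-|->]; rewrite (sKx rd).
case: eqP => [E|_]; last by rewrite linear0 scaler0.
have neg : ev (a j) z < 0.
  rewrite ltNge le_eqVlt; apply/negP => /orP[/eqP/esym jz|jz].
    by move: zx; rewrite -(s_fix jz) E (sKx rd) eqxx.
  have := nw_up rd jz; rewrite {1}E (sKx rd) => nE.
  by move: nx sz; rewrite nE /=; lia.
by rewrite /chi0 lt_eqF // scale1r.
Qed.

(** * Coefficients of the symmetrized elements *)

Local Notation w0 := (longest a W).
Local Notation w0c := (longest a Wc).

Lemma W_w0 : W w0.
Proof. by have := longest_weyl rd (c := 0); rewrite stab0. Qed.

Lemma w0K : w0 *m w0 = 1%:M.
Proof. by have := longestK rd (@dominant0 R n r a); rewrite stab0. Qed.

Lemma len_w0 v : W v -> (len (w0 *m v) + len v)%N = len w0.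
Proof. by have := len_longestl rd (@dominant0 R n r a) (v := v); rewrite stab0. Qed.

Lemma w0_star j : exists i, [/\ w0 *m s_ j = s_ i *m w0,
  forall f, FL f -> wact (- w0) (pi (T j) f) = pi (T i) (wact (- w0) f) ,
  w0 *m coroot (a j) = - coroot (a i) & t (a i) = t (a j)].
Proof.
have [i []] := longest_conj (@dominant0 R n r a) (ev0r (a j)); rewrite stab0 => _ sE cE eE.
exists i; split=> //; last exact: eE.
move=> f Lf; apply: pi_conj => //; last exact: FL_negw W_w0 Lf.
- by rewrite mulNmx mulmxN sE.
- by rewrite mulNmx cE opprK.
- exact: eE.
Qed.

Lemma W_w0c : W w0c. Proof. exact: (longest_weyl rd). Qed.

Lemma mincoset_w0 : mincoset (w0 *m w0c).
Proof.
split; first exact: weylM W_w0 W_w0c.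
move=> u Wu; have Wwu := stabM (longest_stab rd (c := c)) Wu.
have := len_w0 W_w0c; have := len_w0 (proj1 Wwu); rewrite mulmxA.
have := (proj2 (longestP rd (c := c))) _ Wwu; lia.
Qed.

Lemma w0_c : w0 *m w0c *m c = w0 *m c.
Proof. by rewrite -mulmxA (longest_fix rd). Qed.

Lemma dominant_uniq x y w : dominant a x -> dominant a y -> W w -> y = w *m x -> x = y.
Proof.
move=> dx dy Ww yE; have [u mu uc] := mincoset_exists (a := a) (c := x) Ww.
have := mincoset_nw rd dx mu; rewrite uc -yE (nw_dom rd dy).
by move=> /esym/(len_eq0 rd (mincoset_weyl mu)) u1; rewrite yE -uc u1 mul1mx.
Qed.

(** Climb while some [a j] is positive at [w *m c]. When none is, both [- (w *m c)] and
    [- (w0 *m c)] are dominant and in one orbit, hence equal. *)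
Lemma mincoset_dind (P : 'M[R]_n -> Prop) :
  P (w0 *m w0c) ->
  (forall j w, mincoset w -> len (s_ j *m w) = (len w).+1 ->
    0 < ev (a j) (w *m c) -> P (s_ j *m w) -> P w) ->
  forall w, mincoset w -> P w.
Proof.
move=> P1 PS w mw; have [N] := ubnP (len w0 - len w)%N.
elim: N w mw => // N IH w mw wN.
have [[j jw]|nj] := EM (exists j, 0 < ev (a j) (w *m c)).
  have [msw lE] := mincoset_up rd dc mw jw.
  apply: (PS _ _ mw lE jw); apply: IH => //; rewrite lE.
  have := len_w0 (mincoset_weyl msw); rewrite lE; lia.
rewrite -[w](_ : w0 *m w0c = w) //; apply: (mincoset_uniq rd dc mincoset_w0 mw).
rewrite w0_c; apply: oppr_inj; have Wi := weylM (mincoset_weyl mw) W_w0.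
apply: (@dominant_uniq _ _ (w *m w0)) => //.
- move=> j; have [i [_ _ cE _]] := w0_star j.
  rewrite evNr oppr_ge0 -evM; have [i' _ jE] := longest_star rd (@dominant0 R n r a) (ev0r (a j)).
  by rewrite stab0 in jE; rewrite jE evNl oppr_le0; apply: dc.
- by move=> j; rewrite evNr oppr_ge0 leNgt; apply/negP => jw; apply: nj; exists j.
- by rewrite mulmxN mulmxA -(mulmxA w) w0K mulmx1.
Qed.

Section Weight.
Variable e : 'rV[R]_n -> F.
Hypothesis eW : weyl_inv_weight (Phi := Phi) e.
Hypothesis eq : forall j, e (a j) * e (a j) = q j * e (a j) + 1.
Local Notation tl := (tlen a e).
Local Notation EW := (symmetrizer a T e W).
Local Notation Sc := (symmetrizer a T e Wc).

Lemma T_symW j : T j * EW = e (a j) *: EW.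
Proof.
by have := T_sym rd braid quad t0 eW eq (ev0r (a j)); rewrite stab0.
Qed.

Lemma symW_T j : EW * T j = e (a j) *: EW.
Proof.
by have := sym_T rd braid quad t0 eW eq (ev0r (a j)); rewrite stab0.
Qed.

(** Apply the cross relation to [s_j f] rather than [f]: T_j comes out on the left, where the
    symmetrizer absorbs it into e_j. *)
Lemma symW_swap j f m : FL f -> rq EW (gprod f (rq (T j) m)) =
  rq EW (gprod (e (a j) *: wact (s_ j) f + q j *: nab j f) m).
Proof.
move=> Lf; have Ls := FL_wact (weyl_s rd j) Lf.
have -> : gprod f (rq (T j) m) = rq (T j) (gprod (wact (s_ j) f) m) + q j *: gprod (nab j f) m.
  rewrite rq_cross // wact_sK nab_s // -[- nab j f]scaleN1r gprodZl scaleN1r scalerN.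
  by rewrite subrK.
by rewrite rqDr -rqM symW_T rqZl gprodDl rqDr !gprodZl !rqZr.
Qed.

(** Expand the symmetrizer over minimal representatives u. No u is longer than [w0 *m w0c], whose
    length is the number of walls at [w0 *m c], so [cf_word] leaves only this one. *)
Lemma cf_symW_top f : FL f -> cf (w0 *m c) (rq EW (gprod f (xx c))) =
  tl (w0 *m w0c) *: wact (w0 *m w0c) (pi Sc f).
Proof.
move=> Lf; have fm := finite_mincoset rd (c := c).
have Lg : FL (pi Sc f) by apply: pi_stable.
have ow : orbit (w0 *m c) by exists w0 => //; apply: W_w0.
have nE : nw Phi v0 (w0 *m c) = len (w0 *m w0c).
  by rewrite -(mincoset_nw rd dc mincoset_w0) w0_c.
rewrite (sym_coset rd dc braid eW) rq_fsum // (fsum_morph (f := cf (w0 *m c))) ?linear0 //;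
  last exact: linearD.
have E u : mincoset u -> cf (w0 *m c) (rq (tl u *: (Tw u * Sc)) (gprod f (xx c))) =
    if u == w0 *m w0c then tl u *: wact u (pi Sc f) else 0.
  move=> mu; have Wu := mincoset_weyl mu.
  rewrite rqZl rqM rq_sym_stab // linearZ /= cf_word //; last first.
    have := len_w0 W_w0c; have := len_w0 (weylM Wu W_w0c).
    have := mincoset_mul rd dc mu (longest_stab rd (c := c)).
    by rewrite nE /Defs.len; lia.
  rewrite (word_redword rd Wu) -w0_c.
  case: eqP => [E|nE']; last by rewrite scaler0; case: eqP => // E; case: nE'; rewrite E.
  by rewrite (mincoset_uniq rd dc mincoset_w0 mu E) eqxx.
rewrite (fsbigD1 (w0 *m w0c)) //=; last exact: mincoset_w0.
rewrite E ?eqxx; last exact: mincoset_w0.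
rewrite fsbig1 ?addr0 // => u [mu /eqP nu]; rewrite E //.
by rewrite (negPf nu).
Qed.

Lemma cf_symW_rec j z f m : FL f -> orbit z -> 0 < ev (a j) z ->
  m = rq EW (gprod f (xx c)) ->
  e (a j) *: cf z m = wact (s_ j) (cf (s_ j *m z) m) + q j *: nab j (cf z m).
Proof.
move=> Lf oz jz mE; have Om : FO m by rewrite mE; apply: FO_sym; apply: FO_basis orbit_c Lf.
have := cf_T j oz Om; rewrite {1}mE -rqM T_symW rqZl -mE linearZ /= => ->.
by rewrite /chi0 /neg_q gt_eqF // ltNge ltW // scale1r scale0r addr0.
Qed.

End Weight.

Lemma w0_neg_wact f : wact (- w0) f = wact w0 (wact (- 1%:M) f).
Proof. by rewrite -wactM mulmxN mulmx1. Qed.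

Lemma wact_w0K f : wact w0 (wact w0 f) = f.
Proof. by rewrite -wactM w0K wact1. Qed.

Lemma wact_negw0K f : wact (- w0) (wact (- w0) f) = f.
Proof. by rewrite -wactM mulmxN mulNmx opprK w0K wact1. Qed.

(** Applying [s_j] solves the relation for [y]. Since [w0] sends the coroot of [a j] to minus that
    of [a i], transporting by it reverses the divided difference, which produces exactly the term
    [s_j (nab j x)] of the solution. *)
Lemma rec_plus i j (x y : A) : w0 *m s_ j = s_ i *m w0 -> w0 *m coroot (a j) = - coroot (a i) ->
  t (a i) = t (a j) -> FL x -> FL y ->
  t (a j) *: x = wact (s_ j) y + q j *: nab j x -> pi (T i) (wact w0 x) = wact w0 y.
Proof.
move=> sE cE tE Lx Ly E; have W0 := W_w0.
have Lwx := FL_wact W0 Lx; have Lnx := FL_neg Lx.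
have {}E : y = t (a j) *: wact (s_ j) x - q j *: (nab j x + wact (s_ j) x - x).
  move/eqP: E; rewrite -subr_eq => /eqP/(congr1 (wact (s_ j))).
  by rewrite wact_sK linearB /= !linearZ /= s_nab // => <-.
have N : nab i (wact w0 x) = - wact w0 (nab j x + wact (s_ j) x - x).
  have -> : wact w0 x = wact (- w0) (wact (- 1%:M) x).
    by rewrite w0_neg_wact wact_neg_neg.
  rewrite -(@nab_conj (- w0) i j) //; last exact: FL_negw.
  - by rewrite w0_neg_wact neg_nab // linearN.
  - by rewrite mulNmx mulmxN sE.
  - by rewrite mulNmx cE opprK.
move: (nab j x + wact (s_ j) x - x) E N => p E N.
by rewrite piT // N tE -wactM -sE wactM E scalerN linearB /= !linearZ.
Qed.

Lemma rec_minus (e : 'rV[R]_n -> F) j (x y : A) : e (a j) * t (a j) = -1 -> FL x -> FL y ->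
  e (a j) *: x = wact (s_ j) y + q j *: nab j x -> pi (T j) y = - x.
Proof.
move=> et Lx Ly E; have tne : t (a j) != 0 := t0 (simple_root rd j).
have eE : e (a j) = - (t (a j))^-1 by rewrite -[e _](mulfK tne) et mulN1r.
have Ln := @nab_FL j x Lx.
have sy : wact (s_ j) y = e (a j) *: x - q j *: nab j x by rewrite E addrK.
have ny : nab j y = - (e (a j) *: nab j x - q j *: nab j x).
  rewrite -(wact_sK j y) sy nab_s; last by apply: fsuppB; apply: fsuppZ.
  rewrite nabD ?nabN ?nabZ ?nab_nab //; try by apply: fsuppZ.
  by apply: fsuppN; apply: fsuppZ.
rewrite piT // sy ny scalerBr !scalerA [_ * e _]mulrC et scaleN1r -addrA.
rewrite -[RHS]addr0; congr (_ + _).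
rewrite -scalerBl scalerN scalerA -opprD -scalerDl eE.
have -> : t (a j) * q j + q j * (- (t (a j))^-1 - q j) = 0 by ring.
by rewrite scale0r oppr0.
Qed.

Lemma reduced_ind (P : 'M[R]_n -> Prop) : P 1%:M ->
  (forall j w, W w -> len (s_ j *m w) = (len w).+1 -> P w -> P (s_ j *m w)) ->
  forall w, W w -> P w.
Proof.
move=> P1 PS w; rewrite -stab0; move: w.
apply: (stab_ind rd (@dominant0 R n r a)) => // j w [Ww _] _ E; exact: PS.
Qed.

Lemma t_sq j : t (a j) * t (a j) = q j * t (a j) + 1.
Proof. by rewrite mulrBl mulVf ?subrK // (t0 (simple_root rd j)). Qed.

Lemma symW_swap_plus w f m : W w -> FL f ->
  rq (symmetrizer a T t W) (gprod f (rq (Tw w) m)) =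
  rq (symmetrizer a T t W) (gprod (pi (Tw (invmx w)) f) m).
Proof.
move=> Ww; move: w Ww f; apply: reduced_ind => [|j w Ww E IH] f Lf.
  by rewrite invmx1 (Tw1 rd braid) rq1 pi1.
have Ws := weyl_s rd j; have Wi := weyl_inv rd Ww.
rewrite (Tw_up rd braid) // rqM (symW_swap tW t_sq) // -piT // IH; last exact: pi_stable.
rewrite -piM // (invmxM rd Ws Ww) (inv_s rd) (Tw_upr rd braid) //.
by rewrite -{1}(inv_s rd j) -(invmxM rd Ws Ww) !(len_inv rd) //; apply: weylM.
Qed.

(** For e = -1/t the operator e s_j + (t - t^-1) nab_j of [symW_swap] is minus the iota-conjugate of
    T_j^-1. This is the source of iota, of the inverse and of the sign in the formula for p^-. *)
Lemma symW_swap_minus (e : 'rV[R]_n -> F) w h m :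
  weyl_inv_weight (Phi := Phi) e ->
  (forall j, e (a j) * e (a j) = q j * e (a j) + 1) ->
  (forall j, e (a j) * t (a j) = -1) -> W w -> FL h ->
  rq (symmetrizer a T e W) (gprod (wact (- 1%:M) h) (rq (Tw w) m)) =
  (-1) ^+ len w *:
    rq (symmetrizer a T e W) (gprod (wact (- 1%:M) (pi (hinv (Tw w)) h)) m).
Proof.
move=> eW eq et Ww; move: w Ww h; apply: reduced_ind => [|j w Ww E IH] h Lh.
  by rewrite (hinv_Tw1 rd braid) (Tw1 rd braid) rq1 pi1 // (len1 rd) scale1r.
have Ws := weyl_s rd j; have tne : t (a j) != 0 := t0 (simple_root rd j).
have eE : e (a j) = - (t (a j))^-1 by rewrite -[e _](mulfK tne) et mulN1r.
have LnT : FL (pi (Ti a T t j) h) by apply: pi_stable.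
have Lnh := FL_neg Lh.
rewrite (Tw_up rd braid) // rqM (symW_swap eW eq) //.
have -> : e (a j) *: wact (s_ j) (wact (- 1%:M) h) + q j *: nab j (wact (- 1%:M) h) =
    - wact (- 1%:M) (pi (Ti a T t j) h).
  rewrite -[nab j _]wact_neg_neg neg_nab // pi_Ti // wact_negC.
  move: (wact (s_ j) h) (nab j h) => X N.
  have rearr (x1 x2 x3 x4 : A) : x1 - x2 - (x3 + x1 - x4) = - (x2 + x3 - x4).
    by rewrite !opprD !opprK [- x3 - x1]addrC !addrA [x1 - x2]addrC addrK.
  have -> : t (a j) *: X + q j *: N - q j *: h = - (e (a j) *: X + q j *: - (N + X - h)).
    have -> : e (a j) = q j - t (a j) by rewrite eE; ring.
    move: (q j) => q1; move: (t (a j)) => t1.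
    by rewrite scalerBl scalerN scalerBr scalerDr rearr opprK.
  move: (- (N + X - h)) => Y.
  by rewrite linearN opprK linearD !linearZ.
rewrite -scaleN1r gprodZl rqZr IH // scalerA -exprS -E.
have lE : len (s_ j *m w) = (len (s_ j) + len w)%N by rewrite E (len_s rd).
by rewrite -(Tw_up rd braid Ww E) (hinv_TwM rd braid quad t0 Ws Ww lE)
  (hinv_T rd braid quad t0) piM.
Qed.

Lemma tl_w0_mul (e : 'rV[R]_n -> F) : weyl_inv_weight (Phi := Phi) e ->
  tlen a e (w0 *m w0c) * tlen a e w0c = tlen a e w0.
Proof.
move=> eW; have lw := len_w0 W_w0c; have Ww := weylM W_w0 W_w0c.
have K := longestK rd dc.
by rewrite -(tlen_mul rd eW Ww W_w0c) -mulmxA K mulmx1 // -lw.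
Qed.

(** At the top, [w0c] fixes g, and the inverse of T_{w0c} acts on g by 1 / t(w0c), which accounts
    for t(w0 w0c) in place of t(w0). Going down by [s_j] lengthens [w0 *m w] by [s_i] on the left,
    and [rec_plus] supplies the matching T_i^-1. *)
Lemma cf_plus f w : FL f -> mincoset w ->
  cf (w *m c) (rq (symmetrizer a T t W) (gprod f (xx c))) =
  tlen a t w0 *: wact w0 (pi (hinv (Tw (invmx (w0 *m w)))) (pi (symmetrizer a T t Wc) f)).
Proof.
move=> Lf; set g := pi (symmetrizer a T t Wc) f; set m := rq _ _.
have Lg : FL g by apply: pi_stable.
move: w; apply: mincoset_dind => [|j w mw lE jw IH].
  rewrite w0_c /m (cf_symW_top tW) // -/g wactM (sym_fixed_w dc) //; last exact: (longest_stab rd).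
  rewrite mulmxA w0K mul1mx (longest_inv rd dc).
  have S0 := longest_stab rd (c := c).
  have [h1 h2] := Tw_invertible rd quad t0 W_w0c.
  have -> : pi (hinv (Tw w0c)) g = (tlen a t w0c)^-1 *: g.
    have := Tw_sym rd dc braid quad t0 tW t_sq S0.
    move=> /(congr1 (fun x => pi ((tlen a t w0c)^-1 *: (hinv (Tw w0c) * x)) f)).
    rewrite mulrA h1 mul1r -scalerAr scalerA mulVf ?(tl_neq0 t_sq) // scale1r.
    by rewrite piZl // piM // -/g => ->.
  rewrite linearZ /= scalerA; congr (_ *: _).
  by rewrite -(tl_w0_mul tW) mulfK ?(tl_neq0 t_sq).
have Ww := mincoset_weyl mw; have oz : orbit (w *m c) by exists w.
have [i [sE _ cE tE]] := w0_star j.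
have Wsw := weylM (weyl_s rd j) Ww.
have Lx := @cf_FL (w *m c) m.
have := cf_symW_rec tW t_sq Lf oz jw (erefl m); rewrite (mulmxA (s_ j)) IH => E.
have Lp : FL (pi (hinv (Tw (invmx (w0 *m (s_ j *m w))))) g) by apply: pi_stable.
have Ly := fsuppZ (k := tlen a t w0) (FL_wact W_w0 Lp).
have := rec_plus sE cE tE Lx Ly E; rewrite linearZ /= wact_w0K.
move=> /(congr1 (pi (Ti a T t i))); rewrite pi_TiT; last exact: FL_wact W_w0 Lx.
move=> /(congr1 (wact w0)); rewrite wact_w0K piZr // linearZ /= => ->.
congr (_ *: wact _ _).
have w0E : w0 *m w = s_ i *m (w0 *m (s_ j *m w)).
  by rewrite mulmxA -sE -!mulmxA (mulmxA (s_ j)) (sK rd) mul1mx.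
have W1 := weylM W_w0 Wsw; have Wi := weyl_s rd i.
rewrite w0E (invmxM rd Wi W1) (inv_s rd) (hinv_TwM rd braid quad t0) //.
- by rewrite (hinv_T rd braid quad t0) piM.
- exact: (weyl_inv rd).
- rewrite -{1}(inv_s rd i) -(invmxM rd Wi W1) !(len_inv rd) // -?w0E; last exact: weylM W_w0 Ww.
  by rewrite (len_s rd); have := len_w0 Ww; have := len_w0 Wsw; rewrite lE; lia.
Qed.

Section Minus.
Variable e : 'rV[R]_n -> F.
Hypothesis eW : weyl_inv_weight (Phi := Phi) e.
Hypothesis eq : forall j, e (a j) * e (a j) = q j * e (a j) + 1.
Hypothesis e_anti : forall j, e (a j) * t (a j) = -1.
Local Notation tl := (tlen a e).

(** One factor 1 / tl w0c comes from tl (w0 w0c); the other compensates the scalar tl w0c by which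
    T_{w0c} acts on g at the top. Each descent applies - T_j by [rec_minus], and [- w0] turns T_j
    into T_i. *)
Lemma cf_minus h w : FL h -> mincoset w ->
  cf (w *m c) (rq (symmetrizer a T e W) (gprod (wact (- 1%:M) h) (xx c))) =
  ((-1) ^+ (len w + len w0) * tl w0 / tl w0c ^+ 2) *:
    wact (- 1%:M) (wact w0 (pi (Tw (w0 *m w)) (pi (symmetrizer a T e Wc) h))).
Proof.
move=> Lh; set g := pi (symmetrizer a T e Wc) h; set m := rq _ _.
have Lg : FL g by apply: pi_stable.
have Lnh := FL_neg Lh; have Ww := weylM W_w0 W_w0c.
have sgn (k : nat) : (-1) ^+ k * (-1) ^+ k = 1 :> F.
  by rewrite -exprD addnn -mul2n exprM sqrrN !expr1n.
move: w; apply: mincoset_dind => [|j w mw lE jw IH].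
  rewrite w0_c /m (cf_symW_top eW) // wactM (sym_anti_neg dc eW e_anti) // -/g.
  have S0 := longest_stab rd (c := c).
  have -> : pi (Tw (w0 *m (w0 *m w0c))) g = tl w0c *: g.
    rewrite mulmxA w0K mul1mx /g -piM // (Tw_sym rd dc braid quad t0 eW eq S0).
    by rewrite piZl.
  rewrite !linearZ /= !scalerA -wact_negC; congr (_ *: _).
  have tc0 := tl_neq0 eq w0c; rewrite -(tl_w0_mul eW).
  have lw := len_w0 W_w0c.
  have -> : (-1) ^+ (len (w0 *m w0c) + len w0) = (-1) ^+ len w0c :> F.
    by rewrite -lw addnA exprD exprD sgn mul1r.
  move: tc0; move: (tl w0c) => x; move: (tl (w0 *m w0c)) => y.
  by move: (_ ^+ len w0c) => s x0; field.
have Ww1 := mincoset_weyl mw; have oz : orbit (w *m c) by exists w.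
have [i [sE pE cE tE]] := w0_star j.
have Wsw := weylM (weyl_s rd j) Ww1.
have Lx := @cf_FL (w *m c) m; have Ly := @cf_FL (s_ j *m (w *m c)) m.
have := cf_symW_rec eW eq Lnh oz jw (erefl m) => E.
have := rec_minus (e_anti j) Lx Ly E; rewrite (mulmxA (s_ j)) IH => /(congr1 -%R).
rewrite opprK => <-.
set p := pi (Tw _) g; have Lp : FL p by apply: pi_stable.
have Lwp := FL_neg (FL_wact W_w0 Lp).
rewrite piZr // -scaleNr lE addSn exprS -!mulrA !mulN1r opprK; congr (_ *: _).
have negE f : wact (- 1%:M) (wact w0 f) = wact (- w0) f by rewrite w0_neg_wact wact_negC.
rewrite !negE in Lwp *; have LTp : FL (pi (T i) p) by apply: pi_stable.
rewrite -[LHS]wact_negw0K pE // wact_negw0K /p -piM //; congr (wact _ (pi _ _)).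
have w0E : w0 *m w = s_ i *m (w0 *m (s_ j *m w)).
  by rewrite mulmxA -sE -!mulmxA (mulmxA (s_ j)) (sK rd) mul1mx.
have W1 := weylM W_w0 Wsw.
rewrite w0E (Tw_up rd braid) // -w0E.
by have := len_w0 Ww1; have := len_w0 Wsw; rewrite lE; lia.
Qed.

End Minus.

Section Formula.
Variables (mu : V) (hw : 'M[R]_n).
Hypothesis Lmu : Lam mu.
Hypothesis mhw : mincoset hw.
Let Whw := mincoset_weyl mhw.

Lemma FO_formula (e : 'rV[R]_n -> F) f : FL f ->
  rq (symmetrizer a T e W) (gprod f (xx c)) = \sum_(w \in mincoset)
    gprod (cf (w *m c) (rq (symmetrizer a T e W) (gprod f (xx c)))) (xx (w *m c)).
Proof. by move=> Lf; apply/FO_decomp/FO_sym/FO_basis/Lf/orbit_c. Qed.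

Lemma xx_factor : xx (mu + hw *m c) = gprod (xx mu) (rq (Tw hw) (xx c)).
Proof. by rewrite rq_Tw_c // gprod_xx. Qed.

Definition coef_plus w : A := wact w0 (pi (hinv (Tw (invmx (w0 *m w)))
  * symmetrizer a T t Wc * Tw (invmx hw)) (xx mu)).

Theorem qp_plus_formula : rq (symmetrizer a T t W) (xx (mu + hw *m c)) =
  tlen a t w0 *: \sum_(w \in mincoset) gprod (coef_plus w) (xx (w *m c)).
Proof.
have Lx := FL_x Lmu; have Lp : FL (pi (Tw (invmx hw)) (xx mu)) by apply: pi_stable.
rewrite xx_factor symW_swap_plus // FO_formula // fsum_scaler; last exact: (finite_mincoset rd).
by apply: eq_fsum => w mw; rewrite cf_plus // gprodZl /coef_plus !piM.
Qed.

Definition coef_minus w : A :=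
  wact (- 1%:M) (wact w0 (pi (Tw (w0 *m w)
    * antisymmetrizer a T t Wc * hinv (Tw hw)) (wact (- 1%:M) (xx mu)))).

Definition anti_weight : 'rV[R]_n -> F := fun be => - (t be)^-1.

Lemma antisymmetrizerE B : antisymmetrizer a T t B = symmetrizer a T anti_weight B.
Proof. by apply: eq_fsum => w _; rewrite tlen_neg_inv. Qed.

Lemma anti_weightW : weyl_inv_weight (Phi := Phi) anti_weight.
Proof. by move=> be w be_ Ww; rewrite /anti_weight tW. Qed.

Lemma anti_weight_sq j :
  anti_weight (a j) * anti_weight (a j) = q j * anti_weight (a j) + 1.
Proof. by rewrite /anti_weight; field; apply: (t0 (simple_root rd j)). Qed.

Lemma anti_weight_t j : anti_weight (a j) * t (a j) = -1.
Proof. by rewrite /anti_weight mulNr mulVf // (t0 (simple_root rd j)). Qed.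

Theorem qp_minus_formula : rq (antisymmetrizer a T t W) (xx (mu + hw *m c)) =
  ((-1) ^+ len hw * tlen a t w0c ^+ 2 / tlen a t w0) *:
  \sum_(w \in mincoset) (-1) ^+ len w *: gprod (coef_minus w) (xx (w *m c)).
Proof.
have eW := anti_weightW; have eq := anti_weight_sq; have et := anti_weight_t.
have Lx := FL_x Lmu; have Lnx := FL_neg Lx.
have Lp : FL (pi (hinv (Tw hw)) (wact (- 1%:M) (xx mu))) by apply: pi_stable.
rewrite xx_factor -{1}(wact_neg_neg (xx mu)) antisymmetrizerE symW_swap_minus //.
rewrite FO_formula; last exact: FL_neg.
have fm := finite_mincoset rd (c := c); rewrite !fsum_scaler //.
apply: eq_fsum => w mw; rewrite -!gprodZl (cf_minus eW eq et) // /coef_minus antisymmetrizerE.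
rewrite !piM // !scalerA; congr (gprod (_ *: _) _).
(* For the weight -1/t, tl w0 / tl w0c^2 is (-1)^l(w0) t(w0c)^2 / t(w0), and its sign cancels the
   (-1)^l(w0) of [cf_minus]. *)
rewrite !tlen_neg_inv exprD.
have t1 : tlen a t w0 != 0 := tl_neq0 t_sq w0; have t2 : tlen a t w0c != 0 := tl_neq0 t_sq w0c.
have sgn (k : nat) : (-1) ^+ k * (-1) ^+ k = 1 :> F.
  by rewrite -exprD addnn -mul2n exprM sqrrN !expr1n.
have sgn0 (k : nat) : (-1) ^+ k != 0 :> F by rewrite signr_eq0.
move: (sgn (len w0)) (sgn (len w0c)) (sgn0 (len w0c)).
move: ((-1) ^+ len w0) ((-1) ^+ len w0c) => s1 s2 E1 E2 n2.
move: ((-1) ^+ len hw) ((-1) ^+ len w) => s3 s4.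
transitivity ((s1 * s1) * (s3 * tlen a t w0c ^+ 2 / tlen a t w0 * s4) / (s2 * s2)).
  move: t1 t2 n2; move: (tlen a t w0) => x; move: (tlen a t w0c) => y.
  by move=> x0 y0 n2; field; rewrite x0 y0 n2.
by rewrite E1 E2 mul1r divr1.
Qed.

Lemma cf_sum (g : 'M[R]_n -> A) w : (forall v, mincoset v -> FL (g v)) -> mincoset w ->
  cf (w *m c) (\sum_(v \in mincoset) gprod (g v) (xx (v *m c))) = g w.
Proof.
move=> Lg mw; have fm := finite_mincoset rd (c := c).
have orb v : mincoset v -> orbit (v *m c) by move=> /mincoset_weyl Wv; exists v.
rewrite (fsum_morph (f := cf (w *m c))) ?linear0 //; last exact: linearD.
rewrite (fsbigD1 w) //= cf_basis ?eqxx; try by [exact: orb | exact: Lg].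
rewrite fsbig1 ?addr0 // => v [mv vw]; rewrite cf_basis; try by [exact: orb | exact: Lg].
by case: eqP => // E; case: vw; apply: (mincoset_uniq rd dc).
Qed.

(** An integer [a i] value at [mu] exceeds -1, because [a i] is below 1 at [hw *m c]; so [mu] is
    dominant. If a wall counted by the length of the inverse of [hw] met the point attached to [mu],
    the corresponding positive root [de] would be nonnegative at [hw *m c] by dominance of y, yet
    negative there by minimality of [hw]. *)
Lemma dominant_dataE : dominant a (mu + hw *m c) ->
  dominant_data a Phi Lam (invmx hw *m mu) = (mu, hw).
Proof.
move=> dy; have Wi := weyl_inv rd Whw.
have dmu : dominant a mu.
  move=> i; have /intrP[m mE] := Lam_int (simple_root rd i) Lmu.
  have := dy i; rewrite evDr mE => y0.
  have /andP[_ lt1] : -1 < ev (a i) (hw *m c) < 1 by apply: orbit_bound; exists hw.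
  have : -1 < m%:~R :> R.
    by lra.
  by rewrite -[-1]/((-1)%:~R) ltr_int ler0z; lia.
have mi : Defs.mincoset a Phi mu (invmx hw).
  apply/(mincosetP rd _ dmu); split=> //.
  have [_ [_ H1]] := nw_le_dom rd dmu Wi; apply: H1 => be be_ b0 bi.
  pose de := - (be *m invmx hw).
  have de_ : de \in Phi by apply: (phiN rd); apply: (root_weyl rd).
  have de0 : 0 < ev de v0 by rewrite /de evNl evM oppr_gt0.
  have := dom_pos rd dmu de_ de0; rewrite le_eqVlt => /orP[/eqP/esym dmu0|]; last first.
    by rewrite /de evNl evM oppr_gt0.
  have deh x : ev de (hw *m x) = - ev be x by rewrite /de evNl evM (weylK rd).
  have := dom_pos rd dy de_ de0; rewrite evDr dmu0 add0r deh oppr_ge0 => bc0.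
  have [_ [H2 _]] := nw_le_dom rd dc Whw.
  have := H2 (mincoset_nw rd dc mhw) de de_ de0; rewrite !deh oppr_lt0 => /(_ b0).
  by rewrite oppr_lt0 ltNge bc0.
apply: xget_unique => /= [|[mu' hw'] /= [Lmu' dmu' Whw' mi' E]]; first by split.
have Emu : mu' = (hw' *m invmx hw) *m mu.
  by rewrite -mulmxA E mulmxA mulmxV ?mul1mx // (weyl_unit rd).
have muE := dominant_uniq dmu dmu' (weylM Whw' Wi) Emu; rewrite -muE in mi' E *.
by rewrite -(invmxK hw') -(mincoset_uniq rd dmu mi mi' E) invmxK.
Qed.

(** * Inverting the parameters *)

Section Inverse.
Context {H' : algType F} {T' : 'I_r -> H'}.
Variable rq' : H' -> A -> A.
Hypothesis rq'_lin : forall h k f g, rq' h (k *: f + g) = k *: rq' h f + rq' h g.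
Hypothesis rq'_linH : forall k h h' f, rq' (k *: h + h') f = k *: rq' h f + rq' h' f.
Hypothesis rq'1 : forall f, rq' 1 f = f.
Hypothesis rq'M : forall h h' f, rq' (h * h') f = rq' h (rq' h' f).
Hypothesis rq'_T : forall j y,
  tB (coroot (a j)) (rq' (T' j) (xx y) - chi a (tinv t) j (ev (a j) y) *: xx (s_ j *m y)) =
  (tinv t (a j) - (tinv t (a j))^-1) *:
    (xx (y - coroot (a j) *~ Num.floor (ev (a j) y)) - xx y).
Local Notation iota := (wact (A := A) (- 1%:M)).

Lemma rq'0r h : rq' h 0 = 0.
Proof. by have := rq'_lin h (-1) 0 0; rewrite !scaleN1r !addNr. Qed.

Lemma iota_x y : iota (xx y) = xx (- y).
Proof. by rewrite wact_x mulNmx mul1mx. Qed.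

Lemma floorN (b : R) : Num.floor (- b) =
  if b \is a Num.int then - Num.floor b else - Num.floor b - 1.
Proof.
case: ifP => [/intrP[m ->]|nb]; first by rewrite -mulrNz !intrKfloor.
have fb := floor_le b; have lb := floorD1_gt b.
apply: floor_def; rewrite subrK; apply/andP; split.
  by rewrite -opprD mulrNz lerN2 ltW.
rewrite mulrNz ltrN2 lt_neqAle fb andbT; apply/eqP => E.
by move: nb; rewrite -E intr_int.
Qed.

Lemma tBN al f : iota (tB al f) = tB (- al) (iota f).
Proof. by rewrite /tB linearB /= wact_tr mulNmx mul1mx. Qed.

Lemma tBNE al f : tr al (tB (- al) f) = - tB al f.
Proof. by rewrite /tB linearB /= trD subrr tr0 opprB. Qed.

(** Both sides are compared on monomials after multiplication by x^al - 1. At integral b the factors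
    t and t^-1 of [chi] differ by t - t^-1, which accounts for T_j^-1 in place of T_j; otherwise
    floor(-b) = - floor b - 1 makes the quotients agree. *)
Lemma iota_T j m : iota (rq' (T' j) (iota m)) = rq (Ti a T t j) m.
Proof.
elim/free_ind: m => [|k y m IH]; first by rewrite linear0 rq'0r rq0r linear0.
rewrite wactP rq'_lin wactP IH rq_lin; congr (_ *: _ + _).
rewrite iota_x /Ti rqDl -scaleNr rqZl rq1.
set b := ev (a j) y; set al := coroot (a j).
pose ch b := chi a t j b; pose ch' b := chi a (tinv t) j b.
have yE : xx (s_ j *m y) = iota (xx (s_ j *m (- y))) by rewrite iota_x mulmxN opprK.
(* iota turns the denominator into x^-al - 1. Translating by [al] restores x^al - 1 up to sign,
   whence the extra [al] in the exponents. *)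
have E1 : tB al (iota (rq' (T' j) (xx (- y))) - ch' (- b) *: xx (s_ j *m y)) =
    q j *: (xx (y + al *~ Num.floor (- b) + al) - xx (y + al)).
  have := rq'_T j (- y); rewrite evNr -/b -/al -/(ch' (- b)).
  move=> /(congr1 (fun h => - tr al (iota h))); rewrite tBN tBNE opprK.
  rewrite linearB linearZ /= -yE => ->.
  rewrite !(linearZ, linearB) /= !iota_x !tr_x (opprD (- y)) !opprK /tinv invrK.
  by apply: fcoef_inj => z; rewrite !(linearD, linearB, linearN, linearZ) /=; ring.
have E2 := rq_T j y; rewrite -/b -/al in E2.
have chb : ch b - ch' (- b) = if b \is a Num.int then q j else 0.
  by rewrite /ch /ch' /chi rpredN; case: ifP; rewrite ?subrr.
apply: (tB_inj (coroot_nz j)); rewrite -/al.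
move: E1; move D2E: (iota _ - _) => D2 E1.
have {D2E} -> : iota (rq' (T' j) (xx (- y))) = D2 + ch' (- b) *: xx (s_ j *m y).
  by rewrite -D2E subrK.
move: E2; move D1E: (rq _ _ - _) => D1 E2.
have {D1E} -> : rq (T j) (xx y) = D1 + ch b *: xx (s_ j *m y) by rewrite -D1E subrK.
rewrite !linearD /= E1 E2.
have -> : ch b = ch' (- b) + (if b \is a Num.int then q j else 0).
  by rewrite -chb addrC subrK.
rewrite floorN !linearZ /=; case: ifP => [/intrP[m' bE]|nb].
  have fE : Num.floor b = m' by rewrite bE intrKfloor.
  have syE : s_ j *m y = y - al *~ m' by rewrite reflE -/b bE scaler_int.
  rewrite fE /tB !tr_x syE mulrNz.
  move: (xx (y - al *~ m' + al)) (xx (y - al *~ m')) (xx (y + al)) (xx y) (ch' _) (q j).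
  move=> x1 x2 x3 x4 k1 k2.
  by apply: fcoef_inj => z; rewrite !(linearD, linearB, linearN, linearZ) /=; ring.
have -> : y + al *~ (- Num.floor b - 1) + al = y - al *~ Num.floor b.
  by rewrite mulrzBr mulr1z mulrNz addrA subrK.
rewrite /tB !tr_x.
move: (xx (y - al *~ Num.floor b)) => x1.
move: (xx (y + al)) (xx (s_ j *m y + al)) (xx (s_ j *m y)) (xx y) => x2 x3 x4 x5.
move: (ch' _) (q j) => k1 k2.
by apply: fcoef_inj => z; rewrite !(linearD, linearB, linearN, linearZ) /=; ring.
Qed.

Lemma iota_word s m : iota (rq' (\prod_(j <- s) T' j) (iota m)) =
  rq (\prod_(j <- s) Ti a T t j) m.
Proof.
elim: s m => [|j s IH] m; first by rewrite !big_nil rq'1 rq1 wact_neg_neg.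
by rewrite !big_cons rq'M rqM -IH -iota_T wact_neg_neg.
Qed.

Lemma hinv_Tw_inv w : W w -> hinv (Tw (invmx w)) = \prod_(j <- redword a w) Ti a T t j.
Proof.
move=> Ww; have rs := redword_reduced rd Ww.
rewrite -{1}(word_redword rd Ww) -(word_rev rd) (Tw_word rd braid) ?(reduced_rev rd) //.
have [TiT TTi] := (TiT rd quad t0, TTi rd quad t0).
elim: (redword a w) => [|j s IH]; first by rewrite !big_nil; apply: hinvE; rewrite mulr1.
have inv s' : \prod_(k <- rev s') T k * \prod_(k <- s') Ti a T t k = 1 /\
    \prod_(k <- s') Ti a T t k * \prod_(k <- rev s') T k = 1.
  elim: s' => [|k s' [h1 h2]]; first by rewrite !big_nil mulr1.
  rewrite rev_cons -cats1 big_cat big_seq1 big_cons; split.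
    by rewrite -mulrA (mulrA (T k)) TTi mul1r h1.
  by rewrite -mulrA (mulrA _ _ (T k)) h2 mul1r TiT.
by have [h1 h2] := inv (j :: s); apply: hinvE.
Qed.

Lemma iota_sym (e e' : 'rV[R]_n -> F) m :
  weyl_inv_weight (Phi := Phi) e ->
  (forall j, e (a j) * e (a j) = q j * e (a j) + 1) ->
  (forall w, tlen a e' w = (tlen a e w)^-1) ->
  iota (rq' (symmetrizer a T' e' W) (iota m)) =
  (tlen a e w0)^-1 ^+ 2 *: rq (symmetrizer a T e W) m.
Proof.
move=> eW eq ee'; have fW := finite_weyl rd.
have := sym_inv rd (@dominant0 R n r a) braid quad t0 eW eq; rewrite stab0 => E.
rewrite -rqZl -E rq_fsum //.
have rq'0l f : rq' 0 f = 0 by have := rq'_linH (-1) 0 0 f; rewrite !scaleN1r !addNr.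
have rq'Dl h h' f : rq' (h + h') f = rq' h f + rq' h' f.
  by have := rq'_linH 1 h h' f; rewrite !scale1r.
rewrite /symmetrizer (fsum_morph (f := fun h => iota (rq' h (iota m)))) //.
- apply: eq_fsum => w Ww; rewrite rqZl hinv_Tw_inv // -iota_word ee'.
  by have := rq'_linH (tlen a e w)^-1 (Defs.Tw a T' w) 0 (iota m);
    rewrite rq'0l !addr0 => ->; rewrite linearZ.
- by rewrite rq'0l linear0.
- by move=> h h'; rewrite rq'Dl linearD.
Qed.

Lemma iota_qp_plus :
  iota (rq' (symmetrizer a T' (tinv t) W) (xx (- (mu + hw *m c)))) =
  \sum_(w \in mincoset) gprod ((tlen a t w0)^-1 *: wact w0 (pi (hinv (Tw (invmx (w0 *m w))))
    (pi (symmetrizer a T t Wc * Tw (invmx hw)) (xx mu)))) (xx (w *m c)).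
Proof.
rewrite -iota_x (iota_sym _ tW t_sq (tlen_inv_fun _)) qp_plus_formula.
have fm := finite_mincoset rd (c := c); rewrite !fsum_scaler //.
apply: eq_fsum => w mw; rewrite -!gprodZl; congr (gprod _ _).
have Lx := FL_x Lmu; rewrite /coef_plus -mulrA piM // !scalerA; congr (_ *: _).
by rewrite expr2 mulfVK ?(tl_neq0 t_sq).
Qed.

Lemma iota_qp_minus :
  iota (rq' (antisymmetrizer a T' (tinv t) W) (xx (- (mu + hw *m c)))) =
  \sum_(w \in mincoset) gprod
    (((-1) ^+ (len hw + len w) * tlen a t w0c ^+ 2 * tlen a t w0) *:
      iota (wact w0 (pi (Tw (w0 *m w))
        (pi (antisymmetrizer a T t Wc * hinv (Tw hw)) (iota (xx mu)))))) (xx (w *m c)).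
Proof.
rewrite -iota_x.
(* At parameters t^-1 the antisymmetric weight is -t, the inverse of [anti_weight], as [iota_sym]
   requires. *)
have -> : antisymmetrizer a T' (tinv t) W =
    symmetrizer a T' (fun be => - (tinv t be)^-1) W.
  by apply: eq_fsum => v _; rewrite tlen_neg_inv.
have ee' v : tlen a (fun be => - (tinv t be)^-1) v = (tlen a anti_weight v)^-1.
  rewrite /anti_weight !tlen_neg_inv tlen_inv_fun invfM !invrK; congr (_ * _).
  by rewrite -exprVn invrN1.
rewrite (iota_sym _ anti_weightW anti_weight_sq ee') -antisymmetrizerE qp_minus_formula.
have fm := finite_mincoset rd (c := c); rewrite !fsum_scaler //.
apply: eq_fsum => w mw; rewrite -!gprodZl; congr (gprod _ _).
have Lnx := FL_neg (FL_x Lmu).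
have Lp : FL (pi (hinv (Tw hw)) (iota (xx mu))) by apply: pi_stable.
rewrite /coef_minus !piM // !scalerA exprD; congr (_ *: _).
rewrite /anti_weight tlen_neg_inv.
have t1 := tl_neq0 t_sq w0.
(* This scalar from [iota_sym] converts the denominator t(w0) of the formula for p^- into a factor
   t(w0). *)
have -> : ((-1) ^+ len w0 / tlen a t w0)^-1 ^+ 2 = tlen a t w0 ^+ 2.
  by rewrite invfM invrK exprMn exprVn -exprM mulnC exprM sqrrN !expr1n invr1 mul1r.
move: t1; move: (tlen a t w0) (tlen a t w0c) => x y x0.
by move: (_ ^+ len hw) (_ ^+ len w) => s1 s2; field.
Qed.

End Inverse.

End Formula.

End QuasiPolynomials.

(** * The algebra {malg F['cV[R]_n]} *)

Lemma gprod_tB (R : realType) n (F : fieldType) (A : freeModule R n F) al (u : A) :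
  gprod u (fx A al - fx A 0) = tB al u.
Proof. by rewrite linearB /= !gprod_xr tr0. Qed.

Section Galg.
Context {R : realType} {n : nat} {F : fieldType}.
Local Notation V := 'cV[R]_n.
Local Notation G := (galg R n F).
Implicit Types (f g h : G) (y z : V) (k : F) (Q : V -> G).

(* Sealed, so that conversion does not unfold linear extensions to sums over
   finite supports. *)
Fact lext_subproof : {L : (V -> G) -> G -> G |
  forall Q f, L Q f = \sum_(y <- msupp f) f@_y *: Q y}.
Proof. by exists (fun Q f => \sum_(y <- msupp f) f@_y *: Q y). Qed.

Definition lext := sval lext_subproof.

Lemma lextE Q f : lext Q f = \sum_(y <- msupp f) f@_y *: Q y.
Proof. exact: (svalP lext_subproof). Qed.

Lemma mcoeff_xx y z : (xx y : G)@_z = (y == z)%:R.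
Proof. by rewrite /xx mcoeffU. Qed.

Lemma lext_wide Q f (D : {fset V}) : (msupp f `<=` D)%fset ->
  lext Q f = \sum_(y <- D) f@_y *: Q y.
Proof.
move=> sD; rewrite lextE (big_fset_incl _ sD) // => y _ yf.
by rewrite mcoeff_outdom // scale0r.
Qed.

Lemma lextP Q k f g : lext Q (k *: f + g) = k *: lext Q f + lext Q g.
Proof.
pose D := (msupp f `|` msupp g `|` msupp (k *: f + g))%fset.
have sf : (msupp f `<=` D)%fset by rewrite /D -fsetUA fsubsetUl.
have sg : (msupp g `<=` D)%fset by rewrite /D (fsetUC (msupp f)) -fsetUA fsubsetUl.
have sfg : (msupp (k *: f + g) `<=` D)%fset by rewrite /D fsubsetUr.
rewrite (lext_wide Q sf) (lext_wide Q sg) (lext_wide Q sfg).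
rewrite scaler_sumr -big_split /=; apply: eq_bigr => y _.
by rewrite mcoeffD mcoeffZ scalerDl scalerA.
Qed.

Lemma lext_xx Q y : lext Q (xx y) = Q y.
Proof. by rewrite lextE [xx y]/xx msuppU oner_eq0 big_seq_fset1 mcoeffUU scale1r. Qed.

Lemma galg_sum f : f = \sum_(y <- msupp f) f@_y *: xx y.
Proof.
rewrite [LHS]monalgE; apply: eq_bigr => y _; apply/malgP => z.
by rewrite [LHS]mcoeffU mcoeffZ mcoeff_xx mulr_natr.
Qed.

Lemma galg_ind (P : G -> Prop) : P 0 ->
  (forall k y f, P f -> P (k *: xx y + f)) -> forall f, P f.
Proof.
move=> P0 PS f; rewrite (galg_sum f); elim: (enum_fset (msupp f)) => [|y s IH].
  by rewrite big_nil.
by rewrite big_cons; apply: PS.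
Qed.

Lemma mcoeffP y k f g : (k *: f + g)@_y = k * f@_y + g@_y.
Proof. by rewrite mcoeffD mcoeffZ. Qed.

Lemma mcoeff_inj f g : (forall y, f@_y = g@_y) -> f = g.
Proof. by move=> h; apply/malgP. Qed.

Definition malgFM : freeModule R n F :=
  @FreeModule R n F {malg F['cV[R]_n]} (@xx R n F) lext (fun y f => f@_y)
   lextP lext_xx mcoeffP mcoeff_xx mcoeff_inj galg_ind.

Lemma fextE Q f : @fext R n F malgFM Q f = \sum_(y <- msupp f) f@_y *: Q y.
Proof. exact: lextE. Qed.

Lemma gmulE f g : gmul f g = @gprod R n F malgFM f g.
Proof.
rewrite /gmul /gprod fextE; apply: eq_bigr => y _.
rewrite /tr fextE scaler_sumr; apply: eq_bigr => z _.
by rewrite scalerA addrC.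
Qed.

Lemma gactE w f : gact w f = @wact R n F malgFM w f.
Proof. by rewrite /gact /gmap /wact fextE. Qed.

Lemma iota_algE f : iota_alg f = @wact R n F malgFM (- 1%:M) f.
Proof.
by rewrite /iota_alg /gmap /wact fextE; apply: eq_bigr => y _; rewrite mulNmx mul1mx.
Qed.

Lemma gsubE (S : set V) : gsub S = @fsupp R n F malgFM S.
Proof.
apply/seteqP; split=> f Sf y; first by move=> fy; apply: Sf; rewrite -mcoeff_neq0.
by rewrite -mcoeff_neq0 => fy; apply: Sf.
Qed.

Lemma gdivE al f h : al != 0 -> @tB R n F malgFM al h = f ->
  gdiv f (xx al - xx 0) = h.
Proof.
move=> al0 hE.
have mulE (u : malgFM) : gmul u (xx al - xx 0) = tB al u.
  by rewrite gmulE; apply: (gprod_tB (A := malgFM)).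
apply: xget_unique => [|u /=]; first by rewrite /= mulE.
by rewrite mulE -hE; apply: (@tB_inj _ _ _ malgFM al al0 u h).
Qed.

End Galg.

(** * Divided differences and the cross relation on F[Lam] *)

Section Nabla.
Context {R : realType} {n : nat} {Phi : {fset 'rV[R]_n}}.
Context {r : nat} {a : 'I_r -> 'rV[R]_n} {v0 : 'cV[R]_n} {F : fieldType}.
Hypothesis rd : root_datum Phi a v0.
Context {A : freeModule R n F} {Lam : set 'cV[R]_n}.
Hypothesis LamD : forall x y, Lam x -> Lam y -> Lam (x + y).
Hypothesis LamN : forall x, Lam x -> Lam (- x).
Hypothesis Lam_coroot : forall be, be \in Phi -> Lam (coroot be).
Hypothesis Lam_int : forall be lam, be \in Phi -> Lam lam -> ev be lam \is a Num.int.

Lemma nabla_exists j (f : A) : fsupp Lam f -> exists2 h : A, fsupp Lam h &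
  tB (coroot (a j)) h = wact (refl (a j)) f - f.
Proof.
have aj := simple_root rd j; have Lc := Lam_coroot aj.
move: f; apply: fsupp_ind => [|k y f Ly _ [h Lh hE]].
  by exists 0; [exact: fsupp0 | rewrite !linear0 ?oppr0 ?addr0].
have /intrP[m mE] := Lam_int aj Ly.
have [u Lu uE] : exists2 u : A, fsupp Lam u &
    tB (coroot (a j)) u = fx A (y - coroot (a j) *~ m) - fx A y.
  by apply: tB_exists => // z Lz; apply: LamD => //; apply: LamN.
exists (k *: u + h); first exact: fsuppZD.
rewrite linearP /= hE uE wactP wact_x reflE mE scaler_int.
by rewrite opprD addrACA scalerBr.
Qed.

Hypothesis Lam0 : Lam 0.
Variable nab : 'I_r -> A -> A.
Hypothesis nabP : forall j f, fsupp Lam f ->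
  fsupp Lam (nab j f) /\ tB (coroot (a j)) (nab j f) = wact (refl (a j)) f - f.
Context {H : algType F} {T : 'I_r -> H} {X : 'cV[R]_n -> H} {t : 'rV[R]_n -> F}.
Variables (XX : A -> H) (rq : H -> A -> A).
Hypothesis rq_lin : forall h k f g, rq h (k *: f + g) = k *: rq h f + rq h g.
Hypothesis rq_linH : forall k h h' f, rq (k *: h + h') f = k *: rq h f + rq h' f.
Hypothesis rqM : forall h h' f, rq (h * h') f = rq h (rq h' f).
Hypothesis rq_X : forall lam y, Lam lam -> rq (X lam) (fx A y) = fx A (lam + y).
Lemma rep_x_tr lam m : Lam lam -> rq (X lam) m = tr lam m.
Proof.
have rq0 h : rq h 0 = 0.
  by have := rq_lin h (-1) 0 0; rewrite !scaleN1r !addNr.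
move=> Ll; elim/free_ind: m => [|k y m IH]; first by rewrite rq0 linear0.
by rewrite rq_lin IH rq_X // trP tr_x [lam + y]addrC.
Qed.

Lemma rep_x_sum (I : Type) (s : seq I) (G : I -> F) (lam : I -> 'cV[R]_n) m :
  (forall i, Lam (lam i)) ->
  rq (\sum_(i <- s) G i *: X (lam i)) m = \sum_(i <- s) G i *: tr (lam i) m.
Proof.
move=> Ll; elim: s => [|i s IH].
  rewrite !big_nil; have := rq_linH (-1) 0 0 m.
  by rewrite !scaleN1r !addNr.
by rewrite !big_cons rq_linH IH rep_x_tr.
Qed.

Hypothesis XXP : forall f m, fsupp Lam f -> rq (XX f) m = gprod f m.
Hypothesis cross : forall j lam, Lam lam ->
  T j * X lam - X (refl (a j) *m lam) * T j =
  (t (a j) - (t (a j))^-1) *: XX (nab j (fx A lam)).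

(** By linearity in [f] it suffices to treat a monomial, where this is the cross relation of the
    Hecke algebra read through [rq]; [XX] stands for the map sending a polynomial to its element of
    the algebra. *)
Lemma rep_cross j f m : fsupp Lam f -> rq (T j) (gprod f m) =
  gprod (wact (refl (a j)) f) (rq (T j) m) +
  (t (a j) - (t (a j))^-1) *: gprod (nab j f) m.
Proof.
have rq0 h : rq h 0 = 0.
  by have := rq_lin h (-1) 0 0; rewrite !scaleN1r !addNr.
move: f; apply: fsupp_ind => [|k y f Ly Lf IH].
  by rewrite (nab0 rd nabP) linear0 !gprod0l rq0 scaler0 addr0.
have Lx := fsupp_x (A := A) Ly; have [LN _] := nabP j Lx.
have Lsy : Lam (refl (a j) *m y).
  exact: (Lam_weyl LamD LamN Lam_coroot Lam_int Lam0 (weyl_s rd j) Ly).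
rewrite !(nab_lin rd nabP) // wactP wact_x !gprodPl rq_lin IH.
have -> : rq (T j) (gprod (fx A y) m) = gprod (fx A (refl (a j) *m y)) (rq (T j) m) +
    (t (a j) - (t (a j))^-1) *: gprod (nab j (fx A y)) m.
  rewrite !gprod_xl -!rep_x_tr // -!rqM -XXP //.
  have /(canRL (subrK _)) -> := cross j Ly.
  by rewrite rq_linH addrC.
by rewrite !scalerDr !scalerA [k * _]mulrC addrACA.
Qed.

End Nabla.

(** * Points of C^0 *)

Section Alcove.
Context {R : realType} {n : nat} {Phi : {fset 'rV[R]_n}}.
Context {r : nat} {a : 'I_r -> 'rV[R]_n} {v0 : 'cV[R]_n}.
Hypothesis rd : root_datum Phi a v0.
Context {Lam : set 'cV[R]_n} {c : 'cV[R]_n}.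

Lemma inIntSpan_subgroup m (s : m.-tuple 'cV[R]_n) :
  [/\ inIntSpan s 0, forall x y, inIntSpan s x -> inIntSpan s y -> inIntSpan s (x + y)
    & forall x, inIntSpan s x -> inIntSpan s (- x)].
Proof.
split=> [|x y [k ->] [l ->]|x [k ->]].
- by exists [ffun=> 0]; rewrite big1 // => i _; rewrite ffunE mulr0z.
- exists [ffun i => k i + l i]; rewrite -big_split /=; apply: eq_bigr => i _.
  by rewrite ffunE mulrzDr.
- exists [ffun i => - k i]; rewrite -sumrN; apply: eq_bigr => i _.
  by rewrite ffunE mulrNz.
Qed.

Lemma Qvee_coroot be : be \in Phi -> Qvee Phi (coroot be).
Proof.
move=> be_; rewrite /Qvee /=.
have cb : coroot be \in [seq coroot al | al <- Phi] by apply: map_f.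
move: cb; set s := [seq _ | _ <- _] => /[dup] cb; rewrite -index_mem => ib.
exists [ffun i : 'I_(size s) => (i == Ordinal ib)%:Z].
rewrite (bigD1 (Ordinal ib)) //= ffunE eqxx mulr1z nth_index // big1 ?addr0 // => i /negPf ni.
by rewrite ffunE ni mulr0z.
Qed.

Hypothesis Lam_coroot : forall be, be \in Phi -> Lam (coroot be).
Hypothesis c0 : C0 a Phi Lam c.

Lemma C0_dominant : dominant a c.
Proof.
move=> i; have [/(_ (a i)) + _] := c0.
move=> h; have /h/andP[] // : positive_root a Phi (a i).
by apply: (posP rd); [exact: (simple_root rd) | rewrite (rd_v0 rd)].
Qed.

(** If [be] took the value 1 at [c], the reflection in [be] followed by translation by its coroot
    would fix [c], although the stabilizer of [c] contains only pairs with zero translation. *)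
Lemma C0_lt1 be : be \in Phi -> ev be c < 1.
Proof.
move=> be_; case: (ltrP 0 (ev be v0)) => [b0|nb]; last first.
  have nbe := phiN rd be_; have nb' : 0 < ev (- be) v0.
    by rewrite evNl oppr_gt0 lt_def nb eq_sym (root_v0_neq0 rd).
  have := dom_pos rd C0_dominant nbe nb'; rewrite evNl oppr_ge0 => h.
  exact: le_lt_trans h ltr01.
have [al cE] := c0; have /al/andP[_] := posP rd be_ b0.
rewrite le_eqVlt => /orP[/eqP e1|//].
have : [set p | p.1 = 0 /\ stab Phi c p.2] (coroot be, refl be).
  rewrite -cE /=; split; [exact: Lam_coroot | exact: weyl_refl |].
  by rewrite reflE e1 scale1r addrC subrK.
move=> [/= cb0 _]; have := ev_corootxx (root_nz rd be_).
by rewrite cb0 ev0r => /eqP; rewrite eq_sym pnatr_eq0.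
Qed.

Lemma C0_free lam w : Lam lam -> weyl Phi w -> lam + w *m c = c -> lam = 0.
Proof.
move=> Ll Ww E; have [_ cE] := c0.
have : [set p | p.1 = 0 /\ stab Phi c p.2] (lam, w) by rewrite -cE.
by case.
Qed.

End Alcove.

Section Instance.
Context {R : realType} {n : nat} {F : fieldType}.
Context {Phi : {fset 'rV[R]_n}} {r : nat} {a : 'I_r -> 'rV[R]_n} {v0 : 'cV[R]_n}.
Hypothesis rd : root_datum Phi a v0.
Context {Lam : set 'cV[R]_n}.
Hypothesis LamD : forall x y, Lam x -> Lam y -> Lam (x + y).
Hypothesis LamN : forall x, Lam x -> Lam (- x).
Hypothesis Lam_coroot : forall be, be \in Phi -> Lam (coroot be).
Hypothesis Lam_int : forall be lam, be \in Phi -> Lam lam -> ev be lam \is a Num.int.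
Hypothesis Lam0 : Lam 0.
Local Notation A := (@malgFM R n F).

Lemma nablaP j (f : A) : fsupp Lam f -> fsupp Lam (nabla a j f : A) /\
  tB (coroot (a j)) (nabla a j f : A) = wact (refl (a j)) f - f.
Proof.
move=> Lf; have [h Lh hE] := nabla_exists rd LamD LamN Lam_coroot Lam_int j Lf.
suff -> : nabla a j f = h by [].
by rewrite /nabla gactE; apply: gdivE => //; apply: (coroot_nz rd).
Qed.

Context {H : algType F} {T : 'I_r -> H} {X : 'cV[R]_n -> H} {t : 'rV[R]_n -> F}.
Variables (rq : H -> galg R n F -> galg R n F).
Hypothesis hr : hecke_relations a Lam t T X.
Hypothesis qr : quasipolynomial_rep a T X Lam t rq.

Lemma qp_rep_T_tB j y :
  @tB R n F A (coroot (a j))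
    (rq (T j) (xx y) - chi a t j (ev (a j) y) *: xx (refl (a j) *m y)) =
  (t (a j) - (t (a j))^-1) *:
    (xx (y - coroot (a j) *~ Num.floor (ev (a j) y)) - xx y).
Proof.
rewrite (qp_rep_T qr); have tT z : [set: 'cV[R]_n] z -> [set: 'cV[R]_n] (z + coroot (a j)) by [].
have [h _ hE] := tB_exists (A := A) (S := setT) (al := coroot (a j)) (y := y)
  (Num.floor (ev (a j) y)) (fun _ _ => I) (fun _ _ => I) I.
rewrite (gdivE (coroot_nz rd j) hE) addrC addKr.
by rewrite -[RHS](congr1 (fun u => _ *: u) hE); apply: linearZ.
Qed.

Let XX (g : A) : H := \sum_(y <- msupp (g : galg R n F)) (g : galg R n F)@_y *: X y.

Lemma qp_rep_x (g p : A) : fsupp Lam g -> rq (XX g) p = gprod g p.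
Proof.
have [_ rlin rlinH r1 rM] := qp_rep qr.
rewrite -(gsubE Lam) => Lg; rewrite /gprod fextE /XX.
(* [rep_x_sum] wants all indices sent into Lam, so exponents outside Lam are replaced by 0; none of
   them occurs in [g]. *)
have [lam lamE Llam] : exists2 lam : 'cV[R]_n -> 'cV[R]_n,
    {in msupp (g : galg R n F), lam =1 id} & forall y, Lam (lam y).
  exists (fun y => if `[< Lam y >] then y else 0) => y; last by case: asboolP.
  by move=> yg; rewrite asboolT //; apply: Lg.
transitivity (rq (\sum_(y <- msupp (g : galg R n F)) (g : galg R n F)@_y *: X (lam y)) p).
  by congr (rq _ p); apply: eq_big_seq => y /lamE ->.
transitivity (\sum_(y <- msupp (g : galg R n F)) (g : galg R n F)@_y *: @tr _ _ _ A (lam y) p).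
  apply: (@rep_x_sum R n F A Lam H X rq (fun h k g g' => rlin h k g g' I I)
    (fun k h h' g => rlinH k h h' g I) (qp_rep_X qr)).
  exact: Llam.
apply: eq_big_seq => y yg.
exact: (congr1 (fun z => _ *: @tr _ _ _ A z p) (lamE y yg)).
Qed.

Lemma qp_rep_cross j (f m : A) : fsupp Lam f -> rq (T j) (gprod f m) =
  gprod (wact (refl (a j)) f) (rq (T j) m : A) +
  (t (a j) - (t (a j))^-1) *: gprod (nabla a j f : A) m.
Proof.
have [_ rlin rlinH r1 rM] := qp_rep qr.
apply: (@rep_cross R n Phi r a v0 F rd A Lam LamD LamN Lam_coroot Lam_int Lam0
  (nabla a) nablaP H T X t XX rq).
- by move=> h k g g'; apply: rlin.
- by move=> k h h' g; apply: rlinH.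
- by move=> h h' g; apply: rM.
- exact: (qp_rep_X qr).
- exact: qp_rep_x.
- exact: (hecke_cross hr).
Qed.

End Instance.

(** [gamma] chooses some expansion of the element, but [cf] reads the same coefficient off every
    expansion, so the choice does not matter. *)
Lemma gamma_sum (R : realType) (n : nat) (F : fieldType) (Phi : {fset 'rV[R]_n})
    (r : nat) (a : 'I_r -> 'rV[R]_n) (v0 : 'cV[R]_n) (Lam : set 'cV[R]_n)
    (c : 'cV[R]_n) (g : 'M[R]_n -> galg R n F) (w : 'M[R]_n) :
  root_datum Phi a v0 ->
  (forall x y, Lam x -> Lam y -> Lam (x + y)) -> (forall x, Lam x -> Lam (- x)) ->
  (forall be, be \in Phi -> Lam (coroot be)) ->
  (forall be lam, be \in Phi -> Lam lam -> ev be lam \is a Num.int) -> Lam 0 ->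
  C0 a Phi Lam c ->
  (forall v, mincoset a Phi c v -> gsub Lam (g v)) -> mincoset a Phi c w ->
  gamma a Phi Lam c w (\sum_(v \in mincoset a Phi c) gmul (g v) (xx (v *m c))) = g w.
Proof.
move=> rd LamD LamN Lc Li L0 c0 Lg mw; rewrite /gamma.
set S := [set _ | _]; have : S (xget (fun=> 0) S) by apply: xgetPex; exists g.
case; move: (xget _ _) => g' Lg' E.
have dc := C0_dominant rd c0.
have cfE (h : 'M[R]_n -> galg R n F) : (forall v, mincoset a Phi c v -> gsub Lam (h v)) ->
    @cf _ _ _ (@malgFM R n F) Lam (w *m c)
      (\sum_(v \in mincoset a Phi c) gmul (h v) (xx (v *m c))) = h w.
  rewrite gsubE => Lh.
  rewrite -[RHS](@cf_sum _ _ _ _ _ _ _ rd (@malgFM R n F) _ LamD LamN Lc Li L0 _ dc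
    (C0_free c0) h w Lh mw).
  congr (cf _ _); apply: eq_fsum => v _; exact: gmulE.
exact: (etrans (esym (cfE g' Lg'))
  (etrans (congr1 (@cf _ _ _ (@malgFM R n F) Lam (w *m c)) (esym E))
  (cfE g Lg))).
Qed.

Theorem corollary5p5 (R : realType) (n : nat) (F : fieldType)
    (Phi : {fset 'rV[R]_n}) (r : nat) (a : 'I_r -> 'rV[R]_n)
    (Lam : set 'cV[R]_n) (t : 'rV[R]_n -> F)
    (* the Hecke algebras with parameters t and t^-1 *)
    (H : algType F) (T : 'I_r -> H) (X : 'cV[R]_n -> H)
    (H' : algType F) (T' : 'I_r -> H') (X' : 'cV[R]_n -> H')
    (rho rhoqp : H -> galg R n F -> galg R n F)
    (rhoqp' : H' -> galg R n F -> galg R n F)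
    (c y mu : 'cV[R]_n) (hw : 'M[R]_n) :
  root_system Phi -> reduced_roots Phi -> irreducible_roots Phi ->
  simple_roots a Phi -> in_calL Phi Lam -> weyl_invariant Phi t ->
  affine_hecke a Lam t T X ->
  polynomial_rep a T X Lam t rho ->
  quasipolynomial_rep a T X Lam t rhoqp ->
  affine_hecke a Lam (tinv t) T' X' ->
  quasipolynomial_rep a T' X' Lam (tinv t) rhoqp' ->
  C0 a Phi Lam c ->
  orbit_set Phi (Qvee Phi) c y ->
  Lam mu -> mincoset a Phi c hw -> y = mu + hw *m c ->
  let w0 := longest a (weyl Phi) in
  let w0c := longest a (stab Phi c) in
  let l := len a in
  let tt := tlen a t in
  [/\ qp_plus a T Phi t rhoqp y =
        tt w0 *: \sum_(w \in mincoset a Phi c)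
          gmul (gact w0
                  (rho (hinv (Tw a T (invmx (w0 *m w)))
                        * symmetrizer a T t (stab Phi c)
                        * Tw a T (invmx hw)) (xx mu)))
               (xx (w *m c)),
      qp_minus a T Phi t rhoqp y =
        ((-1) ^+ l hw * tt w0c ^+ 2 / tt w0) *:
        \sum_(w \in mincoset a Phi c) (-1) ^+ l w *:
          gmul (iota_alg (gact w0
                  (rho (Tw a T (w0 *m w)
                        * antisymmetrizer a T t (stab Phi c)
                        * hinv (Tw a T hw)) (iota_alg (xx mu)))))
               (xx (w *m c))
    & dominant a y -> forall w, mincoset a Phi c w ->
        gamma a Phi Lam c w
            (iota_alg (Ebar_plus a T' Phi (tinv t) rhoqp' (- y))) =
          (tt w0)^-1 *: gact w0
            (rho (hinv (Tw a T (invmx (w0 *m w))))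
               (parab_plus a T Phi Lam t rho (Jfix a c) (invmx hw *m mu)))
        /\
        gamma a Phi Lam c w
            (iota_alg (Ebar_minus a T' Phi (tinv t) rhoqp' (- y))) =
          ((-1) ^+ (l hw + l w)%N * tt w0c ^+ 2 * tt w0) *: iota_alg (gact w0
            (rho (Tw a T (w0 *m w))
               (parab_minus a T Phi Lam t rho (Jfix a c) (invmx hw *m mu))))].
Proof.
move=> rs red _ sim [[m [s LamE]] QL Li] [t0 tinvar] [hr _] pr qr [hr' _] qr' c0 _ Lmu mhw yE.
move=> w0 w0c l tt.
have [v0 v0P] := exists_regular sim; have rd := RootDatum rs red sim v0P.
have [L0 LamD LamN] : [/\ Lam 0, forall x z, Lam x -> Lam z -> Lam (x + z)
    & forall x, Lam x -> Lam (- x)].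
  by rewrite LamE; apply: inIntSpan_subgroup.
have Lc be : be \in Phi -> Lam (coroot be) by move=> be_; apply/QL/Qvee_coroot.
have tW : weyl_inv_weight (Phi := Phi) t.
  move=> be w be_ Ww; have := tinvar be _ be_ (weyl_inv rd Ww).
  by rewrite invmxK.
have dc := C0_dominant rd c0; have clt1 := C0_lt1 rd Lc c0.
have cfree := C0_free c0.
have braid := hecke_braid hr; have quad := hecke_quadratic hr.
pose A := @malgFM R n F.
have nabP := @nablaP R n F Phi r a v0 rd Lam LamD LamN Lc Li.
have := poly_rep pr; rewrite (gsubE Lam) => -[pst plin plinH p1 pM].
have pT := poly_rep_T pr.
have [_ rlin rlinH r1 rM] := qp_rep qr.
have [_ rlin' rlinH' r1' rM'] := qp_rep qr'.
have rT := qp_rep_T_tB rd qr; have rT' := qp_rep_T_tB rd qr'.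
have rX := qp_rep_cross rd LamD LamN Lc Li L0 hr qr.
have pT' j (f : A) : fsupp Lam f -> rho (T j) f = t (a j) *: wact (refl (a j)) f
   + (t (a j) - (t (a j))^-1) *: (nabla a j f : A).
  rewrite -(gsubE Lam) => Lf; apply: (etrans (pT j f Lf)).
  exact: (congr1 (fun u => _ *: u + _) (gactE _ _)).
have Fp := @qp_plus_formula R n Phi r a v0 F rd A Lam LamD LamN Lc Li L0 H T t
  braid quad t0 tW (nabla a) nabP rho pst plin plinH p1 pM pT'
  rhoqp (fun h k f g => rlin h k f g I I) (fun k h h' f => rlinH k h h' f I)
  (fun f => r1 f I) (fun h h' f => rM h h' f I) rX rT c dc clt1 cfree mu hw Lmu mhw.
have Fm := @qp_minus_formula R n Phi r a v0 F rd A Lam LamD LamN Lc Li L0 H T t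
  braid quad t0 tW (nabla a) nabP rho pst plin plinH p1 pM pT'
  rhoqp (fun h k f g => rlin h k f g I I) (fun k h h' f => rlinH k h h' f I)
  (fun f => r1 f I) (fun h h' f => rM h h' f I) rX rT c dc clt1 cfree mu hw Lmu mhw.
have Gp := @iota_qp_plus R n Phi r a v0 F rd A Lam LamD LamN Lc Li L0 H T t
  braid quad t0 tW (nabla a) nabP rho pst plin plinH p1 pM pT'
  rhoqp (fun h k f g => rlin h k f g I I) (fun k h h' f => rlinH k h h' f I)
  (fun f => r1 f I) (fun h h' f => rM h h' f I) rX rT c dc clt1 cfree mu hw Lmu mhw
  H' T' rhoqp' (fun h k f g => rlin' h k f g I I) (fun k h h' f => rlinH' k h h' f I)
  (fun f => r1' f I) (fun h h' f => rM' h h' f I) rT'.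
have Gm := @iota_qp_minus R n Phi r a v0 F rd A Lam LamD LamN Lc Li L0 H T t
  braid quad t0 tW (nabla a) nabP rho pst plin plinH p1 pM pT'
  rhoqp (fun h k f g => rlin h k f g I I) (fun k h h' f => rlinH k h h' f I)
  (fun f => r1 f I) (fun h h' f => rM h h' f I) rX rT c dc clt1 cfree mu hw Lmu mhw
  H' T' rhoqp' (fun h k f g => rlin' h k f g I I) (fun k h h' f => rlinH' k h h' f I)
  (fun f => r1' f I) (fun h h' f => rM' h h' f I) rT'.
rewrite yE; split.
- apply: (etrans Fp); congr (_ *: _); apply: eq_fsum => w _.
  exact: esym (etrans (gmulE _ _) (congr1 (fun u => @gprod _ _ _ A u _) (gactE _ _))).
- apply: (etrans Fm); apply: (congr1 (fun u : A => _ *: u)); apply: eq_fsum => w _.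
  apply: (congr1 (fun u : A => _ *: u)).
  apply: esym (etrans (gmulE _ _) (congr1 (fun u => @gprod _ _ _ A u _) _)).
  apply: (etrans (iota_algE _)); rewrite /coef_minus.
  apply: (congr1 (@wact _ _ _ A _)); apply: (etrans (gactE _ _)).
  exact: (congr1 (fun u => @wact _ _ _ A _ (rho _ u)) (iota_algE _)).
move=> dy w mw; rewrite /parab_plus /parab_minus.
have -> := dominant_dataE rd Li dc clt1 Lmu mhw dy; rewrite (parabolicE rd dc).
have Lx : @fsupp _ _ _ A Lam (xx mu) by apply: (fsupp_x (A := A)).
have LW (f : A) : fsupp Lam f -> fsupp Lam (wact w0 f).
  exact: (FL_wact LamD LamN Lc Li L0 (W_w0 rd)).
have gE (g : 'M[R]_n -> A) : (forall v, mincoset a Phi c v -> fsupp Lam (g v)) ->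
    gamma a Phi Lam c w (\sum_(v \in mincoset a Phi c) gprod (g v) (xx (v *m c) : A)) = g w.
  rewrite -(gsubE Lam) => Lg.
  rewrite -[RHS](gamma_sum rd LamD LamN Lc Li L0 c0 Lg mw).
  apply: (congr1 (gamma a Phi Lam c w)); apply: eq_fsum => v _; exact: esym (gmulE _ _).
split.
- apply: (etrans (congr1 _ (etrans (iota_algE _) Gp))).
  apply: (etrans (gE _ _)) => [v mv|].
    by apply: fsuppZ; apply: LW; apply: (pst); apply: (pst).
  exact: (congr1 (fun u : A => _ *: u) (esym (gactE _ _))).
- apply: (etrans (congr1 _ (etrans (iota_algE _) Gm))).
  apply: (etrans (gE _ _)) => [v mv|].
    apply: fsuppZ; apply: (FL_neg LamN); apply: LW; apply: (pst); apply: (pst).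
    exact: (FL_neg LamN).
  apply: (congr1 (fun u : A => _ *: u)); apply: esym; apply: (etrans (iota_algE _)).
  apply: (congr1 (@wact _ _ _ A _)); apply: (etrans (gactE _ _)).
  exact: (congr1 (fun u => @wact _ _ _ A _ (rho _ (rho _ u))) (iota_algE _)).
Qed.
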